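(* Let $\delta$ be a matrix of free polynomials in $d$ variables and let $I=\{\phi\in H^\infty(G_\delta):\ \phi|_{\mathcal M_1^d}=0\}$. Then $H^\infty(G_\delta)/I$ is isometrically isomorphic to $H^\infty_{\delta,\mathrm{com}}$.
   Context: $\mathcal M^d=\bigcup_n\mathcal M_n^d$ ($d$-tuples of $n\times n$ complex matrices; $\mathcal M_1^d=\mathbb C^d$); $G_\delta=\{M\in\mathcal M^d:\|\delta(M)\|<1\}$. $H^\infty(G_\delta)$ is the Banach algebra of bounded nc-functions on $G_\delta$ (maps $\phi$ with $\phi(x)\in\mathcal M_n$ for $x\in G_\delta\cap\mathcal M_n^d$, $\phi(x\oplus y)=\phi(x)\oplus\phi(y)$, $\phi(s^{-1}xs)=s^{-1}\phi(x)s$ whenever $s$ is invertible and $x,s^{-1}xs\in G_\delta$), with norm $\sup_{x\in G_\delta}\|\phi(x)\|$; the quotient carries the quotient norm. For a holomorphic function $f$ on $G_\delta\cap\mathbb C^d$, $\|f\|_{\delta,\mathrm{com}}=\sup\|f(T)\|$, where $T$ ranges over commuting $d$-tuples in $\mathcal M_n^d$ (any $n$) with $\|\delta(T)\|\le1$ and joint spectrum $\sigma(T)\subseteq G_\delta$, and $f(T)$ is defined by the (Taylor) holomorphic functional calculus; $H^\infty_{\delta,\mathrm{com}}$ is the Banach algebra of holomorphic functions on $G_\delta\cap\mathbb C^d$ with $\|f\|_{\delta,\mathrm{com}}<\infty$. *)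

(* Defs.v *)
From HB Require Import structures.
From mathcomp Require Import all_boot all_order all_algebra.
From mathcomp Require Import complex.
From mathcomp Require Import boolp classical_sets reals.
Set Implicit Arguments. Unset Strict Implicit. Unset Printing Implicit Defensive.
Import Order.TTheory GRing.Theory Num.Theory.
Local Open Scope ring_scope.
Local Open Scope classical_set_scope.

Section Defs.
Variable R : realType.
Local Notation C := (R[i]).

Definition cabs (z : C) : R := Num.sqrt (complex.Re z ^+ 2 + complex.Im z ^+ 2).

Definition vnorm n (v : 'cV[C]_n) : R := Num.sqrt (\sum_i cabs (v i 0) ^+ 2).

Definition opnorm m n (A : 'M[C]_(m, n)) : R :=
  sup [set r | exists v : 'cV[C]_n, vnorm v <= 1 /\ r = vnorm (A *m v)].

(* free (noncommutative) polynomials in d variables: finite sums of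
   coefficient * word *)
Definition ncpoly (d : nat) := seq (C * seq 'I_d).

Definition wordev d n (X : 'I_d -> 'M[C]_n) (w : seq 'I_d) : 'M[C]_n :=
  foldr (fun i M => X i *m M) 1%:M w.

Definition nceval d (P : ncpoly d) n (X : 'I_d -> 'M[C]_n) : 'M[C]_n :=
  \sum_(t <- P) t.1 *: wordev X t.2.

Definition deltaev d p q (delta : 'I_p -> 'I_q -> ncpoly d) n (X : 'I_d -> 'M[C]_n)
  : 'M[C]_(\sum_(i < p) n, \sum_(j < q) n) :=
  @mxblock C p q (fun _ => n) (fun _ => n) (fun i j => nceval (delta i j) X).

Definition inG d p q (delta : 'I_p -> 'I_q -> ncpoly d) n (X : 'I_d -> 'M[C]_n) : Prop :=
  (0 < n)%N /\ opnorm (deltaev delta X) < 1.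

Definition ncfun (d : nat) := forall n, ('I_d -> 'M[C]_n) -> 'M[C]_n.

Definition dsum d m k (x : 'I_d -> 'M[C]_m) (y : 'I_d -> 'M[C]_k) : 'I_d -> 'M[C]_(m + k) :=
  fun i => block_mx (x i) 0 0 (y i).

Definition simil d n (s : 'M[C]_n) (x : 'I_d -> 'M[C]_n) : 'I_d -> 'M[C]_n :=
  fun i => invmx s *m x i *m s.

Definition is_ncfun d p q (delta : 'I_p -> 'I_q -> ncpoly d) (phi : ncfun d) : Prop :=
  (forall m k (x : 'I_d -> 'M[C]_m) (y : 'I_d -> 'M[C]_k),
     inG delta x -> inG delta y ->
     phi (m + k)%N (dsum x y) = block_mx (phi m x) 0 0 (phi k y)) /\
  (forall n (s : 'M[C]_n) (x : 'I_d -> 'M[C]_n),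
     s \in unitmx -> inG delta x -> inG delta (simil s x) ->
     phi n (simil s x) = invmx s *m phi n x *m s).

(* elements of H^infty(G_delta) (represented by total graded functions;
   only their values on G_delta matter) *)
Definition Hinf d p q (delta : 'I_p -> 'I_q -> ncpoly d) (phi : ncfun d) : Prop :=
  is_ncfun delta phi /\
  exists B : R, forall n (x : 'I_d -> 'M[C]_n), inG delta x -> opnorm (phi n x) <= B.

Definition Hnorm d p q (delta : 'I_p -> 'I_q -> ncpoly d) (phi : ncfun d) : R :=
  sup [set r | exists n (x : 'I_d -> 'M[C]_n), inG delta x /\ r = opnorm (phi n x)].

Definition ncadd d (phi psi : ncfun d) : ncfun d := fun n x => phi n x + psi n x.
Definition ncmul d (phi psi : ncfun d) : ncfun d := fun n x => phi n x *m psi n x.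
Definition ncscale d (c : C) (phi : ncfun d) : ncfun d := fun n x => c *: phi n x.
Definition ncone d : ncfun d := fun n x => 1%:M.

Definition scal d (z : 'I_d -> C) : 'I_d -> 'M[C]_1 := fun i => (z i)%:M.

Definition inI d p q (delta : 'I_p -> 'I_q -> ncpoly d) (phi : ncfun d) : Prop :=
  forall x : 'I_d -> 'M[C]_1, inG delta x -> phi 1%N x = 0.

Definition qnorm d p q (delta : 'I_p -> 'I_q -> ncpoly d) (phi : ncfun d) : R :=
  inf [set r | exists psi : ncfun d,
         Hinf delta psi /\ inI delta psi /\ r = Hnorm delta (ncadd phi psi)].

Definition Omega d p q (delta : 'I_p -> 'I_q -> ncpoly d) : set ('I_d -> C) :=
  [set z | inG delta (scal z)].

Definition supn d (h : 'I_d -> C) : R := \big[Num.max/0]_i cabs (h i).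

Definition holo_on d (U : set ('I_d -> C)) (f : ('I_d -> C) -> C) : Prop :=
  forall a, U a -> exists c : 'I_d -> C,
    forall eps : R, 0 < eps -> exists eta : R, 0 < eta /\
      forall h : 'I_d -> C, supn h < eta ->
        cabs (f (fun i => a i + h i) - f a - \sum_i c i * h i) <= eps * supn h.

(* complex partial derivative d/dz_i (chosen classically; 0 if it does not exist) *)
Definition has_pderiv d (i : 'I_d) (f : ('I_d -> C) -> C) (a : 'I_d -> C) (L : C) : Prop :=
  forall eps : R, 0 < eps -> exists eta : R, 0 < eta /\
    forall t : C, t != 0 -> cabs t < eta ->
      cabs ((f (fun j => if j == i then a j + t else a j) - f a) / t - L) < eps.

Definition pderiv d (i : 'I_d) (f : ('I_d -> C) -> C) : ('I_d -> C) -> C :=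
  fun a => xget 0 [set L | has_pderiv i f a L].

Definition pderivs d (w : seq 'I_d) (f : ('I_d -> C) -> C) : ('I_d -> C) -> C :=
  foldr (fun i g => pderiv i g) f w.

(* Taylor polynomial of f at lambda, of order < n, evaluated at the commuting tuple T:
   sum_{k<n} 1/k! sum_{|w|=k} d_w f(lambda) prod_{i in w} (T_i - lambda_i)
   (= sum_{|alpha|<n} d^alpha f(lambda)/alpha! (T - lambda)^alpha for commuting T) *)
Definition taylorM d (f : ('I_d -> C) -> C) (lam : 'I_d -> C) n (T : 'I_d -> 'M[C]_n)
  : 'M[C]_n :=
  \sum_(k < n) (k`!%:R)^-1 *:
     \sum_(w : k.-tuple 'I_d)
        pderivs w f lam *: wordev (fun i => T i - (lam i)%:M) w.

Definition commuting d n (T : 'I_d -> 'M[C]_n) : Prop :=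
  forall i j, T i *m T j = T j *m T i.

Definition jspec d n (T : 'I_d -> 'M[C]_n) : set ('I_d -> C) :=
  [set lam | exists v : 'cV[C]_n, v != 0 /\ forall i, T i *m v = lam i *: v].

(* holomorphic functional calculus for a commuting tuple of matrices:
   on the joint generalized eigenspace of lam, f(T) acts as the Taylor
   polynomial of f at lam; these spaces span C^n, so f(T) is unique *)
Definition fcalc d (f : ('I_d -> C) -> C) n (T : 'I_d -> 'M[C]_n) : 'M[C]_n :=
  xget 0 [set M : 'M[C]_n | forall (lam : 'I_d -> C) (v : 'cV[C]_n),
            (forall i, (T i - (lam i)%:M) ^+ n *m v = 0) ->
            M *m v = taylorM f lam T *m v].

Definition admissible d p q (delta : 'I_p -> 'I_q -> ncpoly d) n (T : 'I_d -> 'M[C]_n)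
  : Prop :=
  (0 < n)%N /\ commuting T /\ opnorm (deltaev delta T) <= 1 /\
  jspec T `<=` Omega delta.

Definition Hcom d p q (delta : 'I_p -> 'I_q -> ncpoly d) (f : ('I_d -> C) -> C) : Prop :=
  holo_on (Omega delta) f /\
  exists B : R, forall n (T : 'I_d -> 'M[C]_n),
     admissible delta T -> opnorm (fcalc f T) <= B.

Definition comnorm d p q (delta : 'I_p -> 'I_q -> ncpoly d) (f : ('I_d -> C) -> C) : R :=
  sup [set r | exists n (T : 'I_d -> 'M[C]_n),
         admissible delta T /\ r = opnorm (fcalc f T)].

(* equality of functions on Omega (elements of H^infty_com are functions on Omega) *)
Definition eqOm d p q (delta : 'I_p -> 'I_q -> ncpoly d) (f g : ('I_d -> C) -> C) : Prop :=
  forall z, Omega delta z -> f z = g z.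

End Defs.

(* Main.v *)
Require Import Defs.
From HB Require Import structures.
From mathcomp Require Import all_boot all_order all_algebra.
From mathcomp Require Import complex.
From mathcomp Require Import boolp classical_sets reals.
From mathcomp Require Import filter ring lra.
Import Order.TTheory GRing.Theory Num.Theory.
Local Open Scope ring_scope.

(* The homomorphism is evaluation at scalar points, phi |-> phi|_{M_1}.

   Restriction does not increase norms. A bounded nc function phi extends to the
   similarity envelope of G_delta, which contains every commuting tuple T with
   joint spectrum in G_delta; by the Taylor expansion of nc functions at scalar
   points, phi(T) is f(T) for the restriction f of phi. If moreover
   ||delta(T)|| <= 1 and T = s x s^-1 with x in G_delta, then the positive P
   with P (x) 1 - delta(T)^* (P (x) 1) delta(T) >= 0 form a convex set that contains 1
   and, with a strict inequality, s^-* s^-1. Factoring P = (1-e) + e s^-* s^-1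
   as r^* r makes r T r^-1 a point of G_delta, and ||phi(T)|| <= sup ||phi|| follows
   as e tends to 0.

   Conversely, let f have norm at most a > 0 on diagonalizable commuting tuples.
   For finitely many scalar points z_k, a separation argument in the Hermitian
   matrices yields vectors with
     a^2 - conj(f(z_i)) f(z_j) - <(1 - delta(z_i)^* delta(z_j)) u_j, u_i>
   positive semidefinite: a separating functional would be a Gram matrix on which
   f(T) violates its norm bound. The lurking isometry argument turns this into a
   contractive matrix whose transfer function is an nc function on G_delta, bounded by a,
   with the values f(z_k). A limit along an ultrafilter on the finite sets of scalar
   points interpolates f everywhere. *)

Set Implicit Arguments.
Unset Strict Implicit.
Unset Printing Implicit Defensive.

(** * Moduli, Frobenius norms and operator norms *)

Section Norms.
Variable R : realType.
Local Notation C := (R[i]).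
Local Notation Rc := (real_complex R).
Implicit Types (x y z : C).

(** An nc function is used through a single property: an intertwining [x S = S y], with [S]
    rectangular, passes to the values. Derivatives are then values as well, namely corners at block
    triangular tuples. [G_delta] need not contain these tuples when the corner is large, which is
    why functions are first extended to the similarity envelope. The extension need not stay
    bounded; the class that survives both the extension and iterated differentiation is that of
    locally bounded functions, and local boundedness already forces continuity. Continuity is what
    identifies the iterated [pderiv] in [fcalc] with nc derivatives. In the converse direction the
    separating functional is only positive semidefinite. A multiple of the identity makes it
    invertible; the error this causes is harmless because [delta] is uniformly strictly contractive
    at finitely many points. The same uniformity bounds the minimizing vectors of the separation
    argument, so that the cone has a point closest to the target. *)

Definition cabs2 (z : C) : R := complex.Re z ^+ 2 + complex.Im z ^+ 2.

Lemma cabs2_ge0 z : 0 <= cabs2 z.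
Proof. by rewrite addr_ge0 ?sqr_ge0. Qed.

Lemma cabs_sqr z : cabs z ^+ 2 = cabs2 z.
Proof. by rewrite sqr_sqrtr ?cabs2_ge0. Qed.

Lemma cabsE z : cabs z = ComplexField.Normc.normc z.
Proof. by case: z. Qed.

Lemma cabs_ge0 z : 0 <= cabs z.
Proof. exact: sqrtr_ge0. Qed.

Lemma cabsD x y : cabs (x + y) <= cabs x + cabs y.
Proof. rewrite !cabsE; exact: le_normcD. Qed.

Lemma cabsM x y : cabs (x * y) = cabs x * cabs y.
Proof. rewrite !cabsE; exact: ComplexField.Normc.normcM. Qed.

Lemma cabsN x : cabs (- x) = cabs x.
Proof. rewrite !cabsE; exact: normcN. Qed.

Lemma cabs0 : cabs (0 : C) = 0.
Proof. rewrite cabsE; exact: ComplexField.Normc.normc0. Qed.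

Lemma cabs_eq0 x : cabs x = 0 -> x = 0.
Proof. rewrite cabsE; exact: ComplexField.Normc.eq0_normc. Qed.

Lemma cabsR (x : R) : cabs (Rc x) = `|x|.
Proof. by rewrite /cabs /= expr0n /= addr0 sqrtr_sqr. Qed.

Lemma cabsV x : cabs x^-1 = (cabs x)^-1.
Proof. rewrite !cabsE; exact: ComplexField.Normc.normcV. Qed.

Lemma cabs_conj x : cabs (conjc x) = cabs x.
Proof. by case: x => a b; rewrite /cabs /= sqrrN. Qed.

Lemma cabs_sum (I : Type) (r : seq I) (P : pred I) (F : I -> C) :
  cabs (\sum_(i <- r | P i) F i) <= \sum_(i <- r | P i) cabs (F i).
Proof.
elim/big_rec2: _ => [|i y x _ le_xy]; first by rewrite cabs0.
by apply: le_trans (cabsD _ _) _; rewrite lerD2l.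
Qed.

Lemma Re_le_cabs z : `|complex.Re z| <= cabs z.
Proof. by rewrite -sqrtr_sqr /cabs ler_wsqrtr // lerDl sqr_ge0. Qed.

Lemma Im_le_cabs z : `|complex.Im z| <= cabs z.
Proof. by rewrite -sqrtr_sqr /cabs ler_wsqrtr // lerDr sqr_ge0. Qed.

Lemma cabs_le_ReIm z : cabs z <= `|complex.Re z| + `|complex.Im z|.
Proof.
case: z => a b /=.
have -> : (a +i* b)%C = Rc a + Rc b * 'i%C by simpc.
have i1 : cabs ('i%C : C) = 1 by rewrite /cabs /= expr0n expr1n /= add0r sqrtr1.
by apply: le_trans (cabsD _ _) _; rewrite cabsM !cabsR i1 mulr1.
Qed.

Lemma cabs2E z : Rc (cabs2 z) = conjc z * z.
Proof. by case: z => a b; rewrite /cabs2; simpc; congr (_ +i* _)%C; ring. Qed.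

Lemma cabs2M x y : cabs2 (x * y) = cabs2 x * cabs2 y.
Proof. by rewrite -!cabs_sqr cabsM exprMn. Qed.

(** Weighted Young inequality. A small [t] lets a bound below 1 survive a perturbation, as in
    [inG_open]. *)
Lemma cabs2D_le t x y : 0 < t ->
  cabs2 (x + y) <= (1 + t) * cabs2 x + (1 + t^-1) * cabs2 y.
Proof.
case: x => a b; case: y => c d t0; rewrite /cabs2 /=.
have key (u v : R) : (u + v) ^+ 2 <= (1 + t) * u ^+ 2 + (1 + t^-1) * v ^+ 2.
  have -> : (1 + t) * u ^+ 2 + (1 + t^-1) * v ^+ 2 =
     (u + v) ^+ 2 + t^-1 * (t * u - v) ^+ 2 by field; rewrite gt_eqF.
  by rewrite lerDl mulr_ge0 ?sqr_ge0 // invr_ge0 ltW.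
by have := key a c; have := key b d; lra.
Qed.

(** The squared Frobenius norm. A bound [nsq (A *m v) <= c * nsq v] for columns passes to matrices
    [v] of any width, one column at a time, and [nsq] is a trace; so operator norms are needed only
    at the interface. *)
Definition nsq m n (A : 'M[C]_(m, n)) : R := \sum_i \sum_j cabs2 (A i j).

Lemma nsq_ge0 m n (A : 'M[C]_(m, n)) : 0 <= nsq A.
Proof. by apply: sumr_ge0 => i _; apply: sumr_ge0 => j _; apply: cabs2_ge0. Qed.

Lemma cabs2_le_nsq m n (A : 'M[C]_(m, n)) i j : cabs2 (A i j) <= nsq A.
Proof.
rewrite /nsq (bigD1 i) //= (bigD1 j) //= -addrA lerDl addr_ge0 //.
  by apply: sumr_ge0 => ? _; apply: cabs2_ge0.
by apply: sumr_ge0 => ? _; apply: sumr_ge0 => ? _; apply: cabs2_ge0.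
Qed.

Lemma cabs2_eq0 z : cabs2 z = 0 -> z = 0.
Proof. by move=> z0; apply: cabs_eq0; rewrite /cabs -/(cabs2 z) z0 sqrtr0. Qed.

Lemma nsq_eq0 m n (A : 'M[C]_(m, n)) : nsq A <= 0 -> A = 0.
Proof.
move=> A0; apply/matrixP => i j; rewrite mxE; apply: cabs2_eq0.
apply/le_anti; rewrite cabs2_ge0 andbT; exact: le_trans (cabs2_le_nsq _ _ _) A0.
Qed.

Lemma nsq0 m n : nsq (0 : 'M[C]_(m, n)) = 0.
Proof.
by rewrite /nsq big1 // => i _; rewrite big1 // => j _; rewrite mxE /cabs2 /= expr0n /= addr0.
Qed.

Lemma nsqZ m n a (A : 'M[C]_(m, n)) : nsq (a *: A) = cabs2 a * nsq A.
Proof.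
rewrite /nsq mulr_sumr; apply: eq_bigr => i _; rewrite mulr_sumr.
by apply: eq_bigr => j _; rewrite mxE cabs2M.
Qed.

Lemma cabs2N z : cabs2 (- z) = cabs2 z.
Proof. by rewrite -!cabs_sqr cabsN. Qed.

Lemma nsqN m n (A : 'M[C]_(m, n)) : nsq (- A) = nsq A.
Proof. by rewrite /nsq; apply: eq_bigr => i _; apply: eq_bigr => j _; rewrite mxE cabs2N. Qed.

Lemma nsq_row_mx m n1 n2 (A : 'M[C]_(m, n1)) (B : 'M[C]_(m, n2)) :
  nsq (row_mx A B) = nsq A + nsq B.
Proof.
rewrite /nsq -big_split; apply: eq_bigr => i _; rewrite big_split_ord /=.
by congr (_ + _); apply: eq_bigr => j _; rewrite ?row_mxEl ?row_mxEr.
Qed.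

Lemma nsq_col_mx m1 m2 n (A : 'M[C]_(m1, n)) (B : 'M[C]_(m2, n)) :
  nsq (col_mx A B) = nsq A + nsq B.
Proof.
rewrite /nsq big_split_ord /=; congr (_ + _); apply: eq_bigr => i _;
  by apply: eq_bigr => j _; rewrite ?col_mxEu ?col_mxEd.
Qed.

Lemma nsq_dlsubmx_le m1 m2 n1 n2 (A : 'M[C]_(m1 + m2, n1 + n2)) :
  nsq (dlsubmx A) <= nsq A.
Proof.
rewrite -[in leRHS](submxK A) block_mxEv nsq_col_mx !nsq_row_mx.
have := nsq_ge0 (ulsubmx A); have := nsq_ge0 (ursubmx A).
have := nsq_ge0 (drsubmx A); lra.
Qed.

Lemma nsq_cols m n (A : 'M[C]_(m, n)) : nsq A = \sum_j nsq (col j A).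
Proof.
rewrite /nsq exchange_big; apply: eq_bigr => j _; apply: eq_bigr => i _.
by rewrite big_ord1 mxE.
Qed.

Lemma nsq_rows m n (A : 'M[C]_(m, n)) : nsq A = \sum_i nsq (row i A).
Proof.
rewrite /nsq; apply: eq_bigr => i _; rewrite big_ord1.
by apply: eq_bigr => j _; rewrite mxE.
Qed.

Lemma nsqD_le t m n (A B : 'M[C]_(m, n)) : 0 < t ->
  nsq (A + B) <= (1 + t) * nsq A + (1 + t^-1) * nsq B.
Proof.
move=> t0; rewrite /nsq !mulr_sumr -big_split; apply: ler_sum => i _ /=.
rewrite !mulr_sumr -big_split; apply: ler_sum => j _ /=.
by rewrite mxE cabs2D_le.
Qed.

Lemma cabs2_sum_le n (F : 'I_n -> C) :
  cabs2 (\sum_i F i) <= n%:R * \sum_i cabs2 (F i).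
Proof.
elim: n F => [|n IHn] F.
  by rewrite !big_ord0 mulr0 /cabs2 /= expr0n /= addr0.
case: n IHn F => [|n] IHn F; first by rewrite !big_ord1 mul1r.
rewrite [\sum_i F i]big_ord_recl [\sum_i cabs2 _]big_ord_recl.
have n0 : 0 < n.+1%:R :> R by rewrite ltr0n.
apply: le_trans (cabs2D_le _ _ n0) _.
have /= := IHn (fun i => F (lift ord0 i)).
set S := cabs2 (\sum_i _); set T := \sum_i cabs2 _ => ST.
rewrite [leRHS]mulrDr -[n.+2%:R]nat1r lerD2l.
apply: (@le_trans _ _ ((1 + n.+1%:R^-1) * (n.+1%:R * T))).
  by rewrite ler_wpM2l // addr_ge0 // invr_ge0 ltW.
by rewrite mulrA mulrDl mul1r mulVf ?gt_eqF // addrC.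
Qed.

(** The factor [n] comes from a sum of [n] terms in place of Cauchy-Schwarz; every use needs only
    some finite constant. *)
Lemma nsq_mulmx_le m n p (A : 'M[C]_(m, n)) (B : 'M[C]_(n, p)) :
  nsq (A *m B) <= n%:R * nsq A * nsq B.
Proof.
set b := nsq B.
have -> : n%:R * nsq A * b = \sum_i n%:R * ((\sum_k cabs2 (A i k)) * b).
  by rewrite -mulrA {1}/nsq [_ * b]mulr_suml mulr_sumr.
apply: ler_sum => i _.
apply: (@le_trans _ _ (\sum_j n%:R * \sum_k cabs2 (A i k * B k j))).
  by apply: ler_sum => j _; rewrite mxE cabs2_sum_le.
rewrite -mulr_sumr ler_wpM2l // exchange_big mulr_suml; apply: ler_sum => k _ /=.
rewrite (eq_bigr _ (fun j _ => cabs2M _ _)) -mulr_sumr ler_wpM2l ?cabs2_ge0 //.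
rewrite /b /nsq [leRHS](bigD1 k) //= lerDl.
by apply: sumr_ge0 => ? _; apply: sumr_ge0 => ? _; apply: cabs2_ge0.
Qed.

Lemma vnormE n (v : 'cV[C]_n) : vnorm v = Num.sqrt (nsq v).
Proof.
by rewrite /vnorm /nsq; congr Num.sqrt; apply: eq_bigr => i _; rewrite big_ord1 cabs_sqr.
Qed.

Lemma vnorm_sqr n (v : 'cV[C]_n) : vnorm v ^+ 2 = nsq v.
Proof. by rewrite vnormE sqr_sqrtr ?nsq_ge0. Qed.

Lemma vnorm_ge0 n (v : 'cV[C]_n) : 0 <= vnorm v.
Proof. by rewrite vnormE sqrtr_ge0. Qed.

Section OpNorm.
Variables (m n : nat) (A : 'M[C]_(m, n)).
Let S : set R := [set r | exists v : 'cV[C]_n, vnorm v <= 1 /\ r = vnorm (A *m v)]%classic.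

Let S0 : S 0.
Proof. by exists 0; rewrite mulmx0 !vnormE !nsq0 sqrtr0. Qed.

Let supS : has_sup S.
Proof.
split; first by exists 0.
pose K := n%:R * nsq A; have K0 : 0 <= K by rewrite mulr_ge0 ?nsq_ge0.
exists (1 + K) => r [v [v1 ->]].
rewrite -(ler_pXn2r (n := 2)) ?nnegrE ?vnorm_ge0 ?addr_ge0 // vnorm_sqr.
apply: le_trans (nsq_mulmx_le A v) _; rewrite -/K.
have : nsq v <= 1 by rewrite -vnorm_sqr -[leRHS](expr1n _ 2) ler_pXn2r ?nnegrE ?vnorm_ge0.
by have := nsq_ge0 v; nra.
Qed.

Lemma opnorm_ge0 : 0 <= opnorm A.
Proof. exact: (ub_le_sup supS.2 S0). Qed.

Lemma opnorm_leP B : 0 <= B ->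
  opnorm A <= B <-> forall v : 'cV[C]_n, nsq (A *m v) <= B ^+ 2 * nsq v.
Proof.
move=> B0; split=> [AB v|AB]; last first.
  apply: ge_sup; first by exists 0.
  move=> r [v [v1 ->]].
  rewrite -(ler_pXn2r (n := 2)) ?nnegrE ?vnorm_ge0 // vnorm_sqr.
  apply: le_trans (AB v) _; rewrite -vnorm_sqr -[leRHS]mulr1 ler_wpM2l ?sqr_ge0 //.
  by rewrite -[leRHS](expr1n _ 2) ler_pXn2r ?nnegrE ?vnorm_ge0.
have [v0|v0] := ltP 0 (nsq v); last first.
  by rewrite (nsq_eq0 v0) mulmx0 !nsq0 mulr0.
pose t := Num.sqrt (nsq v).
have t0 : 0 < t by rewrite sqrtr_gt0.
have tt : t ^+ 2 = nsq v by rewrite sqr_sqrtr // ltW.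
pose u : 'cV[C]_n := Rc t^-1 *: v.
have ct : cabs2 (Rc t^-1) = (nsq v)^-1.
  by rewrite -cabs_sqr cabsR ger0_norm ?invr_ge0 ?ltW // exprVn tt.
have : vnorm (A *m u) <= B.
  apply: le_trans AB; apply: (ub_le_sup supS.2); exists u; split => //.
  by rewrite vnormE nsqZ ct mulVf ?gt_eqF // sqrtr1.
rewrite -(ler_pXn2r (n := 2)) ?nnegrE ?vnorm_ge0 // vnorm_sqr -scalemxAr nsqZ ct.
by rewrite mulrC ler_pdivrMr.
Qed.
End OpNorm.

Lemma opnorm_lt1P m n (A : 'M[C]_(m, n)) :
  opnorm A < 1 <->
  exists c, [/\ 0 <= c, c < 1 & forall v : 'cV[C]_n, nsq (A *m v) <= c * nsq v].
Proof.
split=> [A1|[c [c0 c1 Ac]]].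
  exists (opnorm A ^+ 2); split; first exact: sqr_ge0.
    by rewrite expr_lt1 // opnorm_ge0.
  by apply/opnorm_leP; rewrite ?opnorm_ge0.
apply: (@le_lt_trans _ _ (Num.sqrt c)); last by rewrite -sqrtr1 ltr_sqrt.
by apply/opnorm_leP; rewrite ?sqrtr_ge0 // sqr_sqrtr.
Qed.

End Norms.

(** * Adjoints, positive semidefinite factorization, extension of contractions *)

Section Adjoint.
Variable R : realType.
Local Notation C := (R[i]).
Local Notation Rc := (real_complex R).

Definition cadj m n (A : 'M[C]_(m, n)) : 'M[C]_(n, m) := (map_mx (@conjc R) A)^T.

Lemma cadjM m n p (A : 'M[C]_(m, n)) (B : 'M[C]_(n, p)) :
  cadj (A *m B) = cadj B *m cadj A.
Proof. by rewrite /cadj map_mxM trmx_mul. Qed.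

Lemma cadjK m n (A : 'M[C]_(m, n)) : cadj (cadj A) = A.
Proof. by apply/matrixP => i j; rewrite !mxE conjcK. Qed.

Lemma cadjD m n (A B : 'M[C]_(m, n)) : cadj (A + B) = cadj A + cadj B.
Proof. by rewrite /cadj map_mxD linearD. Qed.

Lemma cadjB m n (A B : 'M[C]_(m, n)) : cadj (A - B) = cadj A - cadj B.
Proof. by rewrite /cadj map_mxB linearB. Qed.

Lemma cadjZ m n a (A : 'M[C]_(m, n)) : cadj (a *: A) = conjc a *: cadj A.
Proof. by rewrite /cadj map_mxZ linearZ. Qed.

Lemma cadj1 n : cadj 1%:M = 1%:M :> 'M[C]_n.
Proof. by rewrite /cadj map_mx1 trmx1. Qed.

Lemma cadj0 m n : cadj (0 : 'M[C]_(m, n)) = 0.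
Proof. by rewrite /cadj map_mx0 trmx0. Qed.

Lemma cadj_col_mx m1 m2 n (X : 'M[C]_(m1, n)) (Y : 'M[C]_(m2, n)) :
  cadj (col_mx X Y) = row_mx (cadj X) (cadj Y).
Proof. by rewrite /cadj map_col_mx tr_col_mx. Qed.

Lemma tr_cadj n (A : 'M[C]_n) : \tr (cadj A) = conjc (\tr A).
Proof. by rewrite mxtrace_tr /mxtrace rmorph_sum; apply: eq_bigr => i _; rewrite mxE. Qed.

Lemma nsqE m n (A : 'M[C]_(m, n)) : Rc (nsq A) = \tr (cadj A *m A).
Proof.
rewrite /nsq rmorph_sum /= /mxtrace; under [RHS]eq_bigr do rewrite mxE.
rewrite exchange_big /=; apply: eq_bigr => i _; rewrite rmorph_sum /=.
by apply: eq_bigr => j _; rewrite !mxE cabs2E.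
Qed.

Lemma nsq_trE m n (A : 'M[C]_(m, n)) : nsq A = complex.Re (\tr (cadj A *m A)).
Proof. by rewrite -nsqE. Qed.

Lemma nsq_cadj m n (A : 'M[C]_(m, n)) : nsq (cadj A) = nsq A.
Proof. by rewrite !nsq_trE cadjK mxtrace_mulC. Qed.

Lemma nsq_eq_mul a b m n (A : 'M[C]_(a, m)) (B : 'M[C]_(b, m)) (X : 'M[C]_(m, n)) :
  cadj A *m A = cadj B *m B -> nsq (A *m X) = nsq (B *m X).
Proof.
by move=> AB; rewrite !nsq_trE !cadjM -!mulmxA (mulmxA (cadj A)) AB !mulmxA.
Qed.

Lemma conjCE (x : C) : Num.conj x = conjc x.
Proof.
have [->|x0] := eqVneq x 0; first by rewrite !rmorph0.
apply: (mulfI x0); apply: etrans (esym (normCK x)) _; exact: sqr_normc.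
Qed.

Lemma map_conjCE m n (A : 'M[C]_(m, n)) : map_mx Num.conj (A^T) = cadj A.
Proof. by apply/matrixP => i j; rewrite !mxE conjCE. Qed.

Lemma unitmx_inj n (A : 'M[C]_n) :
  (forall v : 'cV[C]_n, A *m v = 0 -> v = 0) -> A \in unitmx.
Proof.
move=> injA; rewrite -unitmx_tr -row_free_unit -kermx_eq0.
apply/eqP/row_matrixP => i; rewrite row0; apply: trmx_inj; rewrite trmx0.
by apply: injA; apply: trmx_inj; rewrite trmx_mul trmxK trmx0 -row_mul mulmx_ker row0.
Qed.

(** By the spectral theorem [K] is [cadj P *m diag_mx D *m P]; testing positivity on the
    eigenvectors [cadj P *m delta_mx i 0] gives [D >= 0], and the factor is the square root of [D]
    times [P]. *)
Lemma psd_factor n (K : 'M[C]_n) :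
  cadj K = K -> (forall v : 'cV[C]_n, 0 <= complex.Re (\tr (cadj v *m K *m v))) ->
  exists r : 'M[C]_n, cadj r *m r = K.
Proof.
move=> Kh Kpos.
have Khs : K \is hermsymmx.
  by apply/is_hermitianmxP; rewrite expr0 scale1r map_conjCE Kh.
have Pu := spectral_unitarymx K; have dr := hermitian_spectral_diag_real Khs.
have /orthomx_spectralP := hermitian_normalmx Khs.
move: (spectralmx K) (spectral_diag K) Pu dr => P D Pu dr.
rewrite invmx_unitary // map_conjCE => KE.
have PP : P *m cadj P = 1%:M by rewrite -map_conjCE; apply/unitarymxP.
have Dpos i : 0 <= D 0 i.
  have /mxOverP/(_ 0 i)/complex_realP[x Dx] := dr.
  have := Kpos (cadj P *m delta_mx i 0); rewrite KE cadjM cadjK.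
  rewrite !mulmxA -(mulmxA _ P) PP mulmx1 -!mulmxA (mulmxA P) PP mul1mx.
  rewrite mul_diag_mx /mxtrace big_ord1 mxE (bigD1 i) //= big1 ?addr0 => [|j ji].
    by rewrite !mxE !eqxx andbT conjc_nat mulr1 mul1r Dx ler0c.
  by rewrite !mxE (negPf ji) /= !mulr0.
pose s : 'rV[C]_n := \row_i Rc (Num.sqrt (complex.Re (D 0 i))).
exists (diag_mx s *m P); rewrite cadjM [in RHS]KE -!mulmxA; congr (_ *m _).
rewrite mulmxA; congr (_ *m _); rewrite /cadj map_diag_mx tr_diag_mx mulmx_diag.
congr diag_mx; apply/rowP => i; rewrite !mxE.
rewrite [X in X * _](conjc_real (Num.sqrt (complex.Re (D 0 i)))) -rmorphM -expr2 /=.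
have := Dpos i; case: (D 0 i) => a b; rewrite lecE /= => /andP[/eqP-> a0].
by rewrite sqr_sqrtr.
Qed.

Lemma gram_factor m n (W : 'M[C]_(m, n)) : exists r : 'M[C]_n, cadj r *m r = cadj W *m W.
Proof.
apply: psd_factor; first by rewrite cadjM cadjK.
by move=> v; rewrite !mulmxA -cadjM -mulmxA -nsq_trE nsq_ge0.
Qed.

(** Pythagoras: [cadj Q *m Q] is an orthogonal projection, and the defect is the squared norm of the
    complementary part. *)
Lemma nsq_proj_le m n r (Y : 'M[C]_(m, n)) (Q : 'M[C]_(r, n)) :
  Q *m cadj Q = 1%:M -> nsq (Y *m cadj Q *m Q) <= nsq Y.
Proof.
move=> QQ; rewrite -subr_ge0.
suff -> : nsq Y - nsq (Y *m cadj Q *m Q) = nsq (Y - Y *m cadj Q *m Q) by exact: nsq_ge0.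
rewrite -(nsq_cadj Y) -(nsq_cadj (Y *m _ *m _)) -(nsq_cadj (Y - _)) !nsq_trE !cadjK.
rewrite cadjB !cadjM cadjK -raddfB /=; congr (complex.Re _).
rewrite mulmxBr !mulmxBl -linearB /=; congr (\tr _).
rewrite !mulmxA -!(mulmxA _ Q (cadj Q)) QQ mulmx1 subrr subr0.
by rewrite -!mulmxA.
Qed.

(* Q is an orthonormal basis of the row space of Ma, and Ma = X Q with X' X = 1. *)
Lemma contraction_extension N a b (Ma : 'M[C]_(N, a)) (Mb : 'M[C]_(N, b)) :
  (forall c : 'rV[C]_N, nsq (c *m Mb) <= nsq (c *m Ma)) ->
  exists V : 'M[C]_(a, b), Ma *m V = Mb /\
    forall n (X : 'M[C]_(n, a)), nsq (X *m V) <= nsq X.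
Proof.
move=> Mab.
have Mab' n (X : 'M[C]_(n, N)) : nsq (X *m Mb) <= nsq (X *m Ma).
  by rewrite !(nsq_rows (_ *m _)); apply: ler_sum => i _; rewrite !row_mul.
pose Q := schmidt (row_base Ma).
have QQ : Q *m cadj Q = 1%:M.
  by rewrite -map_conjCE; apply/unitarymxP/schmidt_unitarymx/rank_leq_col.
have QMa : (Q :=: Ma)%MS.
  exact: eqmx_trans (eqmx_schmidt_free (row_base_free _)) (eq_row_base _).
have /submxP[X MaX] : (Ma <= Q)%MS by rewrite QMa.
have /submxP[X' QX'] : (Q <= Ma)%MS by rewrite QMa.
(* On the row space of [Ma] the map is forced, [Q = X' *m Ma] going to [X' *m Mb]; the factor
   [cadj Q] makes it vanish on the orthogonal complement. *)
exists (cadj Q *m X' *m Mb); split=> [|n Y].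
  rewrite {1}MaX !mulmxA -(mulmxA X Q) QQ mulmx1.
  apply/subr0_eq/nsq_eq0.
  rewrite -[X in _ - X]mul1mx -mulmxBl; apply: le_trans (Mab' _ _) _.
  by rewrite mulmxBl mul1mx -mulmxA -QX' -MaX subrr nsq0.
rewrite !mulmxA; apply: le_trans (Mab' _ _) _.
by rewrite -(mulmxA _ X') -QX'; exact: nsq_proj_le.
Qed.

End Adjoint.

(** * Limits along filters and ultrafilters *)

(** The tails of a directed preorder generate a proper filter. Used for tolerances tending to 0 and
    for finite families of scalar points. *)
Lemma directed_ultrafilter (I : Type) (le : I -> I -> Prop) (i0 : I) :
  (forall i, le i i) -> (forall i j k, le i j -> le j k -> le i k) ->
  (forall i j, exists k, le i k /\ le j k) ->
  exists U : set_system I, UltraFilter U /\ forall i, U (le i).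
Proof.
move=> le_refl le_trans le_dir.
pose F : set_system I := fun A => exists i, forall j, le i j -> A j.
have FF : ProperFilter F.
  apply: Build_ProperFilter_ex; first by move=> A [i Ai]; exists i; apply: Ai.
  split.
  - by exists i0.
  - move=> A B [i Ai] [j Bj]; have [k [ik jk]] := le_dir i j.
    by exists k => l kl; split; [apply: Ai|apply: Bj]; apply: le_trans kl.
  - by move=> A B AB [i Ai]; exists i => j ij; apply/AB/Ai.
have [U [UU FU]] := ultraFilterLemma FF.
by exists U; split => // i; apply: FU; exists i.
Qed.

Section FilterLimit.
Variable R : realType.
Local Notation C := (R[i]).
Local Notation Rc := (real_complex R).
Variables (I : Type) (U : set_system I).
Context {FU : ProperFilter U}.

Definition ucvg (a : I -> C) (l : C) : Prop :=
  forall e : R, 0 < e -> U [set i | cabs (a i - l) < e]%classic.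

Lemma ucvg_cst c : ucvg (fun=> c) c.
Proof. by move=> e e0; apply: filterS filterT => i _ /=; rewrite subrr cabs0. Qed.

Lemma ucvg_uniq a l l' : ucvg a l -> ucvg a l' -> l = l'.
Proof.
move=> al al'; apply/subr0_eq/cabs_eq0/le_anti; rewrite cabs_ge0 andbT.
apply/ler_addgt0Pl => e e0; rewrite addr0; have e2 : 0 < e / 2 by lra.
have [i [/= h1 h2]] := filter_ex (filterI (al _ e2) (al' _ e2)).
have -> : l - l' = - (a i - l) + (a i - l') by ring.
by apply: le_trans (cabsD _ _) _; rewrite cabsN; lra.
Qed.

Lemma ucvgD a b l m : ucvg a l -> ucvg b m -> ucvg (fun i => a i + b i) (l + m).
Proof.
move=> al bm e e0; have e2 : 0 < e / 2 by lra.
apply: filterS (filterI (al _ e2) (bm _ e2)) => i [/= h1 h2].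
have -> : a i + b i - (l + m) = (a i - l) + (b i - m) by ring.
by apply: le_lt_trans (cabsD _ _) _; lra.
Qed.

Lemma ucvgM a b l m : ucvg a l -> ucvg b m -> ucvg (fun i => a i * b i) (l * m).
Proof.
move=> al bm e e0.
pose K := 1 + cabs l + cabs m.
have K0 : 0 < K by have := cabs_ge0 l; have := cabs_ge0 m; rewrite /K; lra.
have K1 : 1 <= K by have := cabs_ge0 l; have := cabs_ge0 m; rewrite /K; lra.
have e2 : 0 < Num.min 1 (e / 2 / K) by rewrite lt_min ltr01 !divr_gt0.
apply: filterS (filterI (al _ e2) (bm _ e2)) => i [/= h1 h2].
move: h1 h2; rewrite !lt_min => /andP[h1 h1'] /andP[h2 h2'].
move: h1' h2'; rewrite !ltr_pdivlMr // => h1' h2'.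
have -> : a i * b i - l * m = (a i - l) * (b i - m) + (a i - l) * m + l * (b i - m) by ring.
apply: le_lt_trans (cabsD _ _) _; apply: le_lt_trans (lerD (cabsD _ _) (lexx _)) _.
rewrite !cabsM; move: h1 h2 h1' h2'.
have := cabs_ge0 (a i - l); have := cabs_ge0 (b i - m).
have := cabs_ge0 l; have := cabs_ge0 m; rewrite /K.
set x := cabs (a i - l); set y := cabs (b i - m); nra.
Qed.

Lemma ucvg_conj a l : ucvg a l -> ucvg (fun i => conjc (a i)) (conjc l).
Proof.
move=> al e e0; apply: filterS (al _ e0) => i /=.
by rewrite -rmorphB /= cabs_conj.
Qed.

Lemma ucvg_sum (J : Type) (r : seq J) (P : pred J) (a : J -> I -> C) (l : J -> C) :
  (forall j, ucvg (a j) (l j)) ->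
  ucvg (fun i => \sum_(j <- r | P j) a j i) (\sum_(j <- r | P j) l j).
Proof.
move=> al; elim: r => [|j r IHr].
  rewrite big_nil (_ : (fun i => _) = fun=> 0); first exact: ucvg_cst.
  by apply/funext => i; rewrite big_nil.
rewrite big_cons (_ : (fun i => _) = fun i => if P j then
  a j i + \sum_(k <- r | P k) a k i else \sum_(k <- r | P k) a k i).
  by case: (P j) => //; apply: ucvgD.
by apply/funext => i; rewrite big_cons.
Qed.

Lemma ucvg_Re_le a l (c : R) :
  ucvg a l -> U [set i | complex.Re (a i) <= c]%classic -> complex.Re l <= c.
Proof.
move=> al ac; apply/ler_addgt0Pl => e e0.
have [i /= [h aic]] := filter_ex (filterI (al _ e0) ac).
have := le_lt_trans (Re_le_cabs _) h; rewrite raddfB ltr_norml /= => /andP[].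
by move: aic => /=; lra.
Qed.

Definition mucvg m n (A : I -> 'M[C]_(m, n)) (L : 'M[C]_(m, n)) : Prop :=
  forall i j, ucvg (fun k => A k i j) (L i j).

Lemma mucvg_cst m n (A : 'M[C]_(m, n)) : mucvg (fun=> A) A.
Proof. by move=> i j; apply: ucvg_cst. Qed.

Lemma mucvg_uniq m n (A : I -> 'M[C]_(m, n)) L L' : mucvg A L -> mucvg A L' -> L = L'.
Proof. by move=> AL AL'; apply/matrixP => i j; apply: ucvg_uniq (AL i j) (AL' i j). Qed.

Lemma mucvgD m n (A B : I -> 'M[C]_(m, n)) L M :
  mucvg A L -> mucvg B M -> mucvg (fun k => A k + B k) (L + M).
Proof.
move=> AL BM i j; rewrite mxE (_ : (fun k => _) = fun k => A k i j + B k i j).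
  exact: ucvgD.
by apply/funext => k; rewrite mxE.
Qed.

Lemma mucvgN m n (A : I -> 'M[C]_(m, n)) L : mucvg A L -> mucvg (fun k => - A k) (- L).
Proof.
move=> AL i j e e0; apply: filterS (AL i j _ e0) => k /=.
by rewrite !mxE -opprD cabsN.
Qed.

Lemma mucvg_mul m n p (A : I -> 'M[C]_(m, n)) (B : I -> 'M[C]_(n, p)) L M :
  mucvg A L -> mucvg B M -> mucvg (fun k => A k *m B k) (L *m M).
Proof.
move=> AL BM i j; rewrite mxE.
rewrite (_ : (fun k => _) = fun k => \sum_h (fun k => A k i h * B k h j) k).
  by apply: ucvg_sum => h; apply: ucvgM.
by apply/funext => k; rewrite mxE.
Qed.

Lemma mucvg_cadj m n (A : I -> 'M[C]_(m, n)) L :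
  mucvg A L -> mucvg (fun k => cadj (A k)) (cadj L).
Proof.
move=> AL i j; rewrite !mxE (_ : (fun k => _) = fun k => conjc (A k j i)).
  exact: ucvg_conj.
by apply/funext => k; rewrite !mxE.
Qed.

Lemma mucvg_trace n (A : I -> 'M[C]_n) L :
  mucvg A L -> ucvg (fun k => \tr (A k)) (\tr L).
Proof. by move=> AL; apply: (@ucvg_sum _ _ _ (fun j k => A k j j)). Qed.

Lemma mucvg_nsq m n (A : I -> 'M[C]_(m, n)) L :
  mucvg A L -> ucvg (fun k => Rc (nsq (A k))) (Rc (nsq L)).
Proof.
move=> AL; rewrite nsqE (_ : (fun k => _) = fun k => \tr (cadj (A k) *m A k)).
  by apply: mucvg_trace; apply: mucvg_mul => //; apply: mucvg_cadj.
by apply/funext => k; rewrite nsqE.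
Qed.

Lemma mucvg_nsq_le m n (A : I -> 'M[C]_(m, n)) L c :
  mucvg A L -> U [set k | nsq (A k) <= c]%classic -> nsq L <= c.
Proof. by move=> /mucvg_nsq AL Ac; apply: (ucvg_Re_le AL). Qed.

End FilterLimit.

Section UltraLimit.
Variable R : realType.
Local Notation C := (R[i]).
Variables (I : Type) (U : set_system I).
Context {UU : UltraFilter U}.

(** The limit is the supremum of the [r] with [r <= a i] for [U]-almost all [i]; above it, the
    ultrafilter must choose the complement. *)
Lemma ucvg_real_ex (a : I -> R) (B : R) : (forall i, `|a i| <= B) ->
  exists l, forall e : R, 0 < e -> U [set i | `|a i - l| < e]%classic.
Proof.
move=> aB; pose S : set R := [set r | U [set i | r <= a i]%classic]%classic.
have supS : has_sup S.
  split.
    exists (- B); rewrite /S /=; apply: filterS filterT => i _ /=.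
    by have := aB i; rewrite ler_norml => /andP[].
  exists B => r /filter_ex[i /= ra]; apply: le_trans ra _.
  by have := aB i; rewrite ler_norml => /andP[].
exists (sup S) => e e0.
have [r Sr rl] := sup_adherent e0 supS.
have NS : ~ S (sup S + e / 2).
  move=> /(ub_le_sup supS.2); lra.
have [//|Uc] := in_ultra_setVsetC [set i | sup S + e / 2 <= a i]%classic UU.
apply: filterS (filterI Sr Uc) => i [/= ra /negP]; rewrite -ltNge => al.
by rewrite ltr_norml; apply/andP; split; lra.
Qed.

Lemma ucvg_ex (a : I -> C) (B : R) : (forall i, cabs (a i) <= B) -> exists l, ucvg U a l.
Proof.
move=> aB.
have [x Hx] := @ucvg_real_ex (fun i => complex.Re (a i)) B
  (fun i => le_trans (Re_le_cabs _) (aB i)).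
have [y Hy] := @ucvg_real_ex (fun i => complex.Im (a i)) B
  (fun i => le_trans (Im_le_cabs _) (aB i)).
exists (x +i* y)%C => e e0; have e2 : 0 < e / 2 by lra.
apply: filterS (filterI (Hx _ e2) (Hy _ e2)) => i [/=] {Hx Hy aB}.
case: (a i) => u v /= Hu Hv; apply: le_lt_trans (cabs_le_ReIm _) _ => /=; lra.
Qed.

Lemma mucvg_ex m n (A : I -> 'M[C]_(m, n)) (B : R) :
  (forall k, nsq (A k) <= B) -> exists L, mucvg U A L.
Proof.
move=> AB.
have B0 : 0 <= B by have [k _] := filter_ex (@filterT _ U _); exact: le_trans (nsq_ge0 _) (AB k).
have H i j : {l | ucvg U (fun k => A k i j) l}.
  apply/cid/(@ucvg_ex _ (Num.sqrt B)) => k.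
  rewrite -(ler_pXn2r (n := 2)) ?nnegrE ?cabs_ge0 ?sqrtr_ge0 // cabs_sqr sqr_sqrtr //.
  exact: le_trans (cabs2_le_nsq _ _ _) (AB k).
by exists (\matrix_(i, j) sval (H i j)) => i j; rewrite mxE; exact: svalP.
Qed.

End UltraLimit.

(** * A theorem of the alternative for a cone of Hermitian matrices *)

Section ConeAlternative.
Variable R : realType.
Local Notation C := (R[i]).
Local Notation Rc := (real_complex R).

Definition re_dot m n (A B : 'M[C]_(m, n)) : R := complex.Re (\tr (cadj A *m B)).

Lemma ReZ (t : R) (z : C) : complex.Re (Rc t * z) = t * complex.Re z.
Proof. by case: z => a b /=; rewrite mul0r subr0. Qed.

Lemma re_dotDr m n (A B D : 'M[C]_(m, n)) : re_dot A (B + D) = re_dot A B + re_dot A D.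
Proof. by rewrite /re_dot mulmxDr mxtraceD raddfD. Qed.

Lemma re_dotNr m n (A B : 'M[C]_(m, n)) : re_dot A (- B) = - re_dot A B.
Proof. by rewrite /re_dot mulmxN raddfN raddfN. Qed.

Lemma re_dotZr m n (A B : 'M[C]_(m, n)) (t : R) : re_dot A (Rc t *: B) = t * re_dot A B.
Proof. by rewrite /re_dot -scalemxAr mxtraceZ ReZ. Qed.

Lemma nsqD m n (A B : 'M[C]_(m, n)) : nsq (A + B) = nsq A + 2 * re_dot A B + nsq B.
Proof.
rewrite !nsq_trE /re_dot cadjD mulmxDr !mulmxDl !mxtraceD !raddfD /=.
have -> : complex.Re (\tr (cadj B *m A)) = complex.Re (\tr (cadj A *m B)).
  by rewrite -{1}[A]cadjK -cadjM tr_cadj; case: (\tr _).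
ring.
Qed.

Lemma nsqZR m n (t : R) (A : 'M[C]_(m, n)) : nsq (Rc t *: A) = t ^+ 2 * nsq A.
Proof. by rewrite nsqZ /cabs2 /= expr0n addr0. Qed.

(** First-order condition at a minimum: for [b < 0] the linear term wins once
    [t * (c + 1) <= - b]. *)
Lemma first_order_ge0 (b c : R) : 0 <= c ->
  (forall t, 0 < t -> t < 1 -> 0 <= 2 * (t * b) + t ^+ 2 * c) -> 0 <= b.
Proof.
move=> c0 H; rewrite leNgt; apply/negP => b0.
pose t := Num.min (2^-1) (- b / (c + 1)).
have t0 : 0 < t by rewrite lt_min invr_gt0 ltr0n /= divr_gt0; lra.
have t1 : t <= 2^-1 by rewrite ge_min lexx.
have : t <= - b / (c + 1) by rewrite ge_min lexx orbT.
rewrite ler_pdivlMr; last lra.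
move=> tc; have t1' : t < 1 by lra.
have := H t t0 t1'; rewrite expr2 => h.
have : t * (2 * b + t * c) < 0 by rewrite pmulr_rlt0 //; lra.
lra.
Qed.

Variables (M N : nat) (H : 'I_N -> 'I_N -> 'M[C]_M) (J : 'M[C]_N) (c0 : R).
Hypothesis Hherm : forall i j, cadj (H i j) = H j i.
Hypothesis Jherm : cadj J = J.
Hypothesis c0_gt0 : 0 < c0.

(* hform V only depends on the positive semidefinite matrix V V^*, linearly; so the
   matrices hform V form a convex cone, and M columns suffice by gram_factor. *)
Definition hform k (V : 'M[C]_(M, k)) : 'M[C]_N :=
  \matrix_(i, j) \tr (cadj V *m H i j *m V).

(** Source of compactness: a sublevel set of the distance from [hform V] to [J] is bounded in [V],
    so the distance is attained. *)
Hypothesis coercive : forall k (V : 'M[C]_(M, k)),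
  c0 * nsq V <= \sum_i complex.Re (hform V i i).

Lemma hform_herm k (V : 'M[C]_(M, k)) : cadj (hform V) = hform V.
Proof.
apply/matrixP => i j; rewrite !mxE -tr_cadj !cadjM cadjK Hherm.
by rewrite mulmxA.
Qed.

Lemma hform_gram k l (V : 'M[C]_(M, k)) (W : 'M[C]_(M, l)) :
  V *m cadj V = W *m cadj W -> hform V = hform W.
Proof.
move=> VW; apply/matrixP => i j; rewrite !mxE.
by rewrite -!mulmxA ![\tr (cadj _ *m _)]mxtrace_mulC -!mulmxA VW.
Qed.

Lemma hform_row_mx k l (V : 'M[C]_(M, k)) (W : 'M[C]_(M, l)) :
  hform (row_mx V W) = hform V + hform W.
Proof.
have cadj_row : cadj (row_mx V W) = col_mx (cadj V) (cadj W).
  by rewrite /cadj map_row_mx tr_row_mx.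
apply/matrixP => i j; rewrite !mxE cadj_row mul_col_mx mul_col_row.
by rewrite mxtrace_block.
Qed.

Lemma hformZ k (t : R) (V : 'M[C]_(M, k)) : hform (Rc t *: V) = Rc (t ^+ 2) *: hform V.
Proof.
apply/matrixP => i j; rewrite !mxE cadjZ conjc_real -!scalemxAl -scalemxAr !mxtraceZ.
by rewrite mulrA -rmorphM expr2.
Qed.

Lemma hform_cvg I (U : set_system I) {UU : UltraFilter U} k
    (V : I -> 'M[C]_(M, k)) L :
  mucvg U V L -> mucvg U (fun e => hform (V e)) (hform L).
Proof.
move=> VL i j; rewrite mxE.
rewrite (_ : (fun e => _) = fun e => \tr (cadj (V e) *m H i j *m V e)).
  apply: mucvg_trace; apply: (mucvg_mul _ VL); apply: mucvg_mul; last exact: mucvg_cst.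
  exact: mucvg_cadj.
by apply/funext => e; rewrite mxE.
Qed.

Let F (V : 'M[C]_M) := nsq (J - hform V).

(** A diagonal entry of [hform V] is at most the sum of the moduli of those of [J] and
    [J - hform V]; [x <= 1 + x ^+ 2] for each of the two gives [2 + nsq J + s]. *)
Let V_bounded V (s : R) : F V <= s -> nsq V <= (N%:R * (2 + nsq J + s)) / c0.
Proof.
move=> FVs; rewrite ler_pdivlMr // mulrC; apply: le_trans (coercive V) _.
have -> : N%:R * (2 + nsq J + s) = \sum_(i < N) (2 + nsq J + s).
  by rewrite sumr_const card_ord mulr_natl.
apply: ler_sum => i _.
have h1 := le_trans (ler_norm _) (Re_le_cabs (J i i)).
have h2 := Re_le_cabs ((J - hform V) i i).
have h3 := cabs2_le_nsq J i i.
have h4 := le_trans (cabs2_le_nsq (J - hform V) i i) FVs.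
move: h2 h3 h4; rewrite -!cabs_sqr.
have -> : complex.Re (hform V i i) = complex.Re (J i i) - complex.Re ((J - hform V) i i).
  have -> : (J - hform V) i i = J i i - hform V i i by rewrite mxE [in LHS]mxE.
  by rewrite raddfB /=; ring.
move: h1; set x := complex.Re (J i i); set y := complex.Re (_ i i).
rewrite ler_norml; set u := cabs _; set v := cabs _ => xu /andP[yv _] u2 v2.
have := sqr_ge0 (u - 1); have := sqr_ge0 (v - 1); rewrite !expr2 in u2 v2 *; nra.
Qed.

Lemma hform_dist_attained : exists V0, forall V, F V0 <= F V.
Proof.
pose S : set R := [set r | exists V, r = F V]%classic.
have infS : has_inf S.
  by split; [exists (F 0), 0|exists 0 => r [V ->]; exact: nsq_ge0].
pose I := {e : R | 0 < e}.
pose mk e (e0 : 0 < e) : I := exist (fun e : R => 0 < e) e e0.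
(* The minimum with 1 keeps all near-minimizers in one bounded sublevel set. *)
have ex (e : I) : {V | F V <= inf S + Num.min (sval e) 1}.
  have e0 : 0 < Num.min (sval e) 1 by rewrite lt_min ltr01 andbT (svalP e).
  by apply/cid; have [_ [V ->] /ltW] := inf_adherent e0 infS; exists V.
pose V e := sval (ex e).
have VP e : F (V e) <= inf S + Num.min (sval e) 1 := svalP (ex e).
have Hdir (e f : I) : exists g : I, sval g <= sval e /\ sval g <= sval f.
  have g0 : 0 < Num.min (sval e) (sval f) by rewrite lt_min (svalP e) (svalP f).
  by exists (mk _ g0); rewrite /= !ge_min !lexx orbT.
have [U [UU HU]] := @directed_ultrafilter I (fun e f => sval f <= sval e)
  (mk 1 ltr01) (fun e => lexx _)
  (fun e f g (ef : sval f <= sval e) (fg : sval g <= sval f) => le_trans fg ef) Hdir.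
have Vb e : nsq (V e) <= (N%:R * (2 + nsq J + (inf S + 1))) / c0.
  by apply: V_bounded; apply: le_trans (VP e) _; rewrite lerD2l ge_min lexx orbT.
have [V0 VV0] := mucvg_ex Vb.
exists V0 => W; apply: (@le_trans _ _ (inf S)); last first.
  by apply: (ge_inf infS.2); exists W.
apply/ler_addgt0Pl => e e0; rewrite addrC.
have cvgF : mucvg U (fun e => J - hform (V e)) (J - hform V0).
  by apply: mucvgD; [exact: mucvg_cst|apply: mucvgN; exact: hform_cvg].
apply: (mucvg_nsq_le cvgF).
apply: filterS (HU (mk e e0)) => k /= ke; apply: le_trans (VP k) _.
by rewrite lerD2l ge_min ke.
Qed.

(* K is the conjugate of hform V0 - J for a point hform V0 of the cone at minimal
   distance from J. Adjoining columns to V0, respectively shrinking V0, gives the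
   two first-order conditions. *)
Lemma cone_alternative :
  (exists V : 'M[C]_M, hform V = J) \/
  (exists K : 'M[C]_N, [/\ cadj K = K,
     forall k (v : 'M[C]_(M, k)), 0 <= complex.Re (\sum_i \sum_j K i j * hform v i j) &
     complex.Re (\sum_i \sum_j K i j * J i j) < 0]).
Proof.
have [V0 V0min] := hform_dist_attained.
have [J0|J0] := eqVneq (hform V0) J; first by left; exists V0.
right; pose l := hform V0 - J.
have FE V : F V = nsq (hform V - J) by rewrite /F -nsqN opprB.
have ipE (X : 'M[C]_N) : complex.Re (\sum_i \sum_j conjc (l i j) * X i j) = re_dot l X.
  rewrite /re_dot /mxtrace exchange_big; congr complex.Re; apply: eq_bigr => i _.
  by rewrite mxE; apply: eq_bigr => j _; rewrite !mxE.
have lcone k (v : 'M[C]_(M, k)) : 0 <= re_dot l (hform v).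
  apply: (@first_order_ge0 _ (nsq (hform v))); first exact: nsq_ge0.
  move=> t t0 _; pose W := row_mx V0 (Rc (Num.sqrt t) *: v).
  (* [W] has [M + k] columns; [cadj r] has the same value under [hform] and the [M] columns over
     which [V0] is minimal. *)
  have [r rW] := gram_factor (cadj W).
  have := V0min (cadj r); rewrite !FE -/l (@hform_gram _ _ _ W); last by rewrite cadjK rW cadjK.
  rewrite hform_row_mx hformZ sqr_sqrtr ?(ltW t0) // addrAC -/l (nsqD l) re_dotZr nsqZR.
  by rewrite -addrA lerDl.
have lV0 : 0 <= re_dot l (- hform V0).
  apply: (@first_order_ge0 _ (nsq (hform V0))); first exact: nsq_ge0.
  move=> t t0 t1; have t1' : 0 <= 1 - t by lra.
  have := V0min (Rc (Num.sqrt (1 - t)) *: V0); rewrite !FE hformZ sqr_sqrtr //.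
  rewrite rmorphB rmorph1 scalerBl scale1r addrAC -/l (nsqD l) (re_dotNr l (_ *: _)) re_dotZr nsqN nsqZR re_dotNr.
  by rewrite -addrA lerDl (mulrN t).
have l0 : 0 < nsq l.
  rewrite ltNge; apply/negP => /nsq_eq0/eqP; rewrite subr_eq0; exact/negP.
exists (map_mx (@conjc R) l); split.
- have lh : cadj l = l by rewrite /l cadjB hform_herm Jherm.
  rewrite -[in RHS]lh; apply/matrixP => i j; rewrite !mxE conjcK.
  by [].
- by move=> k v; under eq_bigr do under eq_bigr do rewrite mxE; rewrite ipE.
- under eq_bigr do under eq_bigr do rewrite mxE; rewrite ipE.
  have -> : J = hform V0 - l by rewrite /l opprB addrC subrK.
  have -> : re_dot l (hform V0 - l) = - re_dot l (- hform V0) - nsq l.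
    by rewrite re_dotDr !re_dotNr opprK (nsq_trE l).
  lra.
Qed.

End ConeAlternative.

(** * Intertwining relations and the domain of delta *)

Section NcEval.
Variable R : realType.
Local Notation C := (R[i]).
Local Notation Rc := (real_complex R).
Variable d : nat.
Local Notation tup n := ('I_d -> 'M[C]_n).

(** Rectangular [S] covers similarities, direct summands, restrictions to invariant subspaces and
    rows of diagonal tuples at once; by [ncfun_intw] and [intw_ncfun], preserving such relations on
    [G_delta] characterizes nc functions. *)
Definition intw m n (x : tup m) (y : tup n) (S : 'M[C]_(m, n)) : Prop :=
  forall i, x i *m S = S *m y i.

Lemma wordev_intw m n (x : tup m) (y : tup n) S w :
  intw x y S -> wordev x w *m S = S *m wordev y w.
Proof.
move=> xS; elim: w => [|i w IHw] /=; first by rewrite mul1mx mulmx1.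
by rewrite -mulmxA IHw !mulmxA xS.
Qed.

Lemma nceval_intw P m n (x : tup m) (y : tup n) S :
  intw x y S -> nceval P x *m S = S *m nceval P y.
Proof.
move=> xS; rewrite /nceval mulmx_suml mulmx_sumr; apply: eq_bigr => t _.
by rewrite -scalemxAl -scalemxAr (wordev_intw _ xS).
Qed.

Lemma simil_intw n (s : 'M[C]_n) (x : tup n) : s \in unitmx -> intw x (simil s x) s.
Proof. by move=> us i; rewrite /simil !mulmxA mulmxV // mul1mx. Qed.

Lemma intw_comp l m n (x : tup l) (y : tup m) (z : tup n) S T :
  intw x y S -> intw y z T -> intw x z (S *m T).
Proof. by move=> xy yz i; rewrite mulmxA xy -mulmxA yz mulmxA. Qed.

Lemma intw_inv n (s : 'M[C]_n) (x y : tup n) :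
  s \in unitmx -> intw x y s -> intw y x (invmx s).
Proof.
move=> us xs i; apply: (can_inj (mulKmx us)).
by rewrite !mulmxA -xs mulmxK // mulmxV // mul1mx.
Qed.

Lemma intw_simil n (s : 'M[C]_n) (x y : tup n) :
  s \in unitmx -> intw x y s -> simil s x = y.
Proof. by move=> us xs; apply/funext => i; rewrite /simil -mulmxA xs mulKmx. Qed.

Variables (p q : nat) (delta : 'I_p -> 'I_q -> ncpoly R d).

(** Block [i] of [deltaev delta x] applied to a column of blocks, see [deltaev_mxcol]. The free
    width [m] plays the part of a tensor factor. *)
Definition dact n m (x : tup n) (y : 'I_q -> 'M[C]_(n, m)) (i : 'I_p) : 'M[C]_(n, m) :=
  \sum_j nceval (delta i j) x *m y j.

Lemma dact_intw n n' m (x : tup n) (x' : tup n') S (y : 'I_q -> 'M[C]_(n', m)) i :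
  intw x x' S -> dact x (fun j => S *m y j) i = S *m dact x' y i.
Proof.
move=> xS; rewrite /dact mulmx_sumr; apply: eq_bigr => j _.
by rewrite mulmxA (nceval_intw _ xS) mulmxA.
Qed.

Definition dbound n (x : tup n) (c : R) : Prop :=
  forall m (y : 'I_q -> 'M[C]_(n, m)),
    \sum_i nsq (dact x y i) <= c * \sum_j nsq (y j).

Lemma nsq_mxcol k n m (F : 'I_k -> 'M[C]_(n, m)) :
  nsq (\mxcol_i F i) = \sum_i nsq (F i).
Proof.
have mapE : map_mx (@conjc R) (\mxcol_i F i) = \mxcol_i map_mx (@conjc R) (F i).
  by apply/matrixP => i j; rewrite !mxE.
apply: (@complexI R); rewrite nsqE /cadj mapE tr_mxcol mul_mxrow_mxcol raddf_sum rmorph_sum.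
by apply: eq_bigr => i _ /=; rewrite nsqE.
Qed.

Lemma nsq_mxrow k n m (F : 'I_k -> 'M[C]_(n, m)) :
  nsq (\mxrow_i F i) = \sum_i nsq (F i).
Proof.
have mapE : cadj (\mxrow_i F i) = \mxcol_i cadj (F i).
  by apply/matrixP => i j; rewrite !mxE.
rewrite -nsq_cadj mapE nsq_mxcol; apply: eq_bigr => i _; exact: nsq_cadj.
Qed.

Lemma deltaev_mxcol n m (x : tup n) (y : 'I_q -> 'M[C]_(n, m)) :
  deltaev delta x *m (\mxcol_j y j) = \mxcol_i dact x y i.
Proof.
rewrite /deltaev mxblockEh mul_mxrow_mxcol.
by rewrite [RHS]mxcol_sum; apply: eq_bigr => j _; rewrite mxcol_mul.
Qed.

Lemma dboundP n (x : tup n) c :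
  (forall v : 'cV[C]_(\sum_(j < q) n), nsq (deltaev delta x *m v) <= c * nsq v) <->
  dbound x c.
Proof.
split=> [H m y|H v]; last first.
  by rewrite -(submxcolK v) deltaev_mxcol !nsq_mxcol; apply: H.
rewrite -!nsq_mxcol -deltaev_mxcol !(nsq_cols (_ *m _)) (nsq_cols (\mxcol_i _)).
by rewrite mulr_sumr; apply: ler_sum => j _; rewrite !colE -mulmxA.
Qed.

Lemma inGP n (x : tup n) :
  inG delta x <-> (0 < n)%N /\ exists c, [/\ 0 <= c, c < 1 & dbound x c].
Proof.
split=> [[n0 /opnorm_lt1P[c [c0 c1 xc]]]|[n0 [c [c0 c1 xc]]]]; split => //.
  by exists c; split => //; apply/dboundP.
by apply/opnorm_lt1P; exists c; split => //; apply/dboundP.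
Qed.

Lemma opnorm_deltaev_le1 n (x : tup n) : opnorm (deltaev delta x) <= 1 <-> dbound x 1.
Proof.
rewrite -dboundP; split=> [/opnorm_leP H v|H].
  by have := H ler01 v; rewrite expr1n.
by apply/opnorm_leP => // v; rewrite expr1n.
Qed.

Lemma dsum_inl m k (x : tup m) (y : tup k) : intw (dsum x y) x (col_mx 1%:M 0).
Proof.
by move=> i; rewrite /dsum mul_block_col mul_col_mx !mulmx0 !mul0mx mul1mx mulmx1 !addr0.
Qed.

Lemma dsum_inr m k (x : tup m) (y : tup k) : intw (dsum x y) y (col_mx 0 1%:M).
Proof.
by move=> i; rewrite /dsum mul_block_col mul_col_mx !mulmx0 !mul0mx mul1mx mulmx1 !add0r.
Qed.

Lemma dbound_dsum m k (x : tup m) (y : tup k) a b :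
  dbound x a -> dbound y b -> dbound (dsum x y) (Num.max a b).
Proof.
move=> xa yb l z; have xl := dsum_inl x y; have yr := dsum_inr x y.
pose z1 j := usubmx (z j); pose z2 j := dsubmx (z j).
have zE : z = fun j => col_mx 1%:M 0 *m z1 j + col_mx 0 1%:M *m z2 j.
  apply/funext => j; rewrite !mul_col_mx !mul1mx !mul0mx add_col_mx addr0 add0r.
  by rewrite vsubmxK.
have -> : \sum_j nsq (z j) = \sum_j nsq (z1 j) + \sum_j nsq (z2 j).
  by rewrite -big_split; apply: eq_bigr => j _ /=; rewrite -nsq_col_mx vsubmxK.
have -> : \sum_i nsq (dact (dsum x y) z i) =
          \sum_i nsq (dact x z1 i) + \sum_i nsq (dact y z2 i).
  rewrite -big_split; apply: eq_bigr => i _ /=.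
  have -> : dact (dsum x y) z i = col_mx (dact x z1 i) (dact y z2 i).
    have -> : dact (dsum x y) z i =
       dact (dsum x y) (fun j => col_mx 1%:M 0 *m z1 j) i +
       dact (dsum x y) (fun j => col_mx 0 1%:M *m z2 j) i.
      by rewrite zE /dact -big_split; apply: eq_bigr => j _; rewrite mulmxDr.
    rewrite (dact_intw _ _ xl) (dact_intw _ _ yr).
    by rewrite !mul_col_mx !mul1mx !mul0mx add_col_mx addr0 add0r.
  by rewrite nsq_col_mx.
rewrite mulrDr; apply: lerD.
  by apply: le_trans (xa _ _) _; rewrite ler_wpM2r ?le_max ?lexx // sumr_ge0 // => j _; exact: nsq_ge0.
by apply: le_trans (yb _ _) _; rewrite ler_wpM2r ?le_max ?lexx ?orbT // sumr_ge0 // => j _; exact: nsq_ge0.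
Qed.

Lemma inG_dsum m k (x : tup m) (y : tup k) :
  inG delta x -> inG delta y -> inG delta (dsum x y).
Proof.
move=> /inGP[m0 [a [a0 a1 xa]]] /inGP[k0 [b [b0 b1 yb]]]; apply/inGP.
split; first by rewrite addn_gt0 m0.
exists (Num.max a b); split; first by rewrite le_max a0.
  by rewrite gt_max a1.
exact: dbound_dsum.
Qed.

Lemma unit_ublock1 m n (S : 'M[C]_(m, n)) :
  block_mx 1%:M S 0 1%:M \in unitmx.
Proof. by rewrite unitmxE det_ublock !det1 mulr1 unitr1. Qed.

(** The unipotent [s] with corner [S] commutes with [dsum x y], hence with its image under [phi];
    the corner of that relation is the claim. [S] may have any norm because [simil s] fixes the
    point. *)
Lemma ncfun_intw phi m n (x : tup m) (y : tup n) S :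
  is_ncfun delta phi -> inG delta x -> inG delta y -> intw x y S ->
  phi m x *m S = S *m phi n y.
Proof.
move=> [phiD phiS] Gx Gy xS.
pose s : 'M[C]_(m + n) := block_mx 1%:M S 0 1%:M.
have us : s \in unitmx := unit_ublock1 S.
have xys : intw (dsum x y) (dsum x y) s.
  move=> i; rewrite /dsum !mulmx_block.
  by rewrite !mulmx1 !mul1mx !mulmx0 !mul0mx !addr0 !add0r xS.
have sE := intw_simil us xys.
have Gxy := inG_dsum Gx Gy.
have := phiS _ s (dsum x y) us Gxy; rewrite sE => /(_ Gxy).
rewrite (phiD _ _ _ _ Gx Gy) => /(congr1 (mulmx s)); rewrite mulmxA mulmxA mulmxV // mul1mx.
rewrite !mulmx_block !mulmx1 !mul1mx !mulmx0 !mul0mx !addr0 !add0r.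
by case/eq_block_mx.
Qed.

End NcEval.

(** * Transfer functions *)

Section Realization.
Variable R : realType.
Local Notation C := (R[i]).
Local Notation Rc := (real_complex R).
Variable d : nat.
Local Notation tup n := ('I_d -> 'M[C]_n).
Variables (p q : nat) (delta : 'I_p -> 'I_q -> ncpoly R d).
Variables (M : nat) (V : 'M[C]_(1 + \sum_(i < p) M, 1 + \sum_(j < q) M)) (al : R).
Hypothesis Vcontr : forall n (X : 'M[C]_(n, 1 + \sum_(i < p) M)), nsq (X *m V) <= nsq X.
Local Notation KQ := (\sum_(j < q) M)%N.
Local Notation KP := (\sum_(i < p) M)%N.
Let A : 'M[C]_(1, 1) := ulsubmx V.
Let c : 'M[C]_(1, KQ) := ursubmx V.
Let B : 'M[C]_(KP, 1) := dlsubmx V.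
Let D : 'M[C]_(KP, KQ) := drsubmx V.

(* Coefficients multiply state matrices on the right and the entries of delta(x)
   multiply them on the left: associativity replaces the usual tensor products
   delta(x) (x) 1 and 1 (x) V. *)
Definition act_delta n (x : tup n) (y : 'M[C]_(n, KQ)) : 'M[C]_(n, KP) :=
  \mxrow_i dact delta x (fun j => submxrow y j) i.

Lemma act_delta_intw n n' (x : tup n) (x' : tup n') S y :
  intw x x' S -> act_delta x (S *m y) = S *m act_delta x' y.
Proof.
move=> xS; rewrite /act_delta mul_mxrow; apply: eq_mxrow => i.
by rewrite -(dact_intw _ _ _ xS); congr dact; apply/funext => j; rewrite mul_submxrow.
Qed.

Lemma submxrow_lin k (r : 'I_k -> nat) m a (y z : 'M[C]_(m, \sum_i r i)) j :
  submxrow (a *: y + z) j = a *: submxrow y j + submxrow z j.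
Proof. by apply/matrixP => s t; rewrite !mxE. Qed.

Lemma act_deltaD n (x : tup n) a y z : act_delta x (a *: y + z) = a *: act_delta x y + act_delta x z.
Proof.
apply/mxrowP => i; rewrite submxrow_lin !mxrowK /dact scaler_sumr -big_split.
by apply: eq_bigr => j _ /=; rewrite submxrow_lin mulmxDr -scalemxAr.
Qed.

Lemma act_delta_bound n (x : tup n) b y : dbound delta x b -> nsq (act_delta x y) <= b * nsq y.
Proof.
by move=> xb; rewrite /act_delta nsq_mxrow -{2}(submxrowK y) nsq_mxrow; apply: xb.
Qed.

Lemma inj_surj_mx m n (f : {linear 'M[C]_(m, n) -> 'M[C]_(m, n)}) :
  (forall u, f u = 0 -> u = 0) -> forall b, exists a, f a = b.
Proof.
move=> finj b; pose L := lin_mx f.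
have LU : L \in unitmx.
  rewrite -row_free_unit -kermx_eq0; apply/eqP/row_matrixP => i; rewrite row0.
  have : vec_mx (row i (kermx L)) = 0.
    apply: finj; apply: (can_inj mxvecK); rewrite -mul_vec_lin vec_mxK.
    by rewrite -row_mul mulmx_ker row0 linear0.
  by move=> /(congr1 mxvec); rewrite vec_mxK linear0.
exists (vec_mx (mxvec b *m invmx L)); apply: (can_inj mxvecK).
by rewrite -mul_vec_lin vec_mxK mulmxKV.
Qed.

(** The realization formula in implicit form: [V] sends [e] and [act_delta x y] to the output, up to
    [al], and back to [y]. Keeping [y] as an unknown avoids writing an inverse. *)
Definition transfer_state n (x : tup n) (e : 'cV[C]_n) (y : 'M[C]_(n, KQ)) : Prop :=
  y = e *m c + act_delta x y *m D.

Definition transfer_output n (x : tup n) (e : 'cV[C]_n) (y : 'M[C]_(n, KQ)) : 'cV[C]_n :=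
  Rc al *: (e *m A + act_delta x y *m B).

Lemma row_mx_blocksV n (e : 'cV[C]_n) (z : 'M[C]_(n, KP)) :
  row_mx e z *m V = row_mx (e *m A + z *m B) (e *m c + z *m D).
Proof. by rewrite -[V]submxK mul_row_block. Qed.

(** [V] is a contraction and [act_delta x] a strict one, so [nsq y <= b * nsq y] with [b < 1]. *)
Lemma transfer_state0 n (x : tup n) y : inG delta x -> y = act_delta x y *m D -> y = 0.
Proof.
move=> /inGP[_ [b [b0 b1 xb]]] yE; apply/nsq_eq0.
have := Vcontr (row_mx (0 : 'cV_n) (act_delta x y)).
rewrite row_mx_blocksV !mul0mx !add0r -yE !nsq_row_mx nsq0 add0r => h.
have := act_delta_bound y xb; have := nsq_ge0 (act_delta x y *m B); have := nsq_ge0 y; nra.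
Qed.

Lemma transfer_state_ex n (x : tup n) e : inG delta x -> exists y, transfer_state x e y.
Proof.
move=> Gx; pose f := fun y : 'M[C]_(n, KQ) => y - act_delta x y *m D.
have lf : linear f.
  by move=> a y z; rewrite /f act_deltaD mulmxDl -scalemxAl scalerBr opprD addrACA.
pose F : {linear 'M[C]_(n, KQ) -> 'M[C]_(n, KQ)} :=
  HB.pack f (GRing.isLinear.Build _ _ _ _ f lf).
have Finj u : F u = 0 -> u = 0.
  by move=> /(@subr0_eq _ _ _); exact: transfer_state0.
have [y yE] := inj_surj_mx Finj (e *m c).
by exists y; rewrite /transfer_state -yE /= /f subrK.
Qed.

Lemma transfer_stateD n (x : tup n) a e e' y y' :
  transfer_state x e y -> transfer_state x e' y' -> transfer_state x (a *: e + e') (a *: y + y').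
Proof.
rewrite /transfer_state => yE yE'; rewrite act_deltaD !mulmxDl -!scalemxAl addrACA -scalerDr.
by rewrite -yE -yE'.
Qed.

Lemma transfer_state_uniq n (x : tup n) e y y' : inG delta x ->
  transfer_state x e y -> transfer_state x e y' -> y = y'.
Proof.
move=> Gx sy sy'; have := transfer_stateD (-1) sy' sy.
rewrite !scaleN1r !(addrC (- _)) subrr /transfer_state mul0mx add0r.
by move=> /(transfer_state0 Gx)/subr0_eq.
Qed.

Lemma transfer_outputD n (x : tup n) a e e' y y' :
  transfer_output x (a *: e + e') (a *: y + y') = a *: transfer_output x e y + transfer_output x e' y'.
Proof.
rewrite /transfer_output act_deltaD !mulmxDl -!scalemxAl addrACA -(scalerDr a) [LHS]scalerDr.
by rewrite !scalerA [a * _]mulrC.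
Qed.

Lemma transfer_ex n (x : tup n) : inG delta x ->
  exists Phi : 'M[C]_n, forall e, exists2 y, transfer_state x e y & Phi *m e = transfer_output x e y.
Proof.
move=> Gx; pose Y b := projT1 (cid (transfer_state_ex (delta_mx b 0) Gx)).
have YP b : transfer_state x (delta_mx b 0) (Y b) := projT2 (cid (transfer_state_ex (delta_mx b 0) Gx)).
exists (\matrix_(a, b) transfer_output x (delta_mx b 0) (Y b) a 0) => e.
set Phi := \matrix_(a, b) _.
have PhiE b : Phi *m delta_mx b 0 = transfer_output x (delta_mx b 0) (Y b).
  by rewrite -colE; apply/colP => a; rewrite !mxE.
have -> : e = \sum_b e b 0 *: delta_mx b 0.
  rewrite {1}(matrix_sum_delta e); apply: eq_bigr => b _.
  by rewrite big_ord1.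
pose good e := exists2 y, transfer_state x e y & Phi *m e = transfer_output x e y.
apply: (@big_rec _ good) => [|b u _ [y sy Pu]].
  exists 0; first by rewrite /transfer_state /act_delta mul0mx add0r; apply/esym;
    have := act_deltaD x (-1) 0 0; rewrite scaler0 addr0 scaleN1r /act_delta => ->; rewrite addNr mul0mx.
  rewrite mulmx0 /transfer_output mul0mx add0r.
  by have := act_deltaD x (-1) 0 0; rewrite scaler0 addr0 scaleN1r => ->; rewrite addNr mul0mx scaler0.
exists (e b 0 *: Y b + y); first exact: transfer_stateD.
by rewrite transfer_outputD mulmxDr -scalemxAr PhiE Pu.
Qed.

Definition transfer : ncfun R d := fun n x =>
  xget 0 [set Phi : 'M[C]_n | forall e, exists2 y, transfer_state x e y & Phi *m e = transfer_output x e y]%classic.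

Lemma transferP n (x : tup n) e : inG delta x ->
  exists2 y, transfer_state x e y & transfer x *m e = transfer_output x e y.
Proof.
move=> Gx; rewrite /transfer; case: xgetP => [Phi _ H|H]; first exact: H.
by have [Phi HPhi] := transfer_ex Gx; case: (H Phi).
Qed.

Lemma transferE n (x : tup n) e y : inG delta x -> transfer_state x e y ->
  transfer x *m e = transfer_output x e y.
Proof.
by move=> Gx sy; have [y' sy' ->] := transferP e Gx; rewrite (transfer_state_uniq Gx sy sy').
Qed.

Lemma mulmx_colP m n (X Y : 'M[C]_(m, n)) : (forall e : 'cV_n, X *m e = Y *m e) -> X = Y.
Proof.
move=> XY; apply/matrixP => i j; have := XY (delta_mx j 0).
by rewrite -!colE => /colP/(_ i); rewrite !mxE.
Qed.

(** If [z] is the state of [e] at [y], then [S *m z] solves the state equation of [S *m e] at [x];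
    states are unique. *)
Lemma transfer_intw m n (x : tup m) (y : tup n) S : inG delta x -> inG delta y ->
  intw x y S -> transfer x *m S = S *m transfer y.
Proof.
move=> Gx Gy xS; apply: mulmx_colP => e; rewrite -!mulmxA.
have [z sz ->] := transferP e Gy.
have sSz : transfer_state x (S *m e) (S *m z).
  by rewrite /transfer_state (act_delta_intw _ xS) -!mulmxA -mulmxDr -sz.
by rewrite (transferE Gx sSz) /transfer_output (act_delta_intw _ xS) -!mulmxA -mulmxDr -scalemxAr.
Qed.

(** Energy balance: output (divided by [al]) and state together weigh at most
    [nsq v + nsq (act_delta x y)], and the last term is at most [nsq y], so the state cancels. *)
Lemma transfer_bound n (x : tup n) (v : 'cV[C]_n) : inG delta x ->
  nsq (transfer x *m v) <= al ^+ 2 * nsq v.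
Proof.
move=> Gx; have [y sy ->] := transferP v Gx.
have /inGP[_ [b [b0 b1 xb]]] := Gx.
have := Vcontr (row_mx v (act_delta x y)); rewrite row_mx_blocksV -sy !nsq_row_mx.
rewrite /transfer_output nsqZR => h; rewrite ler_wpM2l ?sqr_ge0 //.
have := act_delta_bound y xb; have := nsq_ge0 y; nra.
Qed.

(** Direct sums follow from the two coordinate inclusions [dsum_inl] and [dsum_inr]. *)
Lemma intw_ncfun (phi : ncfun R d) :
  (forall m n (x : tup m) (y : tup n) S, inG delta x -> inG delta y ->
    intw x y S -> phi m x *m S = S *m phi n y) ->
  is_ncfun delta phi.
Proof.
move=> H; split=> [m k x y Gx Gy|n s x us Gx Gsx].
  have Gxy := inG_dsum Gx Gy.
  have xl := dsum_inl x y; have yr := dsum_inr x y.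
  have := H _ _ _ _ _ Gxy Gy yr; have := H _ _ _ _ _ Gxy Gx xl.
  rewrite -[phi _ (dsum x y)]submxK !mul_block_col !mul_col_mx !mulmx1 !mulmx0 !mul1mx !mul0mx.
  by rewrite !addr0 !add0r => /eq_col_mx[-> ->] /eq_col_mx[-> ->].
by rewrite -mulmxA (H _ _ _ _ _ Gx Gsx (simil_intw _ us)) mulKmx.
Qed.

End Realization.

(** * Pick interpolation at finitely many scalar points *)

Section Pick.
Variable R : realType.
Local Notation C := (R[i]).
Local Notation Rc := (real_complex R).
Variable d : nat.
Local Notation tup n := ('I_d -> 'M[C]_n).
Variables (p q : nat) (delta : 'I_p -> 'I_q -> ncpoly R d).
Variables (N : nat) (z : 'I_N -> 'I_d -> C).

(** Regroups a family over the points so that the point index becomes the row index, on which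
    [diagtup] and [K] act. *)
Definition stack s m (E : 'I_N -> 'M[C]_(s, m)) (j : 'I_s) : 'M[C]_(N, m) :=
  \matrix_(a, b) E a j b.

Lemma nsq_stack s m (E : 'I_N -> 'M[C]_(s, m)) : \sum_j nsq (stack E j) = \sum_k nsq (E k).
Proof.
rewrite /nsq exchange_big; apply: eq_bigr => k _; apply: eq_bigr => j _.
by apply: eq_bigr => b _; rewrite mxE.
Qed.

Definition kform (K : 'M[C]_N) s m (E : 'I_N -> 'M[C]_(s, m)) : C :=
  \sum_a \sum_b K a b * \tr (cadj (E a) *m E b).

Lemma kformE K s m (E : 'I_N -> 'M[C]_(s, m)) :
  kform K E = \sum_j \tr (cadj (stack E j) *m K *m stack E j).
Proof.
have trE a b : K a b * \tr (cadj (E a) *m E b) =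
    \sum_j \sum_l K a b * (conjc (E a j l) * E b j l).
  rewrite /mxtrace mulr_sumr exchange_big; apply: eq_bigr => l _.
  by rewrite mxE mulr_sumr; apply: eq_bigr => j _; rewrite !mxE.
rewrite /kform; under eq_bigr do under eq_bigr do rewrite trE.
under eq_bigr do rewrite exchange_big.
rewrite exchange_big; apply: eq_bigr => j _ /=.
under eq_bigr do rewrite exchange_big.
rewrite exchange_big; apply: eq_bigr => l _ /=.
rewrite exchange_big mxE; apply: eq_bigr => b _ /=.
rewrite mxE mulr_suml; apply: eq_bigr => a _.
by rewrite !mxE mulrA [K a b * _]mulrC.
Qed.

Definition diagtup : tup N := fun i => diag_mx (\row_k z k i).

Definition dval k : 'M[C]_(p, q) :=
  \matrix_(i, j) nceval (delta i j) (scal (z k)) 0 0.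

Lemma scal_diagtup_intw k : intw (scal (z k)) diagtup (delta_mx 0 k : 'rV[C]_N).
Proof.
move=> i; rewrite /scal /diagtup mul_scalar_mx mul_mx_diag; apply/rowP => a.
rewrite !mxE eqxx /=; have [->|] := eqVneq a k; first by rewrite mulr1 mul1r.
by rewrite mulr0 mul0r.
Qed.

Lemma dact_diagtup m (E : 'I_N -> 'M[C]_(q, m)) i :
  dact delta diagtup (stack E) i = stack (fun k => dval k *m E k) i.
Proof.
apply/row_matrixP => k; rewrite rowE -(dact_intw _ _ _ (scal_diagtup_intw k)).
apply/rowP => b; rewrite /dact summxE !mxE; apply: eq_bigr => j _.
by rewrite mxE big_ord1 -rowE !mxE.
Qed.

Lemma nsq_dval k c m (E : 'M[C]_(q, m)) :
  dbound delta (scal (z k)) c -> nsq (dval k *m E) <= c * nsq E.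
Proof.
move=> kc; have := kc _ (fun j => row j E); rewrite -(nsq_rows E).
rewrite (nsq_rows (_ *m _)); congr (_ <= _); apply: eq_bigr => i _; congr nsq.
apply/rowP => b; rewrite /dact summxE !mxE; apply: eq_bigr => j _.
by rewrite mxE big_ord1 !mxE.
Qed.

Hypothesis zO : forall k, Omega delta (z k).

Lemma dval_contract : exists c, [/\ 0 <= c, c < 1 &
  forall k m (E : 'M[C]_(q, m)), nsq (dval k *m E) <= c * nsq E].
Proof.
have /choice[cc ccP] : forall k, exists c, [/\ 0 <= c, c < 1 & dbound delta (scal (z k)) c].
  by move=> k; have /inGP[_ H] := zO k.
exists (\big[Num.max/0]_k cc k); split.
- exact: bigmax_ge_id.
- by apply: bigmax_lt => // k _; case: (ccP k).
- move=> k m E; have [_ _ kc] := ccP k; apply: le_trans (nsq_dval E kc) _.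
  by rewrite ler_wpM2r ?nsq_ge0 //; apply: le_bigmax.
Qed.

Variables (w : 'I_N -> C) (al : R).
Hypothesis al0 : 0 < al.
(** The norm bound, tested only on tuples [r diag(z) r^-1], where the functional calculus is
    [r diag(w) r^-1]. *)
Hypothesis Hcom : forall r : 'M[C]_N, r \in unitmx ->
  dbound delta (simil (invmx r) diagtup) 1 ->
  forall v : 'cV[C]_N, nsq (r *m diag_mx (\row_k w k) *m invmx r *m v) <= al ^+ 2 * nsq v.

Let J : 'M[C]_N := \matrix_(a, b) (Rc (al ^+ 2) - conjc (w a) * w b).

Let one : 'I_N -> 'M[C]_1 := fun=> (Rc al)%:M.
Let wm : 'I_N -> 'M[C]_1 := fun k => (w k)%:M.

Lemma kform_J (K : 'M[C]_N) : \sum_a \sum_b K a b * J a b = kform K one - kform K wm.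
Proof.
rewrite /kform -sumrB; apply: eq_bigr => a _; rewrite -sumrB; apply: eq_bigr => b _.
rewrite -mulrBr; congr (_ * _); rewrite !mxE /one /wm /mxtrace !big_ord1 !mxE !big_ord1 !mxE.
by rewrite !eqxx !mulr1n conjc_real -rmorphM expr2.
Qed.

Lemma tr_psd_shift (K r : 'M[C]_N) e m (X : 'M[C]_(N, m)) :
  cadj r *m r = K + (Rc e)%:M ->
  nsq (r *m X) = complex.Re (\tr (cadj X *m K *m X)) + e * nsq X.
Proof.
move=> rK; rewrite nsq_trE cadjM -mulmxA (mulmxA (cadj r)) rK mulmxDl mulmxDr mxtraceD raddfD /=.
by rewrite mulmxA mul_scalar_mx -scalemxAr mxtraceZ ReZ -nsq_trE.
Qed.

(* The extra coordinate, annihilated by dv, adds all positive semidefinite matrices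
   to the cone; this is also what makes the case q = 0 harmless. *)
Let wid : nat := 1 + q.
Let P k := submxcol (1%:M : 'M[C]_(\sum_(i < N) wid)%N) k.
Let dv k : 'M[C]_(p, wid) := row_mx 0 (dval k).
Let H a b := cadj (P a) *m (1%:M - cadj (dv a) *m dv b) *m P b.

Lemma P_mul m (W : 'M[C]_(\sum_(i < N) wid, m)) k : P k *m W = submxcol W k.
Proof. by rewrite /P submxcol_mul mul1mx. Qed.

Lemma hform_HE m (W : 'M[C]_(\sum_(i < N) wid, m)) a b :
  hform H W a b = \tr (cadj (P a *m W) *m (P b *m W)) -
    \tr (cadj (dv a *m (P a *m W)) *m (dv b *m (P b *m W))).
Proof.
rewrite mxE /H !cadjM -linearB /=; congr (\tr _).
by rewrite !mulmxA mulmxBr mulmxBl mulmx1 !mulmxBl !mulmxA.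
Qed.

Lemma dv_mul m k (u : 'M[C]_(wid, m)) : dv k *m u = dval k *m (dsubmx u : 'M_(q, m)).
Proof. by rewrite /dv -{1}(vsubmxK (u : 'M_(1 + q, m))) mul_row_col mul0mx add0r. Qed.

Lemma hform_dval m (W : 'M[C]_(\sum_(i < N) wid, m)) a b :
  hform H W a b = \tr (cadj (P a *m W) *m (P b *m W)) -
    \tr (cadj (dval a *m (dsubmx (P a *m W) : 'M_(q, m))) *m
         (dval b *m (dsubmx (P b *m W) : 'M_(q, m)))).
Proof.
rewrite hform_HE; congr (_ - \tr (_ *m _)); last exact: dv_mul.
by congr cadj; exact: dv_mul.
Qed.

(* K + e = r^* r for e > 0, and the cone condition on K says exactly that the tuple
   r diag(z) r^-1 satisfies ||delta|| <= 1. *)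
Lemma pick_dual_absurd (K : 'M[C]_N) : cadj K = K ->
  (forall m (W : 'M[C]_(\sum_(i < N) wid, m)),
     0 <= complex.Re (\sum_a \sum_b K a b * hform H W a b)) ->
  0 <= complex.Re (\sum_a \sum_b K a b * J a b).
Proof.
move=> Kh KH.
have KH' m (E : 'I_N -> 'M[C]_(wid, m)) :
    complex.Re (kform K (fun k => dval k *m (dsubmx (E k) : 'M_(q, m)))) <= complex.Re (kform K E).
  rewrite -subr_ge0 -raddfB /=.
  have := KH _ (\mxcol_k E k); congr (0 <= complex.Re _).
  rewrite /kform -sumrB; apply: eq_bigr => a _; rewrite -sumrB; apply: eq_bigr => b _.
  by rewrite -mulrBr; congr (_ * _); rewrite hform_dval !P_mul !mxcolK.
(* Vectors supported on the extra coordinate are annihilated by [dv], so the cone condition reduces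
   to positivity of [K]. *)
have Kpsd (v : 'cV[C]_N) : 0 <= complex.Re (\tr (cadj v *m K *m v)).
  have := KH' _ (fun k => col_mx (v k 0)%:M 0).
  have -> : kform K (fun k => dval k *m (dsubmx (col_mx (v k 0)%:M 0 : 'M[C]_(1 + q, 1)) : 'M_(q, 1))) = 0.
    rewrite /kform big1 // => a _; rewrite big1 // => b _.
    by rewrite !col_mxKd !mulmx0 mxtrace0 mulr0.
  have -> : kform K (fun k => col_mx (v k 0)%:M 0 : 'M[C]_(1 + q, 1)) =
            kform K (fun k => (v k 0)%:M : 'M[C]_1).
    apply: eq_bigr => a _; apply: eq_bigr => b _; congr (_ * \tr _).
    by rewrite cadj_col_mx mul_row_col cadj0 mul0mx addr0.
  rewrite kformE big_ord1 (_ : stack _ 0 = v) //.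
  by apply/colP => a; rewrite !mxE eqxx mulr1n.
have Kdval m (E : 'I_N -> 'M[C]_(q, m)) :
    complex.Re (kform K (fun k => dval k *m E k)) <= complex.Re (kform K E).
  have := KH' _ (fun k => col_mx 0 (E k)).
  have -> : kform K (fun k => dval k *m (dsubmx (col_mx 0 (E k) : 'M[C]_(1 + q, m)) : 'M_(q, m)))
          = kform K (fun k => dval k *m E k).
    by apply: eq_bigr => a _; apply: eq_bigr => b _; rewrite !col_mxKd.
  congr (_ <= complex.Re _).
  apply: eq_bigr => a _; apply: eq_bigr => b _; congr (_ * \tr _).
  by rewrite cadj_col_mx mul_row_col cadj0 mul0mx add0r.
have [c [c0 c1 cdval]] := dval_contract.
have main e : 0 < e -> complex.Re (kform K wm) + e * nsq (stack wm 0) <=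
                       complex.Re (kform K one) + e * nsq (stack one 0).
  move=> e0; have [r rK] : exists r : 'M[C]_N, cadj r *m r = K + (Rc e)%:M.
    apply: psd_factor => [|v].
      rewrite cadjD Kh; congr (_ + _); apply/matrixP => i j; rewrite !mxE eq_sym.
      by rewrite rmorphMn; congr (_ *+ _); exact: conjc_real.
    rewrite mulmxDr mulmxDl mxtraceD raddfD /= mul_mx_scalar -scalemxAl mxtraceZ ReZ -nsq_trE.
    by rewrite addr_ge0 // mulr_ge0 ?nsq_ge0 // ltW.
  have ru : r \in unitmx.
    apply: unitmx_inj => v rv; have := tr_psd_shift v rK; rewrite rv nsq0 => h.
    by apply: nsq_eq0; have := Kpsd v; have := nsq_ge0 v; nra.
  have iru : invmx r \in unitmx by rewrite unitmx_inv.
  have Tr : intw (simil (invmx r) diagtup) diagtup r.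
    have := intw_inv iru (simil_intw diagtup iru); by rewrite invmxK.
  (* In the norm weighted by [K + e], the [K] part is [Kdval] and the [e] part holds because each
     [dval k] is a contraction. *)
  have rb : dbound delta (simil (invmx r) diagtup) 1.
    move=> m y; pose g j := invmx r *m y j.
    have -> : y = fun j => r *m g j by apply/funext => j; rewrite /g mulKVmx.
    pose E k := \matrix_(j, b) g j k b.
    have gE : g = stack E by apply/funext => j; apply/matrixP => a b; rewrite !mxE.
    have -> : \sum_j nsq (r *m g j) = complex.Re (kform K E) + e * \sum_k nsq (E k).
      rewrite kformE -nsq_stack mulr_sumr raddf_sum -big_split; apply: eq_bigr => j _.
      by rewrite gE (tr_psd_shift _ rK).
    have -> : \sum_i nsq (dact delta (simil (invmx r) diagtup) (fun j => r *m g j) i) =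
        complex.Re (kform K (fun k => dval k *m E k)) + e * \sum_k nsq (dval k *m E k).
      rewrite kformE -nsq_stack mulr_sumr raddf_sum -big_split; apply: eq_bigr => i _.
      by rewrite (dact_intw _ _ _ Tr) gE dact_diagtup (tr_psd_shift _ rK).
    rewrite mul1r lerD // ler_wpM2l ?(ltW e0) // ler_sum // => k _.
    by apply: le_trans (cdval _ _ _) _; have := nsq_ge0 (E k); nra.
  (* The image of the constant vector 1 under [r] is sent to [r] times [w]: the bound compares the
     forms of [w] and of the constant [al]. *)
  have := Hcom ru rb (r *m const_mx 1).
  have -> : al ^+ 2 * nsq (r *m (const_mx 1 : 'cV_N)) = nsq (r *m stack one 0).
    rewrite -nsqZR scalemxAr; congr (nsq (_ *m _)).
    by apply/colP => a; rewrite !mxE eqxx mulr1n mulr1.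
  have -> : r *m diag_mx (\row_k w k) *m invmx r *m (r *m const_mx 1) = r *m stack wm 0.
    rewrite -!mulmxA mulKmx // mul_diag_mx; congr (_ *m _).
    by apply/colP => a; rewrite !mxE eqxx mulr1n mulr1.
  by rewrite !(tr_psd_shift _ rK) !kformE !big_ord1.
rewrite kform_J raddfB /= subr_ge0; apply/ler_addgt0Pl => t t0.
(* This choice of [e] makes the error term on the side of [one] at most [t]. *)
have := main (t / (1 + nsq (stack one 0))).
have b0 := nsq_ge0 (stack one 0); have a0 := nsq_ge0 (stack wm 0).
set a := nsq _ in a0 *; set b := nsq _ in b0 *.
set u := t / _; have u0 : 0 < u by rewrite divr_gt0 //; lra.
have ub : u * (1 + b) = t by rewrite /u divfK // gt_eqF //; lra.
move=> /(_ u0) h; have ua := mulr_ge0 (ltW u0) a0.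
by rewrite mulrDr mulr1 in ub; lra.
Qed.

(** The dual alternative is excluded by [pick_dual_absurd]. A common bound [c < 1] for the finitely
    many points makes [1 - c] a coercivity constant. *)
Lemma pick_model : exists W : 'M[C]_(\sum_(i < N) wid), hform H W = J.
Proof.
have [c [c0 c1 cdval]] := dval_contract.
have Hh a b : cadj (H a b) = H b a.
  by rewrite /H !cadjM cadjB cadj1 cadjM !cadjK mulmxA.
have Jh : cadj J = J.
  apply/matrixP => a b; rewrite !mxE; case: (w a) => x y; case: (w b) => x' y'.
  by apply/eqP; rewrite eq_complex /=; apply/andP; split; apply/eqP; ring.
have c1' : 0 < 1 - c by lra.
have Hc m (W : 'M[C]_(\sum_(i < N) wid, m)) :
    (1 - c) * nsq W <= \sum_i complex.Re (hform H W i i).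
  rewrite -{1}(submxcolK W) nsq_mxcol mulr_sumr; apply: ler_sum => k _.
  rewrite hform_dval raddfB /= -!nsq_trE P_mul.
  have := cdval k _ (dsubmx (submxcol W k : 'M_(1 + q, m))).
  have : nsq (submxcol W k) = nsq (usubmx (submxcol W k : 'M_(1 + q, m))) +
     nsq (dsubmx (submxcol W k : 'M_(1 + q, m))).
    by rewrite -nsq_col_mx vsubmxK.
  have := nsq_ge0 (usubmx (submxcol W k : 'M_(1 + q, m))); nra.
have [//|[K [Kh KH KJ]]] := cone_alternative Hh Jh c1' Hc.
by have := pick_dual_absurd Kh KH; lra.
Qed.

Lemma pick_interpolation : exists phi : ncfun R d,
  [/\ is_ncfun delta phi,
      forall n (x : tup n), inG delta x -> forall v : 'cV[C]_n,
        nsq (phi n x *m v) <= al ^+ 2 * nsq v &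
      forall k, phi 1%N (scal (z k)) 0 0 = w k].
Proof.
have [W WJ] := pick_model.
pose u k : 'M[C]_(1 + q, \sum_(i < N) wid) := P k *m W.
pose E k := dsubmx (u k); pose S k := usubmx (u k).
(* The kernel identity [hform H W = J] with all signs made positive; [S] comes from the extra
   coordinate. *)
have KS (K : 'M[C]_N) : kform K one + kform K (fun k => dval k *m E k) =
    kform K wm + kform K E + kform K S.
  apply/eqP; rewrite -subr_eq0; apply/eqP.
  suff : kform K one - kform K wm = kform K S + kform K E - kform K (fun k => dval k *m E k).
    by move=> /eqP; rewrite -subr_eq0 => /eqP <-; ring.
  rewrite -kform_J -WJ /kform -big_split -sumrB; apply: eq_bigr => a _ /=.
  rewrite -big_split -sumrB; apply: eq_bigr => b _ /=.
  rewrite -mulrDr -mulrBr; congr (_ * _); rewrite hform_dval -/(u a) -/(u b).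
  by rewrite -{1}(vsubmxK (u a)) -{1}(vsubmxK (u b)) cadj_col_mx mul_row_col mxtraceD.
have nsqK m (c : 'rV[C]_N) (X : 'M[C]_(N, m)) :
    nsq (c *m X) = complex.Re (\tr (cadj X *m (cadj c *m c) *m X)).
  by rewrite nsq_trE cadjM !mulmxA.
have nsqKs s m (c : 'rV[C]_N) (F : 'I_N -> 'M[C]_(s, m)) :
    \sum_j nsq (c *m stack F j) = complex.Re (kform (cadj c *m c) F).
  by rewrite kformE raddf_sum; apply: eq_bigr => j _; rewrite nsqK.
pose Y := \mxrow_j stack E j.
pose Ma := row_mx (stack one 0) (\mxrow_i stack (fun k => dval k *m E k) i).
(* For [K = cadj c *m c] the identity [KS] compares the combinations with coefficients [c] of the
   rows of both sides; dropping the term in [S] leaves the inequality required. *)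
have [V [VM Vc]] : exists V, Ma *m V = row_mx (stack wm 0) Y /\
    forall n (X : 'M[C]_(n, 1 + \sum_(i < p) \sum_(i < N) wid)), nsq (X *m V) <= nsq X.
  apply: contraction_extension => c.
  rewrite !mul_mx_row !nsq_row_mx !mul_mxrow !nsq_mxrow !nsqKs.
  have -> : nsq (c *m stack wm 0) = complex.Re (kform (cadj c *m c) wm).
    by rewrite -nsqKs big_ord1.
  have -> : nsq (c *m stack one 0) = complex.Re (kform (cadj c *m c) one).
    by rewrite -nsqKs big_ord1.
  have := congr1 (@complex.Re R) (KS (cadj c *m c)); rewrite !raddfD /=.
  have : 0 <= complex.Re (kform (cadj c *m c) S).
    by rewrite -nsqKs sumr_ge0 // => j _; exact: nsq_ge0.
  lra.
exists (transfer delta V al); split.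
- apply: intw_ncfun => m n x y T Gx Gy; exact: transfer_intw.
- by move=> n x Gx v; apply: transfer_bound.
move=> k.
have Gz j : inG delta (scal (z j)) by exact: zO.
have GD : inG delta diagtup.
  apply/inGP; split; first exact: leq_ltn_trans (ltn_ord k).
  have [c [c0 c1 cdval]] := dval_contract; exists c; split => // m y.
  pose F a := \matrix_(j, b) y j a b.
  have -> : y = stack F by apply/funext => j; apply/matrixP => a b; rewrite !mxE.
  under eq_bigr do rewrite dact_diagtup.
  by rewrite !nsq_stack mulr_sumr ler_sum.
have actY : act_delta delta diagtup Y = \mxrow_i stack (fun k => dval k *m E k) i.
  apply: eq_mxrow => i; rewrite -dact_diagtup; congr dact.
  by apply/funext => j; rewrite mxrowK.
move: VM; rewrite /Ma -actY row_mx_blocksV => /eq_row_mx[wE yE].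
(* At the point [diagtup] the interpolation data solve their own state equation, with output [al]
   times [w]. *)
have sY : transfer_state delta V diagtup (stack one 0) Y by rewrite /transfer_state.
have := transferE al Vc GD sY; rewrite /transfer_output wE.
have -> : stack one 0 = Rc al *: const_mx 1.
  by apply/colP => a; rewrite !mxE eqxx mulr1n mulr1.
have alC : Rc al != 0 by rewrite eq_complex /= eqxx andbT gt_eqF.
rewrite -scalemxAr => /(scalerI alC) TD.
(* Each [z k] is a coordinate of [diagtup], so the value at [z k] is the [k]-th entry of the value
   at [diagtup]. *)
have := transfer_intw al Vc (Gz k) GD (scal_diagtup_intw k).
move=> /(congr1 (mulmx^~ (const_mx 1 : 'cV[C]_N))); rewrite -!mulmxA TD.
rewrite -!rowE => /matrixP/(_ 0 0); rewrite !mxE big_ord1 !mxE mulr1.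
by rewrite mulr1n.
Qed.

End Pick.

(** * Extension of a commutative function by compactness *)

Section Extension.
Variable R : realType.
Local Notation C := (R[i]).
Local Notation Rc := (real_complex R).
Variable d : nat.
Local Notation tup n := ('I_d -> 'M[C]_n).

Lemma expmxS n (A : 'M[C]_n) k : A ^+ k.+1 = A *m A ^+ k.
Proof. by rewrite exprS. Qed.

Lemma expmxSr n (A : 'M[C]_n) k : A ^+ k.+1 = A ^+ k *m A.
Proof. by rewrite exprSr. Qed.

Lemma expmx_intw m n (A : 'M[C]_m) (B : 'M[C]_n) (S : 'M[C]_(m, n)) k :
  A *m S = S *m B -> A ^+ k *m S = S *m B ^+ k.
Proof.
move=> AS; elim: k => [|k IHk]; first by rewrite !expr0 mul1mx mulmx1.
by rewrite !expmxS -mulmxA IHk !mulmxA AS.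
Qed.

Lemma expmx_kernel n (A : 'M[C]_n) (v : 'cV[C]_n) k :
  (0 < k)%N -> A *m v = 0 -> A ^+ k *m v = 0.
Proof. by case: k => // k _ Av; rewrite expmxSr -mulmxA Av mulmx0. Qed.

Lemma intw_shift m n (x : tup m) (y : tup n) S (lam : 'I_d -> C) :
  intw x y S -> intw (fun i => x i - (lam i)%:M) (fun i => y i - (lam i)%:M) S.
Proof. by move=> xS i; rewrite mulmxBl mulmxBr xS mul_scalar_mx mul_mx_scalar. Qed.

Lemma wordev_kernel n (X : tup n) (v : 'cV[C]_n) w :
  (forall i, X i *m v = 0) -> w != [::] -> wordev X w *m v = 0.
Proof.
move=> Xv; elim: w => [//|i w IHw] _ /=; rewrite -mulmxA.
by case: w IHw => [|j w] IHw /=; rewrite ?mul1mx // IHw // mulmx0.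
Qed.

Lemma taylorM_eigenvector f (lam : 'I_d -> C) n (T : tup n) (v : 'cV[C]_n) :
  (forall i, T i *m v = lam i *: v) -> taylorM f lam T *m v = f lam *: v.
Proof.
case: n T v => [|n] T v Tv; first by apply/colP => -[].
rewrite /taylorM mulmx_suml big_ord_recl /= [X in _ + X]big1 ?addr0 => [|k _].
  rewrite (big_pred1 [tuple]) => [|w]; last by apply/esym/eqP; exact: (tuple0 w).
  by rewrite /= fact0 invr1 scale1r -scalemxAl mul1mx.
rewrite -scalemxAl mulmx_suml big1 ?scaler0 // => w _.
rewrite -scalemxAl wordev_kernel ?scaler0 // => [i|].
  by rewrite mulmxBl Tv mul_scalar_mx subrr.
by rewrite -size_eq0 size_tuple.
Qed.

Lemma commuting_intw n (x y : tup n) (s : 'M[C]_n) :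
  s \in unitmx -> intw x y s -> commuting y -> commuting x.
Proof.
move=> us xs cy i j; apply: (can_inj (mulmxK us)).
by rewrite -!mulmxA !xs !(mulmxA _ s) !xs -!mulmxA cy.
Qed.

(** * Functional calculus of diagonalizable tuples *)

Section Diagonalizable.
Variables (N : nat) (z : 'I_N -> 'I_d -> C) (r : 'M[C]_N).
Hypothesis ru : r \in unitmx.
Let T := simil (invmx r) (diagtup z).

Let Tr : intw T (diagtup z) r.
Proof.
have iru : invmx r \in unitmx by rewrite unitmx_inv.
by have := intw_inv iru (simil_intw (diagtup z) iru); rewrite invmxK.
Qed.

Let DT : intw (diagtup z) T (invmx r).
Proof. exact: intw_inv Tr. Qed.

Lemma diagtup_eigen k i : diagtup z i *m delta_mx k 0 = z k i *: (delta_mx k 0 : 'cV[C]_N).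
Proof.
rewrite /diagtup mul_diag_mx; apply/colP => a; rewrite !mxE.
by case: eqP => [->|]; rewrite /= ?mulr0.
Qed.

Lemma diagtup_gen_eigen (lam : 'I_d -> C) m (u : 'cV[C]_N) k :
  (forall i, (diagtup z i - (lam i)%:M) ^+ m *m u = 0) -> u k 0 != 0 -> z k = lam.
Proof.
move=> Hu uk; apply/funext => i.
have E s : ((diagtup z i - (lam i)%:M) ^+ s *m u) k 0 = (z k i - lam i) ^+ s * u k 0.
  elim: s => [|s IHs]; first by rewrite !expr0 mul1mx mul1r.
  rewrite expmxS -mulmxA mulmxBl mul_scalar_mx /diagtup mul_diag_mx.
  rewrite !mxE in IHs *; rewrite IHs exprS; ring.
have := E m; rewrite Hu mxE => /esym/eqP; rewrite mulf_eq0 (negPf uk) orbF.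
by rewrite expf_eq0 subr_eq0 => /andP[_ /eqP].
Qed.

Lemma simil_gen_eigen (lam : 'I_d -> C) m (v : 'cV[C]_N) k :
  (forall i, (T i - (lam i)%:M) ^+ m *m v = 0) -> (invmx r *m v) k 0 != 0 -> z k = lam.
Proof.
move=> Hv; apply: (@diagtup_gen_eigen _ m) => i.
by rewrite mulmxA (expmx_intw _ (intw_shift lam DT i)) -mulmxA Hv mulmx0.
Qed.

(** A joint generalized eigenvector of [T] is a genuine one, where the Taylor polynomial reduces to
    its constant term; the columns of [r] span, so the defining property of [fcalc] determines one
    matrix. *)
Lemma fcalc_diagonalizable f :
  fcalc f T = r *m diag_mx (\row_k f (z k)) *m invmx r.
Proof.
set M0 := r *m _ *m _.
have Tev k i : T i *m (r *m delta_mx k 0) = z k i *: (r *m delta_mx k 0 : 'cV_N).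
  by rewrite mulmxA Tr -mulmxA diagtup_eigen scalemxAr.
have M0P (lam : 'I_d -> C) (v : 'cV[C]_N) :
    (forall i, (T i - (lam i)%:M) ^+ N *m v = 0) -> M0 *m v = taylorM f lam T *m v.
  move=> Hv; have [u uE vE] : exists2 u, u = invmx r *m v & v = r *m u.
    by exists (invmx r *m v); rewrite ?mulKVmx.
  have uz k : u k 0 != 0 -> z k = lam by rewrite uE; exact: simil_gen_eigen Hv.
  have Du i : diagtup z i *m u = lam i *: u.
    rewrite /diagtup mul_diag_mx; apply/colP => k; rewrite !mxE.
    by have [->|/uz->] := eqVneq (u k 0) 0; rewrite ?mulr0.
  rewrite taylorM_eigenvector => [|i].
    rewrite /M0 -!mulmxA -uE [in RHS]vE scalemxAr; congr (_ *m _).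
    rewrite mul_diag_mx; apply/colP => k; rewrite !mxE.
    by have [->|/uz->] := eqVneq (u k 0) 0; rewrite ?mulr0.
  by rewrite vE mulmxA Tr -mulmxA Du scalemxAr.
rewrite /fcalc; case: xgetP => [M _ MP|H]; last by case: (H M0).
suff Mr : M *m r = M0 *m r by rewrite -(mulmxK ru M) Mr mulmxK.
apply: mulmx_colP => e; rewrite -(mulmxA M) -(mulmxA M0).
have -> : e = \sum_k e k 0 *: delta_mx k 0.
  by rewrite {1}(matrix_sum_delta e); apply: eq_bigr => k _; rewrite big_ord1.
rewrite !mulmx_sumr; apply: eq_bigr => k _; rewrite -!scalemxAr; congr (_ *: _).
have Hk i : (T i - (z k i)%:M) ^+ N *m (r *m delta_mx k 0 : 'cV_N) = 0.
  have N0 : (0 < N)%N := leq_ltn_trans (leq0n k) (ltn_ord k).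
  by apply: expmx_kernel => //; rewrite mulmxBl Tev mul_scalar_mx subrr.
exact: etrans (MP _ _ Hk) (esym (M0P _ _ Hk)).
Qed.

Lemma jspec_diagonalizable lam : jspec T lam -> exists k, z k = lam.
Proof.
move=> [v [v0 Tv]].
have : invmx r *m v != 0.
  by apply: contra v0 => /eqP/(congr1 (mulmx r)); rewrite mulKVmx // mulmx0 => ->.
case/cV0Pn => k uk; exists k; apply: (simil_gen_eigen (m := 1) _ uk) => i.
by rewrite expr1 mulmxBl Tv mul_scalar_mx subrr.
Qed.

Lemma commuting_diagonalizable : commuting T.
Proof.
by apply: (commuting_intw ru Tr) => i j; rewrite /diagtup diag_mxC.
Qed.

End Diagonalizable.

Variables (p q : nat) (delta : 'I_p -> 'I_q -> ncpoly R d).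

Lemma commutative_extension (f : ('I_d -> C) -> C) (al : R) : 0 < al ->
  (forall n (T : tup n), admissible delta T -> opnorm (fcalc f T) <= al) ->
  exists phi : ncfun R d,
  [/\ is_ncfun delta phi,
      forall n (x : tup n), inG delta x -> forall v : 'cV[C]_n,
        nsq (phi n x *m v) <= al ^+ 2 * nsq v &
      forall z, Omega delta z -> phi 1%N (scal z) 0 0 = f z].
Proof.
move=> al0 fal.
pose pts := {N : nat & {z : 'I_N -> 'I_d -> C | forall k, Omega delta (z k)}}.
pose pt (s : pts) : 'I_(tag s) -> 'I_d -> C := sval (tagged s).
have ptO (s : pts) k : Omega delta (pt s k) := svalP (tagged s) k.
have interp (s : pts) : {phi : ncfun R d |
  [/\ is_ncfun delta phi,
      forall n (x : tup n), inG delta x -> forall v : 'cV[C]_n,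
        nsq (phi n x *m v) <= al ^+ 2 * nsq v &
      forall k, phi 1%N (scal (pt s k)) 0 0 = f (pt s k)]}.
  apply/cid/pick_interpolation => // r ru rb v.
  (* The empty family is needed as a base point of the directed set, but tuples of size 0 are not
     admissible. *)
  have [N0|N0] := posnP (tag s).
    have nsq_0 (X : 'cV[C]_(tag s)) : nsq X = 0.
      by rewrite /nsq big1 // => -[i iN]; exfalso; rewrite N0 in iN.
    by rewrite !nsq_0 mulr0.
  rewrite -(fcalc_diagonalizable (pt s) ru f).
  have := fal _ (simil (invmx r) (diagtup (pt s))).
  move=> H; apply: (iffLR (opnorm_leP _ (ltW al0))); apply: H; split => //; split.
    exact: commuting_diagonalizable.
  split; first exact/opnorm_deltaev_le1.
  by move=> lam /(jspec_diagonalizable ru)[k <-].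
(* Inclusion of the sets of points; repetitions and order are ignored. *)
pose le (s t : pts) := forall k, exists l, pt s k = pt t l.
pose empty : pts := existT _ 0%N (exist (fun z : 'I_0 -> 'I_d -> C => forall k, Omega delta (z k))
  (fun k => fun=> 0) (fun k => match k with Ordinal _ h => False_ind _ (notF h) end)).
have [|s t u st tu k|s t|U [UU leU]] := @directed_ultrafilter pts le empty.
- by move=> s k; exists k.
- by have [l ->] := st k; apply: tu.
- pose zz (k : 'I_(tag s + tag t)) :=
    match split k with inl a => pt s a | inr b => pt t b end.
  have zzO k : Omega delta (zz k) by rewrite /zz; case: (split k) => a; apply: ptO.
  exists (existT _ (tag s + tag t)%N (exist _ zz zzO)); split=> k.
    by exists (lshift _ k); rewrite /pt /= /zz -[lshift _ _]/(unsplit (inl k)) unsplitK.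
  by exists (rshift _ k); rewrite /pt /= /zz -[rshift _ _]/(unsplit (inr k)) unsplitK.
pose Phi s := sval (interp s).
have PhiP s := svalP (interp s).
have lim_ex n (x : tup n) : inG delta x -> exists L, mucvg U (fun s => Phi s n x) L.
  move=> Gx; apply: (mucvg_ex (B := \sum_(j < n) al ^+ 2 * nsq (delta_mx j 0 : 'cV[C]_n))) => s.
  rewrite nsq_cols; apply: ler_sum => j _; rewrite colE.
  by have [_ H _] := PhiP s; apply: H.
pose phi : ncfun R d := fun n x => xget 0 [set L | mucvg U (fun s => Phi s n x) L]%classic.
have phiP n (x : tup n) : inG delta x -> mucvg U (fun s => Phi s n x) (phi n x).
  move=> Gx; rewrite /phi; case: xgetP => // H.
  by have [L HL] := lim_ex _ _ Gx; case: (H L).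
exists phi; split.
- apply: intw_ncfun => m n x y S Gx Gy xS.
  apply: (mucvg_uniq (mucvg_mul (phiP _ _ Gx) (mucvg_cst S))).
  rewrite (_ : (fun s => _) = fun s => S *m Phi s n y).
    exact: mucvg_mul (mucvg_cst S) (phiP _ _ Gy).
  by apply/funext => s; have [H _ _] := PhiP s; exact: (ncfun_intw H).
- move=> n x Gx v.
  apply: (mucvg_nsq_le (mucvg_mul (phiP _ _ Gx) (mucvg_cst v))).
  apply: filterS filterT => s _ /=; have [_ H _] := PhiP s; exact: H.
- move=> z Oz.
  pose s1 : pts := existT _ 1%N (exist (fun z : 'I_1 -> 'I_d -> C => forall k, Omega delta (z k))
    (fun=> z) (fun=> Oz)).
  (* From the one-point family of [z] on, the interpolants all take the value [f z]. *)
  apply: (ucvg_uniq (phiP _ (scal z) Oz 0 0)) => e e0.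
  apply: filterS (leU s1) => s /= /(_ ord0)[l zl].
  have [_ _ H] := PhiP s; have := H l; rewrite -zl => ->.
  by rewrite subrr cabs0.
Qed.

End Extension.

(** * Neighbourhoods of matrix tuples *)

Section NcCalculus.
Variable R : realType.
Local Notation C := (R[i]).
Local Notation Rc := (real_complex R).
Variable d : nat.
Local Notation tup n := ('I_d -> 'M[C]_n).

Definition tnbhs n (x : tup n) : set_system (tup n) := fun A =>
  exists2 eta : R, 0 < eta &
    forall y : tup n, (forall i a b, cabs (y i a b - x i a b) < eta) -> A y.

Lemma tnbhs_proper n (x : tup n) : ProperFilter (tnbhs x).
Proof.
apply: Build_ProperFilter_ex => [A [e e0 eA]|].
  by exists x; apply: eA => i a b; rewrite subrr cabs0.
split.
- by exists 1.
- move=> A B [e e0 eA] [f f0 fB]; exists (Num.min e f); first by rewrite lt_min e0.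
  move=> y xy; split; [apply: eA|apply: fB] => i a b;
    by have := xy i a b; rewrite lt_min => /andP[].
- by move=> A B AB [e e0 eA]; exists e => // y /eA/AB.
Qed.
#[export] Existing Instance tnbhs_proper.

Definition tcvg I (U : set_system I) n (F : I -> tup n) (X : tup n) : Prop :=
  forall i, mucvg U (fun k => F k i) (X i).

Lemma tcvg_tnbhs I (U : set_system I) {FU : ProperFilter U} n (F : I -> tup n) X A :
  tcvg U F X -> tnbhs X A -> U [set k | A (F k)]%classic.
Proof.
move=> FX [e e0 eA].
have : U (fun k => forall i a b, cabs (F k i a b - X i a b) < e).
  have H (i : 'I_d) : U (fun k => forall a b, cabs (F k i a b - X i a b) < e).
    have H' a : U (fun k => forall b, cabs (F k i a b - X i a b) < e).
      have /filter_forall := fun b => FX i a b e e0.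
      by apply: filterS => k Hk b; apply: Hk.
    have /filter_forall := H'.
    by apply: filterS => k Hk a b; apply: Hk.
  have /filter_forall := H.
  by apply: filterS => k Hk i a b; apply: Hk.
by apply: filterS => k /= Hk; apply: eA.
Qed.

Lemma tcvg_id n (x : tup n) : tcvg (tnbhs x) id x.
Proof. by move=> i a b e e0; exists e => // y xy; apply: xy. Qed.

Lemma mucvg_comp I (U : set_system I) {FU : ProperFilter U} n (F : I -> tup n) X
    a b (g : tup n -> 'M[C]_(a, b)) L :
  tcvg U F X -> mucvg (tnbhs X) g L -> mucvg U (fun k => g (F k)) L.
Proof. by move=> FX gL i j e e0; exact: (tcvg_tnbhs FX (gL i j e e0)). Qed.

Lemma mucvg_block I (U : set_system I) {FU : ProperFilter U} m1 m2 n1 n2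
    (A : I -> 'M[C]_(m1, n1)) (B : I -> 'M[C]_(m1, n2))
    (D : I -> 'M[C]_(m2, n1)) (E : I -> 'M[C]_(m2, n2)) A' B' D' E' :
  mucvg U A A' -> mucvg U B B' -> mucvg U D D' -> mucvg U E E' ->
  mucvg U (fun k => block_mx (A k) (B k) (D k) (E k)) (block_mx A' B' D' E').
Proof.
move=> HA HB HD HE i j e e0.
rewrite -(splitK i) -(splitK j); case: (split i) => i'; case: (split j) => j' /=;
  rewrite ?(block_mxEul, block_mxEur, block_mxEdl, block_mxEdr).
- by apply: filterS (HA i' j' e e0) => k /=; rewrite block_mxEul.
- by apply: filterS (HB i' j' e e0) => k /=; rewrite block_mxEur.
- by apply: filterS (HD i' j' e e0) => k /=; rewrite block_mxEdl.
- by apply: filterS (HE i' j' e e0) => k /=; rewrite block_mxEdr.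
Qed.

Lemma mucvg_sum I (U : set_system I) {FU : ProperFilter U} m n (J : Type) (r : seq J)
    (A : J -> I -> 'M[C]_(m, n)) (L : J -> 'M[C]_(m, n)) :
  (forall j, mucvg U (A j) (L j)) ->
  mucvg U (fun k => \sum_(j <- r) A j k) (\sum_(j <- r) L j).
Proof.
move=> AL; elim: r => [|j r IHr].
  rewrite big_nil (_ : (fun k => _) = fun=> 0); first exact: mucvg_cst.
  by apply/funext => k; rewrite big_nil.
rewrite big_cons (_ : (fun k => _) = fun k => A j k + \sum_(j <- r) A j k).
  exact: mucvgD.
by apply/funext => k; rewrite big_cons.
Qed.

Lemma mucvgZ I (U : set_system I) {FU : ProperFilter U} m n (a : I -> C) l
    (A : I -> 'M[C]_(m, n)) L :
  ucvg U a l -> mucvg U A L -> mucvg U (fun k => a k *: A k) (l *: L).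
Proof.
move=> al AL i j; rewrite mxE (_ : (fun k => _) = fun k => a k * A k i j).
  exact: ucvgM.
by apply/funext => k; rewrite mxE.
Qed.

Lemma nceval_cont P n (x : tup n) : mucvg (tnbhs x) (fun y => nceval P y) (nceval P x).
Proof.
rewrite /nceval; apply: mucvg_sum => t; apply: mucvgZ; first exact: ucvg_cst.
elim: t.2 => [|i w IHw] /=; first exact: mucvg_cst.
by apply: mucvg_mul IHw; exact: tcvg_id.
Qed.

Lemma nsq_small I (U : set_system I) {FU : ProperFilter U} m n (A : I -> 'M[C]_(m, n)) L e :
  0 < e -> mucvg U A L -> U [set k | nsq (A k - L) < e]%classic.
Proof.
move=> e0 AL; have H : ucvg U (fun k => Rc (nsq (A k - L))) (Rc (nsq (L - L))).
  by apply: mucvg_nsq; apply: mucvgD AL _; apply: mucvg_cst.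
apply: filterS (H e e0) => k /=.
by rewrite subrr nsq0 subr0 cabsR ger0_norm ?nsq_ge0.
Qed.

Section Domain.
Variables (p q : nat) (delta : 'I_p -> 'I_q -> ncpoly R d).
Local Notation G := (inG delta).

Lemma deltaev_cont n (x : tup n) :
  mucvg (tnbhs x) (fun y => deltaev delta y) (deltaev delta x).
Proof.
move=> a b e e0; rewrite /deltaev mxE.
have := @nceval_cont (delta (tag (tagnat.sig a)) (tag (tagnat.sig b))) n x
  (tagnat.sig2 a) (tagnat.sig2 b) e e0.
by apply: filterS => y /=; rewrite mxE.
Qed.

Lemma inG_open n (x : tup n) : G x -> tnbhs x (@inG R d p q delta n).
Proof.
move=> Gx; have [n0 /opnorm_lt1P[c [c0 c1 xc]]] := Gx.
(* The constant becomes [(1 + t) * c + (1 - c) / 4], where [t * c <= (1 - c) / 2]; [e] below is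
   chosen to make the perturbation cost [(1 - c) / 4]. *)
pose t := (1 - c) / 2; have t0 : 0 < t by rewrite /t; lra.
pose K : R := (\sum_(j < q) n)%N%:R; have K0 : 0 <= K by rewrite ler0n.
have s0 : 0 < 1 + t^-1 by have : 0 < t^-1 by [rewrite invr_gt0]; lra.
pose e := (1 - c) / 4 / ((1 + t^-1) * (K + 1)).
have e0 : 0 < e by rewrite !divr_gt0 ?mulr_gt0 //; lra.
have ne : tnbhs x [set y | nsq (deltaev delta y - deltaev delta x) < e]%classic.
  exact: nsq_small (deltaev_cont x).
apply: filterS ne => y /= ye.
split => //; apply/opnorm_lt1P; exists ((1 + t) * c + (1 - c) / 4); split.
- by have := mulr_ge0 (ltW t0) c0; lra.
- by have := mulr_ge0 (ltW t0) c0; rewrite /t; nra.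
- move=> v; rewrite -(subrK (deltaev delta x) (deltaev delta y)) mulmxDl addrC.
  apply: le_trans (nsqD_le _ _ t0) _; rewrite [leRHS]mulrDl -mulrA.
  apply: lerD; first by rewrite ler_wpM2l //; lra.
  apply: (@le_trans _ _ ((1 + t^-1) * (K * e * nsq v))).
    rewrite ler_wpM2l ?(ltW s0) //; apply: le_trans (nsq_mulmx_le _ _) _.
    by rewrite ler_wpM2r ?nsq_ge0 // ler_wpM2l // ltW.
  rewrite mulrA ler_wpM2r ?nsq_ge0 //.
  have eE : (1 - c) / 4 = e * ((1 + t^-1) * (K + 1)).
    by rewrite divfK // gt_eqF // mulr_gt0 //; lra.
  rewrite eE -subr_ge0 (_ : _ - _ = e * (1 + t^-1)); last by ring.
  by rewrite mulr_ge0 // ltW.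
Qed.

End Domain.
End NcCalculus.

(** * Difference-differential calculus of nc functions *)

Section Domain.
Variable R : realType.
Local Notation C := (R[i]).
Local Notation Rc := (real_complex R).
Variable d : nat.
Local Notation tup n := ('I_d -> 'M[C]_n).
Variables (p q : nat) (delta : 'I_p -> 'I_q -> ncpoly R d).
Local Notation G := (inG delta).

(* The similarity envelope of G_delta. Unlike G_delta it contains every block triangular
   tuple whose diagonal blocks it contains. *)
Definition Dom n (x : tup n) : Prop :=
  exists s y, [/\ s \in unitmx, intw x y s & G y].

Definition lblock m n (x' : tup m) (y : 'I_d -> 'M[C]_(n, m)) (x : tup n) : tup (m + n) :=
  fun i => block_mx (x' i) 0 (y i) (x i).

Lemma lblock_inr m n (x' : tup m) y (x : tup n) :
  intw (lblock x' y x) x (col_mx 0 1%:M).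
Proof.
by move=> i; rewrite /lblock mul_block_col mul_col_mx !mulmx0 !mul0mx mul1mx mulmx1 !add0r.
Qed.

Lemma G_Dom n (x : tup n) : G x -> Dom x.
Proof. by exists 1%:M, x; rewrite unitmx1; split => // i; rewrite mulmx1 mul1mx. Qed.

Lemma Dom_intw n (x y : tup n) s : s \in unitmx -> intw x y s -> Dom y -> Dom x.
Proof.
move=> us xy [t [z [ut yz Gz]]]; exists (s *m t), z; split => //.
  by rewrite unitmx_mul us.
exact: intw_comp xy yz.
Qed.

Lemma tcvg_simil I (U : set_system I) {FU : ProperFilter U} n (F : I -> tup n) X s :
  tcvg U F X -> tcvg U (fun k => simil s (F k)) (simil s X).
Proof.
move=> FX i; apply: mucvg_mul (mucvg_cst s); apply: mucvg_mul (FX i).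
exact: mucvg_cst.
Qed.

Lemma Dom_open n (x : tup n) : Dom x -> tnbhs x (@Dom n).
Proof.
move=> [s [y [us xy Gy]]]; move: Gy; rewrite -(intw_simil us xy) => /inG_open.
move/(tcvg_tnbhs (tcvg_simil s (tcvg_id x))).
apply: filterS => x' /= Gx'; exists s, (simil s x'); split => //.
exact: simil_intw.
Qed.

(* The filter of punctured neighbourhoods of 0 in has_pderiv. *)
Definition to0 : set_system C := fun A =>
  exists2 eta : R, 0 < eta & forall t : C, t != 0 -> cabs t < eta -> A t.

Lemma to0_proper : ProperFilter to0.
Proof.
apply: Build_ProperFilter_ex => [A [e e0 eA]|].
  exists (Rc (e / 2)); apply: eA; rewrite ?cabsR ?ger0_norm; try lra.
  by rewrite eq_complex /= eqxx andbT; lra.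
split.
- by exists 1.
- move=> A B [e e0 eA] [f f0 fB]; exists (Num.min e f); first by rewrite lt_min e0.
  by move=> t t0; rewrite lt_min => /andP[te tf]; split; [apply: eA|apply: fB].
- by move=> A B AB [e e0 eA]; exists e => // t t0 /(eA t t0)/AB.
Qed.
#[export] Existing Instance to0_proper.

Lemma to0_id : ucvg to0 id 0.
Proof. by move=> e e0; exists e => // t _ te /=; rewrite subr0. Qed.

Lemma to0_neq0 : to0 [set t | t != 0]%classic.
Proof. by exists 1. Qed.

Lemma unit_diag_block m n (s : 'M[C]_m) (t : 'M[C]_n) :
  s \in unitmx -> t \in unitmx -> block_mx s 0 0 t \in unitmx.
Proof. by rewrite !unitmxE det_ublock => us ut; rewrite unitrM us. Qed.

(** A similarity by [diag(t, 1)] multiplies the corner by [t]; for small [t] the tuple is near a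
    direct sum of points of [G], and [G] is open. *)
Lemma Dom_lblock m n (x' : tup m) y (x : tup n) : Dom x' -> Dom x -> Dom (lblock x' y x).
Proof.
move=> [s' [z' [us' xz' Gz']]] [s [z [us xz Gz]]].
pose y0 i := invmx s *m y i *m s'.
apply: (Dom_intw (y := lblock z' y0 z) (unit_diag_block us' us)).
  move=> i; rewrite /lblock !mulmx_block !mul0mx !mulmx0 !addr0 !add0r xz' xz.
  by rewrite /y0 !mulmxA mulmxV // mul1mx.
have c0 : tcvg to0 (fun t => lblock z' (fun i => t *: y0 i) z) (dsum z' z).
  move=> i; apply: mucvg_block; [exact: mucvg_cst|exact: mucvg_cst| |exact: mucvg_cst].
  rewrite -(scale0r (y0 i)); apply: mucvgZ; [exact: to0_id|exact: mucvg_cst].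
have [t [Gt t0]] := filter_ex (filterI (tcvg_tnbhs c0 (inG_open (inG_dsum Gz' Gz))) to0_neq0).
apply: (Dom_intw (y := lblock z' (fun i => t *: y0 i) z) (s := block_mx t%:M 0 0 1%:M)).
- apply: unit_diag_block (unitmx1 _ _).
  by rewrite unitmxE det_scalar unitrX // unitfE.
- move=> i; rewrite /lblock !mulmx_block !mul0mx !mulmx0 !addr0 !add0r !mul1mx !mulmx1.
  by rewrite mul_mx_scalar mul_mx_scalar mul_scalar_mx.
- exact: G_Dom.
Qed.

Lemma tcvg_lblock I (U : set_system I) {FU : ProperFilter U} m n
    (F' : I -> tup m) Y (F : I -> tup n) X' Z X :
  tcvg U F' X' -> (forall i, mucvg U (fun k => Y k i) (Z i)) -> tcvg U F X ->
  tcvg U (fun k => lblock (F' k) (Y k) (F k)) (lblock X' Z X).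
Proof. by move=> HF' HY HF i; apply: mucvg_block => //; apply: mucvg_cst. Qed.

Definition ncI (g : ncfun R d) : Prop := forall m n (x : tup m) (y : tup n) S,
  Dom x -> Dom y -> intw x y S -> g m x *m S = S *m g n y.

(** A global bound need not survive [ncpartial]; a local one does, by [ncreg_partial], and it
    suffices for continuity. *)
Definition locbd (g : ncfun R d) : Prop := forall n (x : tup n), Dom x ->
  exists2 B : R, 0 <= B & tnbhs x [set y | nsq (g n y) <= B]%classic.

Definition ncreg g := ncI g /\ locbd g.

(* The nc difference-differential Delta g(x, x')(y): the corner of g at [[x', 0], [y, x]]. *)
Definition ncdiff (g : ncfun R d) m n (x' : tup m) (y : 'I_d -> 'M[C]_(n, m)) (x : tup n) :
  'M[C]_(n, m) := dlsubmx (g (m + n)%N (lblock x' y x)).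

Section Calculus.
Variable g : ncfun R d.
Hypothesis gI : ncI g.

Lemma ncI_lblock m n (x' : tup m) y (x : tup n) : Dom x' -> Dom x ->
  g (lblock x' y x) = block_mx (g x') 0 (ncdiff g x' y x) (g x).
Proof.
move=> Dx' Dx; have DX := Dom_lblock y Dx' Dx.
have h1 := lblock_inr x' y x.
have h2 : intw x' (lblock x' y x) (row_mx 1%:M 0).
  by move=> i; rewrite /lblock mul_row_block mul_mx_row !mulmx0 !mul0mx mul1mx mulmx1 !addr0.
have := gI Dx' DX h2; have := gI DX Dx h1.
rewrite /ncdiff -[g (lblock _ _ _)]submxK block_mxKdl.
rewrite mul_block_col mul_col_mx mul_row_block mul_mx_row !mulmx0 !mul0mx !mul1mx !mulmx1.
rewrite !addr0 !add0r => /eq_col_mx[E1 E2] /eq_row_mx[E3 E4].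
by rewrite E1 E2 -E3.
Qed.

(** The column of [1] and [T] intertwines the block tuple with [x']. Scalar [T] gives the difference
    formulas for [g]. *)
Lemma ncdiff_comm m n (x' : tup m) (x : tup n) (T : 'M[C]_(n, m)) : Dom x' -> Dom x ->
  ncdiff g x' (fun i => T *m x' i - x i *m T) x = T *m g x' - g x *m T.
Proof.
move=> Dx' Dx; set y := fun i => _; have DX := Dom_lblock y Dx' Dx.
have h : intw (lblock x' y x) x' (col_mx 1%:M T).
  move=> i; rewrite /lblock mul_block_col mul_col_mx !mul0mx !mulmx1 addr0 mul1mx.
  by rewrite /y subrK.
have := gI DX Dx' h; rewrite ncI_lblock // mul_block_col mul_col_mx !mul0mx !mulmx1 mul1mx.
by rewrite addr0 => /eq_col_mx[_ <-]; rewrite addrK.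
Qed.

Lemma ncdiff0 m n (x' : tup m) (x : tup n) : Dom x' -> Dom x -> ncdiff g x' (fun=> 0) x = 0.
Proof.
move=> Dx' Dx; have := ncdiff_comm 0 Dx' Dx.
rewrite mul0mx mulmx0 subrr => {2}<-; congr ncdiff; apply/funext => i.
by rewrite mul0mx mulmx0 subrr.
Qed.

(** Both summands are stacked in one corner over two copies of [x]; the rows [(a, b)] intertwine
    every combination with that single tuple. *)
Lemma ncdiffD m n (x' : tup m) y1 y2 (x : tup n) : Dom x' -> Dom x ->
  ncdiff g x' (fun i => y1 i + y2 i) x = ncdiff g x' y1 x + ncdiff g x' y2 x.
Proof.
move=> Dx' Dx; have Dxx : Dom (lblock x (fun=> 0) x) by exact: Dom_lblock.
pose y i := col_mx (y1 i) (y2 i); set xx := lblock x (fun=> 0) x in Dxx.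
have DZ := Dom_lblock y Dx' Dxx.
have key (a b : C) : ncdiff g x' (fun i => a *: y1 i + b *: y2 i) x =
    row_mx a%:M b%:M *m ncdiff g x' y xx.
  set u := fun i => _; have Du := Dom_lblock u Dx' Dx.
  have h : intw (lblock x' u x) (lblock x' y xx)
       (block_mx 1%:M 0 0 (row_mx a%:M b%:M)).
    move=> i; rewrite /lblock !mulmx_block !mul0mx !mulmx0 !mul1mx !mulmx1 !addr0 !add0r.
    rewrite /y /xx /lblock mul_row_col mul_row_block !mulmx0 addr0 add0r mul_mx_row.
    by rewrite !mul_scalar_mx !mul_mx_scalar.
  have := gI Du DZ h; rewrite !ncI_lblock // !mulmx_block.
  rewrite !mul0mx !mulmx0 !mul1mx !mulmx1 !addr0 !add0r.
  by case/eq_block_mx => _ _ -> _.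
have E (a b : C) u : (forall i, u i = a *: y1 i + b *: y2 i) ->
    ncdiff g x' u x = row_mx a%:M b%:M *m ncdiff g x' y xx.
  by move=> uE; rewrite -key; congr ncdiff; apply/funext.
rewrite (E 1 1) => [|i]; last by rewrite !scale1r.
rewrite (E 1 0 y1) => [|i]; last by rewrite scale1r scale0r addr0.
rewrite (E 0 1 y2) => [|i]; last by rewrite scale1r scale0r add0r.
by rewrite -mulmxDl add_row_mx -!raddfD /= addr0 add0r.
Qed.

Lemma ncdiff_mulr l m n (x' : tup m) (x'' : tup l) y (x : tup n) N :
  Dom x' -> Dom x'' -> Dom x -> intw x' x'' N ->
  ncdiff g x'' (fun i => y i *m N) x = ncdiff g x' y x *m N.
Proof.
move=> Dx' Dx'' Dx xN; set u := fun i => _.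
have DX := Dom_lblock y Dx' Dx; have DY := Dom_lblock u Dx'' Dx.
have h : intw (lblock x' y x) (lblock x'' u x) (block_mx N 0 0 1%:M).
  by move=> i; rewrite /lblock !mulmx_block !mul0mx !mulmx0 !mul1mx !mulmx1 !addr0 !add0r xN.
have := gI DX DY h; rewrite !ncI_lblock // !mulmx_block.
rewrite !mul0mx !mulmx0 !mul1mx !mulmx1 !addr0 !add0r.
by case/eq_block_mx => _ _ -> _.
Qed.

Lemma ncdiff_sum m n (x' : tup m) (J : Type) (r : seq J) (y : J -> 'I_d -> 'M[C]_(n, m)) (x : tup n) :
  Dom x' -> Dom x ->
  ncdiff g x' (fun i => \sum_(j <- r) y j i) x = \sum_(j <- r) ncdiff g x' (y j) x.
Proof.
move=> Dx' Dx; elim: r => [|j r IHr].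
  rewrite big_nil -[RHS](ncdiff0 Dx' Dx); congr ncdiff; apply/funext => i.
  by rewrite big_nil.
by rewrite big_cons -IHr -ncdiffD //; congr ncdiff; apply/funext => i; rewrite big_cons.
Qed.

Definition unit_tup n j : tup n := fun i => (i == j)%:R%:M.

(** Write [h] as the sum of the directions [unit_tup n j] times [h j]. Each [h j] commutes with [x']
    and so leaves the corner on the right by [ncdiff_mulr]: the formula is exact, not merely of
    first order. *)
Lemma nc_increment n (x x' : tup n) (h : tup n) : Dom x -> Dom x' ->
  (forall i, x' i = x i + h i) -> (forall i j, x' i *m h j = h j *m x' i) ->
  g x' - g x = \sum_j ncdiff g x' (unit_tup n j) x *m h j.
Proof.
move=> Dx Dx' xh hc.
have -> : g x' - g x = ncdiff g x' h x.
  have := ncdiff_comm 1%:M Dx' Dx; rewrite mul1mx mulmx1 => <-; congr ncdiff.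
  by apply/funext => i; rewrite mul1mx mulmx1 xh addrAC subrr add0r.
have {1}-> : h = fun i => \sum_j unit_tup n j i *m h j.
  apply/funext => i; rewrite (bigD1 i) //= big1 ?addr0 => [|j ji].
    by rewrite /unit_tup eqxx mul1mx.
  by rewrite /unit_tup eq_sym (negPf ji) mul_scalar_mx scale0r.
rewrite (ncdiff_sum _ (fun j i => unit_tup n j i *m h j)) //; apply: eq_bigr => j _.
by apply: ncdiff_mulr => // i.
Qed.

End Calculus.

(* For fixed c, g at [[x, 0], [c (x - y), y]] has the corner c (g x - g y) and stays
   bounded as y tends to x; c is arbitrarily large. *)
Lemma ncreg_cont g n (x : tup n) : ncreg g -> Dom x -> mucvg (tnbhs x) (g n) (g n x).
Proof.
move=> [gI gb] Dx a b e e0.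
have DX : Dom (lblock x (fun=> 0) x) by exact: Dom_lblock.
have [B B0 nbB] := gb _ _ DX.
(* Here [c * e = B + 2], whose square exceeds [B]. *)
have [c c0 cB] : exists2 c : R, 0 < c & B < c ^+ 2 * e ^+ 2.
  exists ((B + 1) / e + e^-1); first by rewrite addr_gt0 ?divr_gt0 ?invr_gt0 //; lra.
  rewrite -exprMn mulrDl divfK ?mulVf ?gt_eqF //; nra.
have Fc : tcvg (tnbhs x) (fun y => lblock x (fun i => Rc c *: (x i - y i)) y)
                      (lblock x (fun=> 0) x).
  apply: tcvg_lblock; [by move=> i; exact: mucvg_cst| |exact: tcvg_id].
  move=> i; rewrite -(scaler0 _ (Rc c)) -(subrr (x i)).
  apply: mucvgZ; first exact: ucvg_cst.
  apply: mucvgD; first exact: mucvg_cst.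
  by apply: mucvgN; exact: tcvg_id.
apply: filterS (filterI (tcvg_tnbhs Fc nbB) (Dom_open Dx)) => y [/= yB Dy].
have DlE : ncdiff g x (fun i => Rc c *: (x i - y i)) y = Rc c *: (g _ x - g _ y).
  rewrite scalerBr -mul_scalar_mx -mul_mx_scalar -(ncdiff_comm gI _ Dx Dy).
  congr ncdiff; apply/funext => i; by rewrite scalerBr mul_scalar_mx mul_mx_scalar.
have : nsq (Rc c *: (g _ x - g _ y)) <= B.
  rewrite -DlE; apply: le_trans yB.
  exact: nsq_dlsubmx_le.
rewrite nsqZR => le_B.
have := cabs2_le_nsq (g _ x - g _ y) a b.
have -> : cabs2 ((g _ x - g _ y) a b) = cabs (g _ y a b - g _ x a b) ^+ 2.
  by rewrite cabs_sqr -cabs2N !mxE opprB.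
move=> le_nsq; rewrite -(ltr_pXn2r (n := 2)) ?nnegrE ?cabs_ge0 ?(ltW e0) //.
rewrite -(ltr_pM2l (exprn_gt0 2 c0)); apply: le_lt_trans cB.
by apply: le_trans le_B; rewrite ler_wpM2l ?sqr_ge0.
Qed.

Definition ncpartial j (g : ncfun R d) : ncfun R d := fun n x => ncdiff g x (unit_tup n j) x.

Lemma unit_tup_intw m n j (S : 'M[C]_(m, n)) i :
  unit_tup m j i *m S = S *m unit_tup n j i.
Proof. by rewrite /unit_tup mul_scalar_mx mul_mx_scalar. Qed.

(** The corner [unit_tup] is scalar, so [block_mx S 0 0 S] intertwines the two block tuples.
    Derivatives can therefore be iterated. *)
Lemma ncreg_partial j g : ncreg g -> ncreg (ncpartial j g).
Proof.
move=> [gI gb]; split=> [m n x y S Dx Dy xS|n x Dx].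
  have DX := Dom_lblock (unit_tup m j) Dx Dx; have DY := Dom_lblock (unit_tup n j) Dy Dy.
  have h : intw (lblock x (unit_tup m j) x) (lblock y (unit_tup n j) y) (block_mx S 0 0 S).
    move=> i; rewrite /lblock !mulmx_block !mul0mx !mulmx0 !addr0 !add0r xS.
    by rewrite unit_tup_intw.
  have := gI _ _ _ _ _ DX DY h; rewrite !ncI_lblock // !mulmx_block.
  rewrite !mul0mx !mulmx0 !addr0 !add0r.
  by case/eq_block_mx.
have [B B0 nbB] := gb _ _ (Dom_lblock (unit_tup n j) Dx Dx).
exists B => //.
have Fc : tcvg (tnbhs x) (fun y => lblock y (unit_tup n j) y) (lblock x (unit_tup n j) x).
  by apply: tcvg_lblock; [exact: tcvg_id|move=> i; exact: mucvg_cst|exact: tcvg_id].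
apply: filterS (tcvg_tnbhs Fc nbB) => y /= yB; apply: le_trans yB.
exact: nsq_dlsubmx_le.
Qed.

Lemma ncdiff_cont I (U : set_system I) {FU : ProperFilter U} j g n (F F' : I -> tup n) x :
  ncreg g -> Dom x -> tcvg U F' x -> tcvg U F x ->
  mucvg U (fun k => ncdiff g (F' k) (unit_tup n j) (F k)) (ncpartial j g x).
Proof.
move=> gD Dx F'x Fx.
have DX := Dom_lblock (unit_tup n j) Dx Dx.
have Fc : tcvg U (fun k => lblock (F' k) (unit_tup n j) (F k)) (lblock x (unit_tup n j) x).
  by apply: tcvg_lblock => // i; exact: mucvg_cst.
have H : mucvg U (fun k => g _ (lblock (F' k) (unit_tup n j) (F k)))
                 (g _ (lblock x (unit_tup n j) x)).
  exact: mucvg_comp Fc (ncreg_cont gD DX).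
move=> a b e e0.
by apply: filterS (H (rshift n a) (lshift n b) e e0) => k /=; rewrite !mxE.
Qed.

End Domain.

(** * Joint spectra of commuting matrices *)

Section JointSpectrum.
Variable R : realType.
Local Notation C := (R[i]).
Local Notation Rc := (real_complex R).
Variable d : nat.
Local Notation tup n := ('I_d -> 'M[C]_n).

(** The Chinese remainder theorem modulo the product of the [('X - a%:P) ^+ m], by a Bezout relation
    for each new root. *)
Lemma poly_split (s : seq C) (m : nat) : uniq s ->
  exists l : seq (C * {poly C}),
    \prod_(a <- s) ('X - a%:P) ^+ m %| \sum_(t <- l) t.2 - 1 /\
    forall t, t \in l -> \prod_(a <- s) ('X - a%:P) ^+ m %| ('X - t.1%:P) ^+ m * t.2.
Proof.
elim: s => [_|a s IHs /= /andP[a_s us]].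
  by exists [::]; split => //; rewrite !big_nil dvd1p.
have [l [l1 l2]] := IHs us; rewrite big_cons.
set P' := \prod_(b <- s) _ in l1 l2 *; set Q := _ ^+ m.
have /Bezout_eq1_coprimepP[[u v] /= uv] : coprimep Q P'.
  apply: coprimep_expl; rewrite /P' coprimep_sym; elim: (s) a_s => [_|b s' IH].
    by rewrite big_nil coprime1p.
  rewrite inE negb_or => /andP[ab as']; rewrite big_cons coprimepMl IH // andbT.
  by apply: coprimep_expl; apply: coprimep_XsubC2; rewrite subr_eq0.
exists ((a, v * P') :: [seq (t.1, u * Q * t.2) | t <- l]); split.
  rewrite big_cons big_map /= -mulr_sumr.
  have -> : v * P' + u * Q * (\sum_(t <- l) t.2) - 1 = u * (Q * (\sum_(t <- l) t.2 - 1)).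
    by rewrite -{1}uv; ring.
  by rewrite dvdp_mull // dvdp_mul.
move=> t; rewrite inE => /orP[/eqP->|/mapP[t' t'l ->]] /=.
  by rewrite -/Q mulrCA dvdp_mull.
have -> : ('X - t'.1%:P) ^+ m * (u * Q * t'.2) = u * (Q * (('X - t'.1%:P) ^+ m * t'.2)) by ring.
by rewrite dvdp_mull // dvdp_mul // l2.
Qed.

(** Cayley-Hamilton, with exponent [n.+1] as a crude bound for all multiplicities. The components
    are polynomials in [A], so they commute with its commutant. *)
Lemma spectral_split n (A : 'M[C]_n.+1) :
  exists l : seq (C * 'M[C]_n.+1), \sum_(t <- l) t.2 = 1 /\
    forall t, t \in l -> (A - t.1%:M) ^+ n.+1 * t.2 = 0 /\
      forall Y, A * Y = Y * A -> t.2 * Y = Y * t.2.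
Proof.
have [rs rsE] := closed_field_poly_normal (char_poly A).
rewrite (monicP (char_poly_monic A)) scale1r in rsE.
have size_rs : size rs = n.+1.
  by have := size_char_poly A; rewrite rsE size_prod_XsubC => -[].
have [l [l1 l2]] := poly_split n.+1 (undup_uniq rs).
set P := \prod_(a <- undup rs) _ in l1 l2.
have PA : horner_mx A P = 0.
  have /dvdpP[k ->] : char_poly A %| P.
    rewrite rsE /P prodrXl -size_rs.
    suff H (s : seq C) : {subset s <= undup rs} ->
        \prod_(a <- s) ('X - a%:P) %| (\prod_(a <- undup rs) ('X - a%:P)) ^+ size s.
      by apply: H => x; rewrite mem_undup.
    elim: s => [|a s IHs] sQ; first by rewrite big_nil dvd1p.
    rewrite big_cons /= exprS dvdp_mul //.
      by rewrite dvdp_XsubCl root_prod_XsubC sQ ?mem_head.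
    by apply: IHs => x xs; apply: sQ; rewrite inE xs orbT.
  by rewrite rmorphM /= Cayley_Hamilton mulr0.
have dvdA Q : P %| Q -> horner_mx A Q = 0.
  by move=> /dvdpP[k ->]; rewrite rmorphM /= PA mulr0.
exists [seq (t.1, horner_mx A t.2) | t <- l]; split.
  by have := dvdA _ l1; rewrite rmorphB rmorph1 rmorph_sum big_map => /subr0_eq.
move=> t /mapP[t' t'l ->] /=; split.
  have := dvdA _ (l2 _ t'l).
  by rewrite rmorphM rmorphXn rmorphB /= horner_mx_X horner_mx_C.
by move=> Y AY; apply: comm_horner_mx.
Qed.

(** Components of the single matrices are multiplied one coordinate at a time; their commutation
    keeps the earlier annihilations. A component may vanish, and its label is then arbitrary. *)
Lemma joint_decomposition n (T : tup n) : commuting T ->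
  exists l : seq (('I_d -> C) * 'M[C]_n),
    \sum_(t <- l) t.2 = 1%:M /\
    forall t, List.In t l ->
      (forall i, (T i - (t.1 i)%:M) ^+ n *m t.2 = 0) /\
      forall i, T i *m t.2 = t.2 *m T i.
Proof.
move=> cT; case: n T cT => [|n] T cT.
  by exists [::]; split => //; apply/matrixP => -[].
suff [l [l1 l2]] : exists l : seq (('I_d -> C) * 'M[C]_n.+1),
    \sum_(t <- l) t.2 = 1 /\
    forall t, List.In t l ->
      (forall i, i \in enum 'I_d -> (T i - (t.1 i)%:M) ^+ n.+1 * t.2 = 0) /\
      forall i, T i * t.2 = t.2 * T i.
  exists l; split => // t /l2[H1 H2]; split => // i; apply: H1; exact: mem_enum.
elim: (enum 'I_d) (enum_uniq 'I_d) => [_|i L IH /= /andP[iL uL]].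
  exists [:: (fun=> 0, 1)]; split; first by rewrite big_seq1.
  by move=> t [<-|[]]; split => // j; rewrite mulr1 mul1r.
have [l [l1 l2]] := IH uL; have [m [m1 m2]] := spectral_split (T i).
pose upd (lam : 'I_d -> C) a j := if j == i then a else lam j.
exists (flatten [seq [seq (upd t.1 u.1, u.2 * t.2) | u <- m] | t <- l]); split.
  rewrite big_flatten big_map /= -[RHS]l1; apply: eq_bigr => t _.
  by rewrite big_map /= -mulr_suml m1 mul1r.
move=> t /List.in_concat[s [/List.in_map_iff[t' [<- /l2[H1 H2]]]]].
have in_mem u (s' : seq (C * 'M[C]_n.+1)) : List.In u s' -> u \in s'.
  by elim: s' => //= v s' IH' [->|/IH' us]; rewrite inE ?eqxx // us orbT.
move=> /List.in_map_iff[u [<- /in_mem/m2[H3 H4]]] /=; split=> j.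
  rewrite inE /upd => /orP[/eqP->|jL]; first by rewrite eqxx mulrA H3 mul0r.
  have -> : (j == i) = false by apply/negbTE; apply: contraNneq iL => <-.
  have cuY : GRing.comm u.2 (T j - (t'.1 j)%:M).
    by apply: H4; rewrite mulrBr mulrBl -!mulmxE cT scalar_mxC.
  by rewrite mulrA -(commrX n.+1 cuY) -mulrA (H1 j jL) mulr0.
by rewrite mulrA -(H4 (T j) (cT i j)) -mulrA H2 mulrA.
Qed.

(** For one coordinate after the other, replace the vector by its image under the last nonvanishing
    power of [T i - lam i]; commutation preserves what was already achieved. *)
Lemma gen_to_jspec n (T : tup n) (lam : 'I_d -> C) (v : 'cV[C]_n) m :
  commuting T -> v != 0 -> (forall i, (T i - (lam i)%:M) ^+ m *m v = 0) -> jspec T lam.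
Proof.
move=> cT v0 Hv.
suff [w [w0 [_ Hw]]] : exists w : 'cV[C]_n, w != 0 /\
    (forall i, (T i - (lam i)%:M) ^+ m *m w = 0) /\
    forall i, i \in enum 'I_d -> (T i - (lam i)%:M) *m w = 0.
  exists w; split => // i; have := Hw i (mem_enum _ _).
  by rewrite mulmxBl mul_scalar_mx => /subr0_eq.
elim: (enum 'I_d) => [|i L [w [w0 [Hm HL]]]]; first by exists v.
pose N := T i - (lam i)%:M.
have cN j : (T j - (lam j)%:M) *m N = N *m (T j - (lam j)%:M).
  apply: comm_mxB; last exact: comm_mx_scalar.
  by apply/comm_mx_sym/comm_mxB; [exact: cT|exact: comm_mx_scalar].
have [k [Nk0 Nk1]] : exists k, N ^+ k *m w != 0 /\ N *m (N ^+ k *m w) = 0.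
  have := Hm i; rewrite -/N; elim: m {Hv Hm} => [|m IHm].
    by rewrite expr0 mul1mx => /eqP; rewrite (negPf w0).
  have [//|Nm0 Nm] := eqVneq (N ^+ m *m w) 0; first by move=> /IHm.
  by exists m; rewrite mulmxA -expmxS.
exists (N ^+ k *m w); split => //; split=> j.
  have cNk := expmx_intw k (esym (expmx_intw m (cN j))).
  by rewrite mulmxA -cNk -mulmxA Hm mulmx0.
rewrite inE => /orP[/eqP->//|jL].
by rewrite mulmxA -(expmx_intw k (esym (cN j))) -mulmxA HL // mulmx0.
Qed.

Lemma joint_left_eigenvector n (T : tup n) : (0 < n)%N -> commuting T ->
  exists (lam : 'I_d -> C) (l : 'rV[C]_n), l != 0 /\ forall i, l *m T i = lam i *: l.
Proof.
move=> n0 cT.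
have [l l0 /allP lP] : exists2 l : 'rV[C]_n, l != 0 &
    all (fun A => stablemx l A) [seq T i | i <- enum 'I_d].
  by apply: common_eigenvector => // A B /mapP[i _ ->] /mapP[j _ ->]; exact: cT.
have /choice[lam Hlam] : forall i, exists a, l *m T i = a *: l.
  by move=> i; apply/sub_rVP; apply: lP; apply: map_f; rewrite mem_enum.
by exists lam, l.
Qed.

(** [jspec] speaks of right eigenvectors. A component [t.2] on which [l] does not vanish must have
    the label [lam], and its range consists of generalized eigenvectors. *)
Lemma left_eigen_jspec n (T : tup n) lam (l : 'rV[C]_n) : commuting T ->
  l != 0 -> (forall i, l *m T i = lam i *: l) -> jspec T lam.
Proof.
move=> cT l0 lT; have [D [D1 D2]] := joint_decomposition cT.
have [t [tD lt0]] : exists t, List.In t D /\ l *m t.2 != 0.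
  apply: contrapT => H; case/negP: l0.
  rewrite -(mulmx1 l) -D1 mulmx_sumr; elim: (D) H => [|t s IHs] H.
    by rewrite big_nil.
  rewrite big_cons; have -> : l *m t.2 = 0.
    by apply/eqP/negPn/negP => lt; apply: H; exists t; split => //; left.
  rewrite add0r; apply: IHs => -[u [us lu]]; apply: H; exists u; split => //.
  by right.
have [Tt _] := D2 t tD.
have lamE : t.1 = lam.
  apply/funext => i.
  have lk k : l *m (T i - (t.1 i)%:M) ^+ k = (lam i - t.1 i) ^+ k *: l.
    elim: k => [|k IHk]; first by rewrite !expr0 mulmx1 scale1r.
    by rewrite expmxS mulmxA mulmxBr lT mul_mx_scalar -scalerBl -scalemxAl IHk scalerA -exprS.
  have := lk n; move=> /(congr1 (mulmx^~ t.2)); rewrite -mulmxA Tt mulmx0 -scalemxAl.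
  move=> /esym/eqP; rewrite scaler_eq0 (negPf lt0) orbF expf_eq0 subr_eq0 => /andP[_ /eqP].
  by [].
have [e te0] : exists e : 'cV[C]_n, t.2 *m e != 0.
  apply: contrapT => H; case/negP: lt0; apply/eqP.
  suff -> : t.2 = 0 by rewrite mulmx0.
  apply: mulmx_colP => e; rewrite mul0mx; apply/eqP/negPn/negP => te.
  by apply: H; exists e.
apply: (gen_to_jspec (m := n) cT te0) => i.
by rewrite mulmxA -lamE Tt mul0mx.
Qed.

End JointSpectrum.

(** * Simultaneous triangularization and membership in the envelope *)

Section Triangular.
Variable R : realType.
Local Notation C := (R[i]).
Local Notation Rc := (real_complex R).
Variable d : nat.
Local Notation tup n := ('I_d -> 'M[C]_n).

Lemma complete_row n (l : 'rV[C]_n.+1) : l != 0 ->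
  exists2 t : 'M[C]_n.+1, t \in unitmx & exists2 a : C, a != 0 & row 0 t = a *: l.
Proof.
move=> l0; exists (row_ebase l); first exact: row_ebase_unit.
have rl : \rank l = 1%N by rewrite rank_rV l0.
have := mulmx_ebase l; rewrite rl.
have -> : col_ebase l = (col_ebase l 0 0)%:M by rewrite -mx11_scalar.
rewrite mul_scalar_mx -scalemxAl.
have -> : pid_mx 1 *m row_ebase l = row 0 (row_ebase l).
  rewrite rowE; congr (_ *m _); apply/rowP => j; rewrite !mxE eqxx /= ltnS leqn0 -val_eqE /=.
  by case: j => -[|j] hj //=; rewrite ?andbF.
move=> lE; have c0 : col_ebase l 0 0 != 0.
  by apply: contra l0 => /eqP c0; rewrite -lE c0 scale0r.
exists (col_ebase l 0 0)^-1; first by rewrite invr_eq0.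
by apply: (scalerI c0); rewrite lE scalerA mulfV // scale1r.
Qed.

(** A joint left eigenvector, completed to a basis, makes the first row of every matrix equal to
    [(lam, 0)]. *)
Lemma triangularize n (T : tup n.+1) : commuting T ->
  exists (lam : 'I_d -> C) (s : 'M[C]_(1 + n)) (y : 'I_d -> 'M[C]_(n, 1)) (x : tup n),
    [/\ s \in unitmx, intw (T : tup (1 + n)) (lblock (scal lam) y x) s, commuting x
      & jspec T lam].
Proof.
move=> cT; have [lam [l [l0 lT]]] := joint_left_eigenvector (ltn0Sn n) cT.
have [t ut [a a0 tl]] := complete_row l0.
have [X XD] : exists X : tup (1 + n), forall i, X i = t *m T i *m invmx t.
  by exists (fun i => t *m T i *m invmx t).
have rowX i : row 0 (X i) = lam i *: delta_mx 0 0.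
  rewrite XD 2!row_mul tl -scalemxAl lT scalerA mulrC -scalerA -tl -scalemxAl.
  by rewrite -row_mul mulmxV // row1.
have XE : X = lblock (scal lam) (fun i => dlsubmx (X i)) (fun i => drsubmx (X i)).
  apply/funext => i; rewrite /lblock -[LHS]submxK; congr block_mx.
    apply/matrixP => r c; rewrite !ord1 !mxE eqxx mulr1n.
    have := rowX i => /rowP/(_ 0); rewrite !mxE eqxx mulr1 => <-.
    by congr (X i _ _); apply: val_inj.
  apply/matrixP => r c; rewrite !ord1 !mxE.
  have := rowX i => /rowP/(_ (rshift 1 c)); rewrite !mxE /= mulr0 => <-.
  by congr (X i _ _); apply: val_inj.
have tX i : t *m T i = X i *m t by rewrite XD mulmxKV.
have TX : intw (T : tup (1 + n)) X (invmx t).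
  by apply: intw_inv => // i; rewrite tX.
have cX i j : X i *m X j = X j *m X i.
  apply: (can_inj (mulmxK ut)).
  by rewrite -!mulmxA -!tX !mulmxA -!tX -!mulmxA cT.
exists lam, (invmx t), (fun i => dlsubmx (X i)), (fun i => drsubmx (X i)); split.
- by rewrite unitmx_inv.
- by rewrite -XE.
- move=> i j; have := cX i j; rewrite XE /lblock !mulmx_block.
  by case/eq_block_mx => _ _ _; rewrite !mulmx0 !add0r !block_mxKdr.
- exact: (left_eigen_jspec cT l0 lT).
Qed.

Lemma jspec_intw m n (x : tup m) (y : tup n) S lam : intw x y S ->
  (forall v : 'cV[C]_n, S *m v = 0 -> v = 0) -> jspec y lam -> jspec x lam.
Proof.
move=> xS Sinj [v [v0 yv]]; exists (S *m v); split.
  by apply: contra v0 => /eqP/Sinj ->.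
by move=> i; rewrite mulmxA xS -mulmxA yv scalemxAr.
Qed.

Lemma col_mx01_inj m n (v : 'cV[C]_n) : col_mx (0 : 'M_(m, n)) 1%:M *m v = 0 -> v = 0.
Proof. by rewrite mul_col_mx mul0mx mul1mx -col_mx0 => /eq_col_mx[]. Qed.

(** Bounds the length by the dimension, whatever [m] and [d]; this matches the truncation order in
    [taylorM]. The last letter maps into an invariant subspace of codimension 1, where induction
    applies to the other letters. *)
Lemma nilpotent_words n (N : tup n) m w : commuting N ->
  (forall i, N i ^+ m = 0) -> (n <= size w)%N -> wordev N w = 0.
Proof.
elim: n N w => [|n IHn] N w cN Nm nw; first by apply/matrixP => -[].
have [lam [s [y [x [us Nx cx [v [v0 Nv]]]]]]] := triangularize cN.
have lam0 i : lam i = 0.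
  have : N i ^+ m *m v = lam i ^+ m *: v.
    elim: (m) => [|k IHk]; first by rewrite !expr0 mul1mx scale1r.
    by rewrite expmxSr -mulmxA Nv -scalemxAr IHk scalerA -exprS.
  rewrite Nm mul0mx => /esym/eqP; rewrite scaler_eq0 (negPf v0) orbF expf_eq0.
  by case/andP => _ /eqP.
have Nx' : intw (N : tup (1 + n)) x (s *m col_mx 0 1%:M) := intw_comp Nx (lblock_inr _ _ _).
have xm i : x i ^+ m = 0.
  apply: mulmx_colP => e; rewrite mul0mx.
  apply: (@col_mx01_inj 1); apply: (can_inj (mulKmx us)).
  by rewrite mulmx0 !mulmxA -(expmx_intw m (Nx' i)) Nm !mul0mx.
case/lastP: w nw => [//|w j]; rewrite size_rcons ltnS => nw.
have wE : wordev N (rcons w j) = wordev N w *m N j.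
  by elim: (w) => [|k u IHu] /=; rewrite ?mulmx1 ?mul1mx // IHu mulmxA.
have NjE : N j = s *m col_mx 0 1%:M *m row_mx (y j) (x j) *m invmx s.
  apply: (can_inj (mulmxK us)); rewrite mulmxKV // Nx /lblock -mulmxA; congr (_ *m _).
  rewrite block_mxEv mul_col_mx mul0mx mul1mx /scal lam0 -scalemx1 scale0r.
  by rewrite row_mx0.
by rewrite wE NjE !mulmxA -(mulmxA _ s) (wordev_intw _ Nx') IHn // mulmx0 !mul0mx.
Qed.

Variables (p q : nat) (delta : 'I_p -> 'I_q -> ncpoly R d).

(* Splitting off a left eigenvector leaves a restriction of T, not a quotient, so the
   spectral hypothesis is inherited at once. *)
Lemma Dom_commuting n (T : tup n) : (0 < n)%N -> commuting T ->
  (forall lam, jspec T lam -> Omega delta lam) -> Dom delta T.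
Proof.
elim: n T => [//|n IHn] T _ cT TO.
have [lam [s [y [x [us Tx cx Tlam]]]]] := triangularize cT.
have Glam := TO _ Tlam.
(* Size 1 is separate: the remaining tuple would have size 0, which [inG] excludes. *)
case: n IHn T cT TO s y x us Tx cx Tlam => [|n] IHn T cT TO s y x us Tx cx Tlam.
  apply: G_Dom; rewrite (_ : T = scal lam) //; apply/funext => i.
  have [v [v0 /(_ i)]] := Tlam; rewrite (mx11_scalar (T i)) (mx11_scalar v).
  move=> /matrixP/(_ 0 0); rewrite !mxE big_ord1 !mxE !eqxx !mulr1n => E.
  rewrite /scal; congr (_%:M); apply: (mulIf _ E).
  by apply: contra v0 => /eqP v00; rewrite (mx11_scalar v) v00 -scalemx1 scale0r.
apply: (Dom_intw us Tx); apply: Dom_lblock; first exact: G_Dom.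
apply: (IHn x (ltn0Sn n) cx) => mu xmu; apply: TO.
apply: (jspec_intw Tx) => [v sv|].
  by rewrite -(mulKmx us v) sv mulmx0.
exact: jspec_intw (lblock_inr _ _ _) (@col_mx01_inj 1 _) xmu.
Qed.

End Triangular.

(** * Complex derivatives *)

Section ComplexDerivative.
Variable R : realType.
Local Notation C := (R[i]).
Local Notation Rc := (real_complex R).

Definition hasder (F : C -> C) (t L : C) : Prop :=
  ucvg (@to0 R) (fun tau => tau^-1 * (F (t + tau) - F t)) L.

Lemma ucvg_near I (U : set_system I) {FU : ProperFilter U} (a b : I -> C) l :
  U [set i | a i = b i]%classic -> ucvg U a l -> ucvg U b l.
Proof. by move=> ab al e e0; apply: filterS (filterI ab (al e e0)) => i [/= <-]. Qed.

Lemma hasder_cst c t : hasder (fun=> c) t 0.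
Proof.
apply: (ucvg_near _ (ucvg_cst 0)); apply: filterS filterT => tau _ /=.
by rewrite subrr mulr0.
Qed.

Lemma hasderD F F' t L L' : hasder F t L -> hasder F' t L' ->
  hasder (fun s => F s + F' s) t (L + L').
Proof.
move=> H H'; apply: (ucvg_near _ (ucvgD H H')); apply: filterS filterT => tau _ /=.
by rewrite -mulrDr opprD addrACA.
Qed.

Lemma hasder_id t : hasder id t 1.
Proof.
apply: (ucvg_near _ (ucvg_cst 1)); apply: filterS (@to0_neq0 R) => tau /= tau0.
by rewrite addrAC subrr add0r mulVf.
Qed.

Lemma hasder_cont F t L : hasder F t L -> ucvg (@to0 R) (fun tau => F (t + tau)) (F t).
Proof.
move=> H.
have H' : ucvg (@to0 R) (fun tau => tau * (tau^-1 * (F (t + tau) - F t)) + F t) (0 * L + F t).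
  by apply: ucvgD (ucvg_cst _); apply: ucvgM H; exact: to0_id.
rewrite mul0r add0r in H'; apply: (ucvg_near _ H').
apply: filterS (@to0_neq0 R) => tau /= tau0.
by rewrite mulrA mulfV // mul1r subrK.
Qed.

Lemma hasderM F F' t L L' : hasder F t L -> hasder F' t L' ->
  hasder (fun s => F s * F' s) t (L * F' t + F t * L').
Proof.
move=> H H'; apply: (ucvg_near _ (ucvgD (ucvgM H (hasder_cont H')) (ucvgM (ucvg_cst (F t)) H'))).
by apply: filterS filterT => tau _ /=; ring.
Qed.

Lemma hasder_pow k t : hasder (fun s => s ^+ k) t (k%:R * t ^+ k.-1).
Proof.
elim: k => [|k IHk].
  by rewrite mul0r; exact: hasder_cst.
have := hasderM (hasder_id t) IHk; rewrite mul1r /=.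
have -> : t ^+ k + t * (k%:R * t ^+ k.-1) = k.+1%:R * t ^+ k.
  case: k {IHk} => [|k]; first by rewrite mul0r mulr0 addr0 mul1r.
  by rewrite /= mulrCA -exprS -{1}[t ^+ k.+1]mul1r -mulrDl nat1r.
have -> : (fun s : C => s ^+ k.+1) = (fun s => s * s ^+ k) by apply/funext => s; rewrite exprS.
by [].
Qed.

Lemma hasder_sum n (F : 'I_n -> C -> C) t L : (forall k, hasder (F k) t (L k)) ->
  hasder (fun s => \sum_k F k s) t (\sum_k L k).
Proof.
move=> H; apply: (ucvg_near _ (@ucvg_sum _ _ _ _ _ (index_enum _) xpredT _ _ H)).
by apply: filterS filterT => tau _ /=; rewrite -mulr_sumr -sumrB.
Qed.

(** Continuous induction on the real segment: the supremum of the [s] where [F] has moved by at most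
    [e * s] belongs to the set and cannot stop before 1; [e] is arbitrary. *)
Lemma hasder0_cst F : (forall t, hasder F t 0) -> F 1 = F 0.
Proof.
move=> HF; apply/subr0_eq/cabs_eq0/le_anti; rewrite cabs_ge0 andbT.
apply/ler_addgt0Pl => e e0; rewrite addr0.
pose S : set R := [set s | 0 <= s <= 1 /\ cabs (F (Rc s) - F 0) <= e * s]%classic.
have S0 : S 0 by split; rewrite ?lexx ?ler01 // rmorph0 subrr cabs0 mulr0.
have supS : has_sup S by split; [exists 0|exists 1 => s [/andP[]]].
set c := sup S.
have c0 : 0 <= c by apply: (ub_le_sup supS.2).
have c1 : c <= 1 by apply: ge_sup; [exists 0|move=> s [/andP[]]].
have [eta eta0 Heta] := HF (Rc c) e e0.
have near_c (tau : R) : `|tau| < eta -> cabs (F (Rc (c + tau)) - F (Rc c)) <= e * `|tau|.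
  have [->|tau0] := eqVneq tau 0; first by rewrite addr0 subrr cabs0 normr0 mulr0.
  move=> te; have tau0' : Rc tau != 0 by rewrite eq_complex /= eqxx andbT.
  have := Heta (Rc tau) tau0'; rewrite /= cabsR => /(_ te).
  rewrite subr0 cabsM cabsV cabsR -rmorphD mulrC ltr_pdivrMr ?normr_gt0 //.
  exact: ltW.
have Sc : S c.
  have [s [/andP[s0 s1] Fs] cs] := sup_adherent eta0 supS.
  have sc : s <= c by apply: (ub_le_sup supS.2); split => //; rewrite s0.
  split; first by rewrite c0.
  have := near_c (s - c); rewrite -/c in cs.
  have -> : `|s - c| = c - s by rewrite distrC ger0_norm // subr_ge0.
  have -> : c + (s - c) = s by ring.
  move=> /(_ ltac:(lra)) h.
  have -> : F (Rc c) - F 0 = - (F (Rc s) - F (Rc c)) + (F (Rc s) - F 0) by ring.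
  by apply: le_trans (cabsD _ _) _; rewrite cabsN; nra.
suff c1' : c = 1 by have [_] := Sc; rewrite c1' mulr1 rmorph1.
apply/le_anti; rewrite c1 /= leNgt; apply/negP => clt1.
pose tau := Num.min (eta / 2) (1 - c).
have tau0 : 0 < tau by rewrite lt_min divr_gt0 // subr_gt0.
have taue : tau <= eta / 2 by rewrite ge_min lexx.
have tauc : tau <= 1 - c by rewrite ge_min lexx orbT.
have : S (c + tau).
  split; first by apply/andP; split; lra.
  have := near_c tau; rewrite (ger0_norm (ltW tau0)) => /(_ ltac:(lra)) h.
  have -> : F (Rc (c + tau)) - F 0 = (F (Rc (c + tau)) - F (Rc c)) + (F (Rc c) - F 0) by ring.
  have [_ Fc] := Sc; apply: le_trans (cabsD _ _) _.
  by rewrite mulrDr addrC; exact: lerD Fc h.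
by move=> /(ub_le_sup supS.2); rewrite -/c; lra.
Qed.

End ComplexDerivative.

(** * Taylor expansion of nc functions at scalar points *)

(** The last letter is split off because [foldr] lets it act first on the function. *)
Lemma sum_tuple_rcons (V : nmodType) (T : finType) k (F : seq T -> V) :
  \sum_(w : k.+1.-tuple T) F w = \sum_(j : T) \sum_(w : k.-tuple T) F (rcons w j).
Proof.
rewrite pair_bigA /=.
pose h (jw : T * k.-tuple T) : k.+1.-tuple T := [tuple of rcons jw.2 jw.1].
have hi : injective h.
  move=> [j w] [j' w'] /(congr1 val) /= /eqP; rewrite eqseq_rcons => /andP[/eqP ww /eqP ->].
  by congr (_, _); apply: val_inj.
by rewrite (reindex h) //; apply: onW_bij; apply: inj_card_bij hi _;
  rewrite card_prod !card_tuple expnS.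
Qed.

Section NcTaylor.
Variable R : realType.
Local Notation C := (R[i]).
Local Notation Rc := (real_complex R).
Variable d : nat.
Local Notation tup n := ('I_d -> 'M[C]_n).
Variables (p q : nat) (delta : 'I_p -> 'I_q -> ncpoly R d).
Local Notation Dom := (Dom delta).
Local Notation ncreg := (ncreg delta).

Definition ncpartials (w : seq 'I_d) (g : ncfun R d) : ncfun R d := foldr (@ncpartial R d) g w.

Lemma ncreg_partials w g : ncreg g -> ncreg (ncpartials w g).
Proof. by move=> gD; elim: w => //= i w; exact: ncreg_partial. Qed.

Definition at_scalar (g : ncfun R d) (z : 'I_d -> C) : C := g 1%N (scal z) 0 0.

Definition line n (z : 'I_d -> C) (N : tup n) (t : C) : tup n :=
  fun i => (z i)%:M + t *: N i.

Lemma ncI_scalar g n (z : 'I_d -> C) : ncI delta g -> Dom (scal z) ->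
  Dom (fun i => (z i)%:M : 'M[C]_n) -> g n (fun i => (z i)%:M) = (at_scalar g z)%:M.
Proof.
move=> gI D1 Dn; apply/row_matrixP => k; rewrite !rowE.
have h : intw (scal z) (fun i => (z i)%:M : 'M[C]_n) (delta_mx 0 k).
  by move=> i; rewrite /scal mul_scalar_mx mul_mx_scalar.
rewrite -(gI _ _ _ _ _ D1 Dn h) {1}(mx11_scalar (g 1%N (scal z))).
by rewrite mul_scalar_mx mul_mx_scalar.
Qed.

Lemma wordevZ n (N : tup n) (t : C) w :
  wordev (fun i => t *: N i) w = t ^+ size w *: wordev N w.
Proof.
elim: w => [|i w IHw] /=; first by rewrite expr0 scale1r.
by rewrite IHw -scalemxAl -scalemxAr scalerA exprS.
Qed.

Lemma wordev_rcons n (N : tup n) w j : wordev N (rcons w j) = wordev N w *m N j.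
Proof. by elim: w => [|k u IHu] /=; rewrite ?mulmx1 ?mul1mx // IHu mulmxA. Qed.

(** By [nc_increment] the difference quotient is a sum of [ncdiff] at two points of the line;
    continuity lets them merge. *)
Lemma line_der g n (z : 'I_d -> C) (N : tup n) (v : 'cV[C]_n) t a :
  ncreg g -> commuting N -> (forall t, Dom (line z N t)) ->
  hasder (fun s => (g n (line z N s) *m v) a 0) t
    ((\sum_j ncpartial j g (line z N t) *m (N j *m v)) a 0).
Proof.
move=> gD cN DN; pose X := line z N.
have Xc : tcvg (@to0 R) (fun tau => X (t + tau)) (X t).
  move=> i; apply: mucvgD; first exact: mucvg_cst.
  apply: mucvgZ; last exact: mucvg_cst.
  by rewrite -[X in ucvg _ _ X]addr0; apply: ucvgD; [exact: ucvg_cst|exact: to0_id].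
have H : mucvg (@to0 R) (fun tau => \sum_j ncdiff g (X (t + tau)) (unit_tup R n j) (X t) *m (N j *m v))
    (\sum_j ncpartial j g (X t) *m (N j *m v)).
  apply: mucvg_sum => j; apply: mucvg_mul; last exact: mucvg_cst.
  by apply: (ncdiff_cont (delta := delta)) => // i; exact: mucvg_cst.
apply: (ucvg_near _ (H a 0)); apply: filterS (@to0_neq0 R) => tau /= tau0.
have inc : g n (X (t + tau)) - g n (X t) =
    \sum_j ncdiff g (X (t + tau)) (unit_tup R n j) (X t) *m (tau *: N j).
  apply: (nc_increment gD.1) => //.
    by move=> i; rewrite /X /line scalerDl addrA.
  move=> i j; rewrite mulmxDl mulmxDr mul_scalar_mx mul_mx_scalar; congr (_ + _).
  by rewrite -!scalemxAl -!scalemxAr cN !scalerA mulrC.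
have -> : \sum_j ncdiff g (X (t + tau)) (unit_tup R n j) (X t) *m (N j *m v) =
    tau^-1 *: ((g n (X (t + tau)) - g n (X t)) *m v).
  rewrite inc mulmx_suml scaler_sumr; apply: eq_bigr => j _.
  by rewrite -mulmxA -scalemxAl -scalemxAr scalerA mulVf // scale1r.
by rewrite mulmxBl !mxE.
Qed.

(* Along t |-> z + t N the derivatives of the two sides agree, by the induction
   hypothesis for the partials of g, the tuples t N and the vectors N_j v. *)
Lemma nc_taylor g n (z : 'I_d -> C) (N : tup n) m (v : 'cV[C]_n) :
  ncreg g -> commuting N -> Dom (scal z) -> (forall t, Dom (line z N t)) ->
  (forall w, (m <= size w)%N -> wordev N w *m v = 0) ->
  g n (line z N 1) *m v = \sum_(k < m) (k`!%:R)^-1 *: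
     \sum_(w : k.-tuple 'I_d) at_scalar (ncpartials w g) z *: (wordev N w *m v).
Proof.
elim: m g N v => [|m IHm] g N v gD cN Dz DN Nv.
  by rewrite big_ord0; have := Nv [::] isT; rewrite mul1mx => ->; rewrite mulmx0.
pose A k : 'cV[C]_n := (k`!%:R)^-1 *:
     \sum_(w : k.-tuple 'I_d) at_scalar (ncpartials w g) z *: (wordev N w *m v).
have step k : \sum_j (k`!%:R)^-1 *:
     \sum_(w : k.-tuple 'I_d) at_scalar (ncpartials w (ncpartial j g)) z *: (wordev N w *m (N j *m v))
     = k.+1%:R *: A k.+1.
  rewrite /A scalerA factS natrM invfM mulrA mulfV ?pnatr_eq0 // mul1r.
  rewrite (sum_tuple_rcons k (fun w => at_scalar (ncpartials w g) z *: (wordev N w *m v))).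
  rewrite scaler_sumr; apply: eq_bigr => j _; congr (_ *: _); apply: eq_bigr => w _.
  by rewrite /ncpartials foldr_rcons wordev_rcons mulmxA.
have derG t : \sum_j ncpartial j g (line z N t) *m (N j *m v) =
    \sum_(k < m) (k.+1%:R * t ^+ k) *: A k.+1.
  have DtN s : Dom (line z (fun i => t *: N i) s).
    have -> : line z (fun i => t *: N i) s = line z N (s * t).
      by apply/funext => i; rewrite /line scalerA.
    exact: DN.
  have ctN : commuting (fun i => t *: N i).
    by move=> i j; rewrite -!scalemxAl -!scalemxAr cN.
  have -> : line z N t = line z (fun i => t *: N i) 1.
    by apply/funext => i; rewrite /line scale1r.
  have E j : ncpartial j g (line z (fun i => t *: N i) 1) *m (N j *m v) = \sum_(k < m) (k`!%:R)^-1 *: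
     \sum_(w : k.-tuple 'I_d) at_scalar (ncpartials w (ncpartial j g)) z *:
       (wordev (fun i => t *: N i) w *m (N j *m v)).
    apply: IHm => //; first exact: ncreg_partial.
    move=> w mw; rewrite wordevZ -scalemxAl mulmxA -wordev_rcons Nv ?scaler0 //.
    by rewrite size_rcons.
  rewrite (eq_bigr _ (fun j _ => E j)) exchange_big; apply: eq_bigr => k _ /=.
  rewrite [k.+1%:R * _]mulrC -scalerA -step scaler_sumr; apply: eq_bigr => j _.
  rewrite !scaler_sumr; apply: eq_bigr => w _.
  by rewrite wordevZ size_tuple -scalemxAl !scalerA; congr (_ *: _); ring.
apply/colP => a.
pose F s := (g n (line z N s) *m v) a 0 - \sum_(k < m.+1) s ^+ k * A k a 0.
have FE : F = fun s => (g n (line z N s) *m v) a 0 + \sum_(k < m.+1) (- A k a 0) * s ^+ k.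
  apply/funext => s; rewrite /F -sumrN; congr (_ + _).
  by apply: eq_bigr => k _; rewrite mulNr mulrC.
have F01 : F 1 = F 0.
  apply: hasder0_cst => t.
  have H1 := line_der v t a gD cN DN.
  have H2 : hasder (fun s => \sum_(k < m.+1) (- A k a 0) * s ^+ k) t
     (\sum_(k < m.+1) (0 * t ^+ k + (- A k a 0) * (k%:R * t ^+ k.-1))).
    by apply: hasder_sum => k; apply: hasderM; [exact: hasder_cst|exact: hasder_pow].
  have := hasderD H1 H2; rewrite derG.
  have -> : (\sum_(k < m) (k.+1%:R * t ^+ k) *: A k.+1) a 0 +
     \sum_(k < m.+1) (0 * t ^+ k + (- A k a 0) * (k%:R * t ^+ k.-1)) = 0.
    rewrite big_ord_recl /= !mul0r mulr0 addr0 add0r summxE -big_split big1 //= => k _.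
    by rewrite mxE mul0r add0r mulNr mulrC subrr.
  by rewrite FE.
have F0 : F 0 = 0.
  rewrite /F big_ord_recl /= big1 ?addr0 => [|k _]; last by rewrite exprS mul0r mul0r.
  have L0 : line z N 0 = fun i => (z i)%:M.
    by apply/funext => i; rewrite /line scale0r addr0.
  have D0 := DN 0; rewrite L0 in D0.
  rewrite L0 (ncI_scalar gD.1 Dz D0) mul_scalar_mx expr0 mul1r /A fact0 invr1 scale1r.
  rewrite (big_pred1 [tuple]) => [|w]; last by apply/esym/eqP; exact: (tuple0 w).
  by rewrite /= mul1mx subrr.
have := F01; rewrite F0 /F => /subr0_eq ->; rewrite summxE; apply: eq_bigr => k _.
by rewrite expr1n mul1r.
Qed.

End NcTaylor.

(** * The functional calculus of a commuting tuple *)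

Section FunctionalCalculus.
Variable R : realType.
Local Notation C := (R[i]).
Local Notation Rc := (real_complex R).
Variable d : nat.
Local Notation tup n := ('I_d -> 'M[C]_n).
Variables (p q : nat) (delta : 'I_p -> 'I_q -> ncpoly R d).
Local Notation Dom := (Dom delta).
Local Notation ncreg := (ncreg delta).
Local Notation Om := (Omega delta).

(** Scalar points are fixed by similarities, so the envelope adds none. *)
Lemma Dom_scal z : Dom (scal z) -> Om z.
Proof.
move=> [s [y [us xs Gy]]]; suff zy : scal z = y by move: Gy; rewrite -zy.
apply/funext => i; apply: (can_inj (mulKmx us)).
by rewrite -xs /scal mul_scalar_mx mul_mx_scalar.
Qed.

Lemma Om_Dom z : Om z -> Dom (scal z).
Proof. exact: G_Dom. Qed.

Section Partial.
Variables (g : ncfun R d) (f : ('I_d -> C) -> C).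
Hypothesis gD : ncreg g.
Hypothesis fg : forall z, Om z -> f z = at_scalar g z.

Lemma scal_increment a (h : 'I_d -> C) : Om a -> Om (fun i => a i + h i) ->
  f (fun i => a i + h i) - f a =
  \sum_j ncdiff g (scal (fun i => a i + h i)) (unit_tup R 1 j) (scal a) 0 0 * h j.
Proof.
move=> Oa Oah; rewrite !fg // /at_scalar.
have E := nc_increment gD.1 (h := scal h) (Om_Dom Oa) (Om_Dom Oah).
have -> : g (scal (fun i => a i + h i)) 0 0 - g (scal a) 0 0 =
  (g (scal (fun i => a i + h i)) - g (scal a)) 0 0 by rewrite !mxE.
rewrite E => [|i|i j]; first last.
- by rewrite /scal scalar_mxC.
- by rewrite /scal raddfD.
by rewrite summxE; apply: eq_bigr => j _; rewrite /scal mul_mx_scalar mxE mulrC.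
Qed.

Lemma ncdiff_scal_cont a : Om a ->
  tnbhs (scal a) [set y | Dom y]%classic /\
  forall j, ucvg (tnbhs (scal a)) (fun y => ncdiff g y (unit_tup R 1 j) (scal a) 0 0)
    (at_scalar (ncpartial j g) a).
Proof.
move=> Oa; split; first exact: Dom_open (Om_Dom Oa).
move=> j.
have H : mucvg (tnbhs (scal a)) (fun y => ncdiff g y (unit_tup R 1 j) (scal a)) (ncpartial j g (scal a)).
  apply: (ncdiff_cont (delta := delta)) => //; first exact: Om_Dom.
    exact: tcvg_id.
  by move=> i; exact: mucvg_cst.
exact: H.
Qed.

Lemma holo_on_at_scalar : holo_on Om f.
Proof.
move=> a Oa; exists (fun j => at_scalar (ncpartial j g) a) => eps eps0.
have [nD nDl] := ncdiff_scal_cont Oa.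
(* The error is shared among [d] coordinates; the [+ 1] covers [d = 0]. *)
pose e := eps / (d%:R + 1); have d0 : (0 : R) <= d%:R by rewrite ler0n.
have e0 : 0 < e by rewrite divr_gt0 //; lra.
have n2 : tnbhs (scal a) (fun y => forall j,
    cabs (ncdiff g y (unit_tup R 1 j) (scal a) 0 0 - at_scalar (ncpartial j g) a) < e).
  have n3 := filter_forall (tnbhs_proper (scal a)) (fun j => nDl j e e0).
  by apply: filterS n3 => y Hy j; exact: Hy.
have [eta eta0 Heta] := filterI nD n2.
exists eta; split => // h hs.
have le_sup j : cabs (h j) <= supn h by exact: le_bigmax.
have := Heta (scal (fun i => a i + h i)) => -[i r c|/= Dah Hc].
  rewrite !ord1 !mxE eqxx !mulr1n addrAC subrr add0r.
  exact: le_lt_trans (le_sup i) hs.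
have Oah := Dom_scal Dah; rewrite scal_increment // -sumrB.
apply: le_trans (cabs_sum _ _ _) _.
apply: (@le_trans _ _ (\sum_(j < d) e * supn h)); last first.
  rewrite sumr_const card_ord -mulr_natl mulrA ler_wpM2r //.
    by apply: bigmax_ge_id.
  rewrite /e mulrA ler_pdivrMr; last lra.
  by rewrite mulrC ler_wpM2l //; lra.
apply: ler_sum => j _; rewrite -mulrBl cabsM.
by apply: ler_pM; rewrite ?cabs_ge0 // ltW // Hc.
Qed.

Lemma pderiv_at_scalar i a : Om a -> pderiv i f a = at_scalar (ncpartial i g) a.
Proof.
move=> Oa; have [nD nDl] := ncdiff_scal_cont Oa.
have H : has_pderiv i f a (at_scalar (ncpartial i g) a).
  move=> eps eps0; have [eta eta0 Heta] := filterI nD (nDl i eps eps0).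
  exists eta; split => // t t0 te.
  pose h j := if j == i then t else 0.
  have ahE : (fun j => if j == i then a j + t else a j) = fun j => a j + h j.
    by apply/funext => j; rewrite /h; case: eqP => // _; rewrite addr0.
  have := Heta (scal (fun i => a i + h i)) => -[k r c|/= Dah Hc].
    rewrite !ord1 !mxE eqxx !mulr1n addrAC subrr add0r /h.
    by case: eqP => // _; rewrite cabs0.
  rewrite ahE (scal_increment Oa (Dom_scal Dah)).
  rewrite (bigD1 i) //= big1 ?addr0 => [|j ji]; last by rewrite /h (negPf ji) mulr0.
  by rewrite {2}/h eqxx mulfK.
rewrite /pderiv; case: xgetP => [L _ HL|HL]; last by case: (HL _ H).
have toU L' : has_pderiv i f a L' ->
    ucvg (@to0 R) (fun t => (f (fun j => if j == i then a j + t else a j) - f a) / t) L'.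
  by move=> HL' e e0; have [eta [eta0 Heta]] := HL' e e0; exists eta.
exact: ucvg_uniq (toU _ HL) (toU _ H).
Qed.
End Partial.

Lemma pderivs_at_scalar g f w z : ncreg g -> (forall z, Om z -> f z = at_scalar g z) ->
  Om z -> pderivs w f z = at_scalar (ncpartials w g) z.
Proof.
move=> gD fg; elim: w z => [|i w IHw] z Oz /=; first exact: fg.
by apply: pderiv_at_scalar => //; exact: ncreg_partials.
Qed.

(** Turns the restriction of [T] to a joint generalized eigenspace into a matrix tuple [Y], to which
    nc functions apply; [r <= n] makes order [n] sufficient there. Transposes appear because
    subspaces are row spaces. *)
Lemma gen_eigenspace n (T : tup n) (lam : 'I_d -> C) m : commuting T ->
  exists r (S : 'M[C]_(n, r)) (Y : tup r),
    [/\ (r <= n)%N, forall u : 'cV[C]_r, S *m u = 0 -> u = 0, intw T Y S,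
        forall i, (T i - (lam i)%:M) ^+ m *m S = 0 &
        forall v : 'cV[C]_n, (forall i, (T i - (lam i)%:M) ^+ m *m v = 0) ->
          exists u, v = S *m u].
Proof.
move=> cT; pose N i := (T i - (lam i)%:M) ^+ m.
pose V := (\bigcap_i kermx (N i)^T)%MS.
have VN i : V *m (N i)^T = 0 by apply/sub_kermxP; exact: (bigcapmx_inf i).
have NT i j : N i *m T j = T j *m N i.
  apply: expmx_intw; rewrite mulmxBl mulmxBr cT mul_scalar_mx mul_mx_scalar.
  by [].
have VT j : (row_base V *m (T j)^T <= row_base V)%MS.
  rewrite eq_row_base; apply: (submx_trans (submxMr _ _) (_ : (V *m (T j)^T <= V)%MS)).
    by rewrite eq_row_base.
  apply/sub_bigcapmxP => i _; apply/sub_kermxP.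
  by rewrite -mulmxA -trmx_mul NT trmx_mul mulmxA VN mul0mx.
have /choice[D HD] : forall j, exists D, row_base V *m (T j)^T = D *m row_base V.
  by move=> j; exact/submxP.
exists (\rank V), (row_base V)^T, (fun j => (D j)^T); split.
- exact: rank_leq_col.
- move=> u Su; apply: trmx_inj; rewrite trmx0; apply/eqP.
  have := row_base_free V; rewrite -kermx_eq0 => /eqP K0.
  rewrite -submx0 -K0; apply/sub_kermxP.
  by apply: trmx_inj; rewrite trmx_mul trmxK Su trmx0.
- by move=> j; apply: trmx_inj; rewrite !trmx_mul !trmxK HD.
- move=> i; apply: trmx_inj; rewrite trmx_mul trmxK trmx0 -/(N i).
  have /submxP[X ->] : (row_base V <= V)%MS by rewrite eq_row_base.
  by rewrite -mulmxA VN mulmx0.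
- move=> v Nv; have /submxP[X vX] : (v^T <= row_base V)%MS.
    rewrite eq_row_base; apply/sub_bigcapmxP => i _; apply/sub_kermxP.
    by rewrite -trmx_mul -/(N i) Nv trmx0.
  by exists X^T; apply: trmx_inj; rewrite trmx_mul !trmxK.
Qed.

Lemma line_jspec n (N : tup n) (z : 'I_d -> C) t mu m :
  (forall i, N i ^+ m = 0) -> jspec (line z N t) mu -> mu = z.
Proof.
move=> Nm [v [v0 Nv]]; apply/funext => i.
have E k : t ^+ k *: (N i ^+ k *m v) = (mu i - z i) ^+ k *: v.
  elim: k => [|k IHk]; first by rewrite !expr0 mul1mx.
  have tN : t *: (N i *m v) = (mu i - z i) *: v.
    rewrite scalerBl -Nv /line mulmxDl mul_scalar_mx addrAC subrr add0r.
    by rewrite scalemxAl.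
  rewrite expmxSr -mulmxA exprSr -scalerA [t *: _]scalemxAr tN -scalemxAr scalerA mulrC -scalerA.
  by rewrite IHk scalerA -exprS.
have := E m; rewrite Nm mul0mx scaler0 => /esym/eqP.
by rewrite scaler_eq0 (negPf v0) orbF expf_eq0 subr_eq0 => /andP[_ /eqP].
Qed.

Lemma commuting_line n (N : tup n) (z : 'I_d -> C) t : commuting N -> commuting (line z N t).
Proof.
move=> cN i j; rewrite /line; apply: comm_mxD; first exact: comm_mx_scalar.
apply/comm_mx_sym/comm_mxD; first exact: comm_mx_scalar.
by rewrite /comm_mx -!scalemxAl -!scalemxAr cN !scalerA mulrC.
Qed.

(** On a joint generalized eigenspace, [T] becomes [lam] plus a nilpotent tuple and [nc_taylor]
    terminates. The eigenspaces span by [joint_decomposition], which gives uniqueness. *)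
Lemma fcalcE g f n (T : tup n) : ncreg g -> (forall z, Om z -> f z = at_scalar g z) ->
  (0 < n)%N -> commuting T -> (forall lam, jspec T lam -> Om lam) ->
  fcalc f T = g n T.
Proof.
move=> gD fg n0 cT TO; have DT := Dom_commuting n0 cT TO.
have gP (lam : 'I_d -> C) (v : 'cV[C]_n) :
    (forall i, (T i - (lam i)%:M) ^+ n *m v = 0) -> g n T *m v = taylorM f lam T *m v.
  move=> Hv; have [->|v0] := eqVneq v 0; first by rewrite !mulmx0.
  have Olam : Om lam by apply: TO; exact: gen_to_jspec cT v0 Hv.
  have [r [S [Y [rn Sinj TS NS /(_ v Hv)[u vE]]]]] := gen_eigenspace lam n cT.
  have r0 : (0 < r)%N.
    rewrite lt0n; apply: contra v0 => /eqP r0; move: S u vE {Sinj TS NS}.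
    by rewrite r0 => S u ->; rewrite (flatmx0 u) mulmx0.
  pose NY i := Y i - (lam i)%:M.
  have NS' : intw (fun i => T i - (lam i)%:M) NY S := intw_shift lam TS.
  have Sinj' k (X : 'M[C]_(r, k)) : S *m X = 0 -> X = 0.
    move=> SX; apply: mulmx_colP => e; rewrite mul0mx; apply: Sinj.
    by rewrite mulmxA SX mul0mx.
  have NYn i : NY i ^+ n = 0.
    by apply: Sinj'; rewrite -(expmx_intw n (NS' i)) NS.
  have cY : commuting Y.
    move=> i j; apply/subr0_eq/Sinj'; rewrite mulmxBr !mulmxA -!TS -!mulmxA -!TS.
    by rewrite !mulmxA cT subrr.
  have cNY : commuting NY.
    move=> i j; apply: comm_mxB; last exact: comm_mx_scalar.
    by apply/comm_mx_sym/comm_mxB; [exact: cY|exact: comm_mx_scalar].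
  (* The whole complex line stays in the envelope, since every tuple on it has joint spectrum at
     most [lam]. *)
  have DY t : Dom (line lam NY t).
    by apply: (Dom_commuting r0 (commuting_line lam t cNY)) => mu /(line_jspec NYn) ->.
  have YE : Y = line lam NY 1.
    by apply/funext => i; rewrite /line scale1r /NY addrC subrK.
  have DY1 : Dom Y by rewrite YE.
  rewrite vE mulmxA (gD.1 _ _ _ _ _ DT DY1 TS) -mulmxA YE.
  rewrite (nc_taylor (m := n) gD cNY (Om_Dom Olam) DY) => [|w nw]; last first.
    by rewrite (nilpotent_words cNY NYn) ?mul0mx // (leq_trans rn).
  rewrite /taylorM mulmx_sumr mulmx_suml; apply: eq_bigr => k _.
  rewrite -scalemxAr -scalemxAl; congr (_ *: _).
  rewrite mulmx_sumr mulmx_suml; apply: eq_bigr => w _.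
  rewrite -scalemxAr -scalemxAl (pderivs_at_scalar _ gD fg Olam); congr (_ *: _).
  by rewrite !mulmxA (wordev_intw _ NS').
rewrite /fcalc; case: xgetP => [M _ MP|H]; last by case: (H (g n T)).
have [l [l1 l2]] := joint_decomposition cT.
rewrite -[M]mulmx1 -[g n T]mulmx1 -l1 !mulmx_sumr.
elim: l l2 {l1} => [|t l IHl] l2; first by rewrite !big_nil.
rewrite !big_cons; congr (_ + _); last by apply: IHl => u ul; apply: l2; right.
have [Ht _] := l2 t (or_introl erefl).
apply: mulmx_colP => e; rewrite -!mulmxA.
have He i : (T i - (t.1 i)%:M) ^+ n *m (t.2 *m e) = 0 by rewrite mulmxA Ht mul0mx.
exact: etrans (MP _ _ He) (esym (gP _ _ He)).
Qed.

End FunctionalCalculus.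

(** * Extension to the similarity envelope *)

Section RealInequalities.
Variable R : realType.

(** [a'] and [b'] are the squared norms of a vector in the two metrics being mixed, [a] and [b]
    those of its image. Only the second metric contracts strictly; [t <= K * b'] transfers its gain
    to the mixture. *)
Lemma mixed_contraction (e c K a b a' b' t : R) : 0 < e -> e < 1 -> c < 1 -> 1 <= K ->
  t = (1 - e) * a' + e * b' -> t <= K * b' -> a <= a' -> b <= c * b' ->
  (1 - e) * a + e * b <= (1 - e * (1 - c) / K) * t.
Proof.
move=> e0 e1 c1 K1 tE tK aa' bb'.
have ec : 0 <= e * (1 - c) by rewrite mulr_ge0; lra.
have K0 : 0 < K by lra.
have H3 : e * (1 - c) / K * t <= e * (1 - c) * b'.
  by rewrite -[leLHS]mulrA ler_wpM2l // mulrC ler_pdivrMr // mulrC.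
have H4 : (1 - e) * a <= (1 - e) * a' by rewrite ler_wpM2l //; lra.
have H5 : e * b <= e * (c * b') by rewrite ler_wpM2l //; lra.
have -> : (1 - e * (1 - c) / K) * t = (1 - e) * a' + e * b' - e * (1 - c) / K * t.
  by rewrite mulrBl mul1r -tE.
have H6 : e * (1 - c) * b' = e * b' - e * (c * b') by ring.
by rewrite H6 in H3; lra.
Qed.

Lemma le_of_convex (a b k A : R) : 0 <= a ->
  (forall e, 0 < e -> e < 1 -> (1 - e) * a <= A * ((1 - e) * b + e * k)) -> a <= A * b.
Proof.
move=> a0 H; rewrite leNgt; apply/negP => Aba.
pose D := 2 * (1 + a + `|A * k| + `|A * b|).
have Ak := normr_ge0 (A * k); have Ab := normr_ge0 (A * b).
have D0 : 0 < D by rewrite /D; lra.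
pose e := (a - A * b) / (2 * D); have e0 : 0 < e by rewrite divr_gt0 ?mulr_gt0 //; lra.
have eD : e * D = (a - A * b) / 2 by rewrite /e; field; lra.
have Ab' := ler_norm (- (A * b)); rewrite normrN in Ab'.
have e1 : e < 1.
  have D2 : 0 < 2 * D by lra.
  rewrite /e (ltr_pdivrMr _ _ D2) /D; lra.
have := H e e0 e1; rewrite mulrDr !(mulrCA A) => h.
have := ler_norm (A * k) => Ak'.
have h1 : e * (A * k) <= e * D by rewrite ler_wpM2l ?(ltW e0) // /D; lra.
have h2 : e * (a - A * b) <= e * D by rewrite ler_wpM2l ?(ltW e0) // /D; lra.
have E1 : (1 - e) * a = a - e * a by ring.
have E2 : (1 - e) * (A * b) = A * b - e * (A * b) by ring.
have E3 : e * (a - A * b) = e * a - e * (A * b) by ring.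
have h3 : e * (A * k) + e * (a - A * b) < a - A * b.
  suff : e * (A * k + (a - A * b)) < 2 * (e * D) by rewrite mulrDr eD; lra.
  rewrite mulrCA ltr_pM2l // /D; lra.
by rewrite E1 E2 in h; rewrite E3 in h3; lra.
Qed.

End RealInequalities.

Section Restriction.
Variable R : realType.
Local Notation C := (R[i]).
Local Notation Rc := (real_complex R).
Variable d : nat.
Local Notation tup n := ('I_d -> 'M[C]_n).
Variables (p q : nat) (delta : 'I_p -> 'I_q -> ncpoly R d).
Local Notation Dom := (Dom delta).
Local Notation ncreg := (ncreg delta).
Local Notation Om := (Omega delta).
Local Notation G := (inG delta).

Section Extend.
Variables (phi : ncfun R d) (al : R).
Hypothesis phiN : is_ncfun delta phi.
Hypothesis phiB : forall n (x : tup n), G x -> forall v : 'cV[C]_n,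
  nsq (phi x *m v) <= al ^+ 2 * nsq v.

Definition nc_ext : ncfun R d := fun n x => xget 0 [set L : 'M[C]_n |
  exists s y, [/\ s \in unitmx, intw x y s, G y & L = s *m phi y *m invmx s]]%classic.

(** Two presentations of [x] differ by an intertwiner between points of [G], so [ncfun_intw] makes
    the value independent of the choice. *)
Lemma nc_extE n (x y : tup n) s : s \in unitmx -> intw x y s -> G y ->
  nc_ext x = s *m phi y *m invmx s.
Proof.
move=> us xy Gy; rewrite /nc_ext; case: xgetP => [L _ [t [z [ut xz Gz ->]]]|H]; last first.
  by case: (H (s *m phi y *m invmx s)); exists s, y.
have h : intw z y (invmx t *m s) := intw_comp (intw_inv ut xz) xy.
have := ncfun_intw phiN Gz Gy h.
move: (phi z : 'M_n) (phi y : 'M_n) => A B E; apply: (can_inj (mulmxK us)); rewrite mulmxKV // -mulmxA -(mulmxA t) E.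
by rewrite !mulmxA mulmxV // mul1mx.
Qed.

Lemma nc_ext_G n (x : tup n) : G x -> nc_ext x = phi x.
Proof.
move=> Gx; rewrite (nc_extE (y := x) (unitmx1 _ _)) // => [|i].
  by rewrite invmx1 mulmx1 mul1mx.
by rewrite mulmx1 mul1mx.
Qed.

Lemma nc_ext_ncI : ncI delta nc_ext.
Proof.
move=> m n x y S [s [x0 [us xs Gx]]] [t [y0 [ut yt Gy]]] xS.
rewrite (nc_extE us xs Gx) (nc_extE ut yt Gy).
have h : intw x0 y0 (invmx s *m S *m t).
  exact: intw_comp (intw_comp (intw_inv us xs) xS) yt.
have := ncfun_intw phiN Gx Gy h.
move: (phi x0 : 'M_m) (phi y0 : 'M_n) => A B E.
apply: (can_inj (mulmxK ut)).
transitivity (s *m (A *m (invmx s *m S *m t))); first by rewrite !mulmxA.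
by rewrite E !mulmxA mulmxV // mul1mx mulmxKV.
Qed.

(** The same [s] serves all nearby points because [G] is open; the bound depends on [s], hence is
    only local. *)
Lemma nc_ext_locbd : locbd delta nc_ext.
Proof.
move=> n x [s [y [us xs Gy]]].
pose B : R := \sum_(j < n) al ^+ 2 * nsq (delta_mx j 0 : 'cV[C]_n).
have B0 : 0 <= B by rewrite sumr_ge0 // => j _; rewrite mulr_ge0 ?sqr_ge0 ?nsq_ge0.
have phi_le z : G z -> nsq (phi z : 'M[C]_n) <= B.
  by move=> Gz; rewrite nsq_cols; apply: ler_sum => j _; rewrite colE; exact: phiB.
pose K : R := n%:R * (n%:R * nsq s * B) * nsq (invmx s).
have n0 : 0 <= n%:R :> R by rewrite ler0n.
exists K; first by rewrite !mulr_ge0 ?nsq_ge0.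
have Gy' : tnbhs (simil s x) (@inG R d p q delta n).
  by rewrite (intw_simil us xs); exact: inG_open.
have nx : tnbhs x [set x' | G (simil s x')]%classic.
  by apply: tcvg_tnbhs Gy'; apply: tcvg_simil; exact: tcvg_id.
apply: filterS nx => x' /= Gx'.
rewrite (nc_extE us (simil_intw x' us) Gx').
apply: le_trans (nsq_mulmx_le _ _) _; rewrite /K ler_wpM2r ?nsq_ge0 // ler_wpM2l //.
apply: le_trans (nsq_mulmx_le _ _) _; rewrite ler_wpM2l ?mulr_ge0 ?nsq_ge0 //.
exact: phi_le.
Qed.

Lemma nc_ext_ncreg : ncreg nc_ext.
Proof. exact: conj nc_ext_ncI nc_ext_locbd. Qed.

Lemma convex_factor n (s : 'M[C]_n) e : s \in unitmx -> 0 < e -> e < 1 ->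
  exists2 r : 'M[C]_n, r \in unitmx &
    forall m (X : 'M[C]_(n, m)), nsq (r *m X) = (1 - e) * nsq X + e * nsq (s *m X).
Proof.
move=> us e0 e1.
pose W := col_mx (Rc (Num.sqrt (1 - e)))%:M (Rc (Num.sqrt e) *: s).
have [r rW] := gram_factor W.
have E m (X : 'M[C]_(n, m)) : nsq (r *m X) = (1 - e) * nsq X + e * nsq (s *m X).
  rewrite (nsq_eq_mul _ rW) /W mul_col_mx nsq_col_mx mul_scalar_mx -scalemxAl !nsqZR.
  by rewrite !sqr_sqrtr //; lra.
exists r => //; apply: unitmx_inj => v rv; apply: nsq_eq0.
have := E _ v; rewrite rv nsq0; have := nsq_ge0 v; have := nsq_ge0 (s *m v); nra.
Qed.

(* The tuple r T r^-1, with r^* r = (1-e) + e s^-* s^-1, lies in G_delta. *)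
Lemma nc_ext_bound n (T : tup n) (v : 'cV[C]_n) : Dom T -> dbound delta T 1 ->
  nsq (nc_ext T *m v) <= al ^+ 2 * nsq v.
Proof.
move=> [s [y [us Ty Gy]]] T1; have /inGP[n0 [c [c0 c1 yc]]] := Gy.
have ius : invmx s \in unitmx by rewrite unitmx_inv.
have yT := intw_inv us Ty.
have key e : 0 < e -> e < 1 ->
  (1 - e) * nsq (nc_ext T *m v) <= al ^+ 2 * ((1 - e) * nsq v + e * nsq (invmx s *m v)).
  move=> e0 e1; have [r ur rE] := convex_factor ius e0 e1.
  have iur : invmx r \in unitmx by rewrite unitmx_inv.
  pose Te := simil (invmx r) T.
  have TTe : intw T Te (invmx r) := simil_intw T iur.
  have TeT : intw Te T r by have := intw_inv iur TTe; rewrite invmxK.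
  have GTe : G Te.
    (* [K] bounds the mixed metric by the one of [invmx s], through [r = (r *m s) *m invmx s]; the
       [+ 1] ensures [1 <= K]. *)
    apply/inGP; split => //; pose K : R := n%:R * nsq (r *m s) + 1.
    have K1 : 1 <= K by rewrite /K lerDr mulr_ge0 ?nsq_ge0.
    have ec : 0 < e * (1 - c) / K by rewrite divr_gt0 ?mulr_gt0 //; lra.
    exists (1 - e * (1 - c) / K); split; [|lra|].
      rewrite subr_ge0 ler_pdivrMr; last lra.
      by rewrite mul1r; apply: le_trans K1; nra.
    move=> m Y; pose g j := invmx r *m Y j.
    have -> : Y = fun j => r *m g j by apply/funext => j; rewrite /g mulKVmx.
    have E1 : \sum_i nsq (dact delta Te (fun j => r *m g j) i) =
      (1 - e) * \sum_i nsq (dact delta T g i) +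
      e * \sum_i nsq (dact delta y (fun j => invmx s *m g j) i).
      rewrite !mulr_sumr -big_split; apply: eq_bigr => i _ /=.
      by rewrite (dact_intw _ _ _ TeT) (dact_intw _ _ _ yT) rE.
    have E2 : \sum_j nsq (r *m g j) =
      (1 - e) * \sum_j nsq (g j) + e * \sum_j nsq (invmx s *m g j).
      by rewrite !mulr_sumr -big_split; apply: eq_bigr => j _ /=; rewrite rE.
    have E3 : \sum_j nsq (r *m g j) <= K * \sum_j nsq (invmx s *m g j).
      rewrite mulr_sumr; apply: ler_sum => j _.
      rewrite -{1}(mulKVmx us (g j)) (mulmxA r s); apply: le_trans (nsq_mulmx_le _ _) _.
      by rewrite ler_wpM2r ?nsq_ge0 // /K lerDl.
    have H1 := T1 _ g; have H2 := yc _ (fun j => invmx s *m g j).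
    rewrite mul1r in H1; rewrite E1.
    exact: (mixed_contraction e0 e1 c1 K1 E2 E3 H1 H2).
  have := phiB GTe (r *m v); rewrite rE.
  have -> : phi Te *m (r *m v) = r *m (nc_ext T *m v).
    by rewrite (nc_extE iur TTe GTe) invmxK !mulmxA mulmxV // mul1mx.
  by rewrite rE; apply: le_trans; rewrite lerDl mulr_ge0 ?nsq_ge0 // ltW.
exact: (le_of_convex (nsq_ge0 _) key).
Qed.

End Extend.

End Restriction.

(** * The isometric isomorphism *)

Section Quotient.
Variable R : realType.
Local Notation C := (R[i]).
Local Notation Rc := (real_complex R).
Variable d : nat.
Local Notation tup n := ('I_d -> 'M[C]_n).
Variables (p q : nat) (delta : 'I_p -> 'I_q -> ncpoly R d).
Local Notation G := (inG delta).
Local Notation Hinf := (Hinf delta).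

Lemma opnorm_le_Hnorm phi n (x : tup n) : Hinf phi -> G x -> opnorm (phi n x) <= Hnorm delta phi.
Proof.
move=> [_ [B HB]] Gx; apply: ub_le_sup; last by exists n, x.
by exists B => r [m [y [Gy ->]]]; exact: HB.
Qed.

Lemma Hnorm_ge0 phi : Hinf phi -> 0 <= Hnorm delta phi.
Proof.
move=> Hphi; have [[n [x Gx]]|nG] := pselect (exists n (x : tup n), G x).
  exact: le_trans (opnorm_ge0 _) (opnorm_le_Hnorm Hphi Gx).
(* With no point in [G], the supremum of the empty set is 0 by convention. *)
rewrite /Hnorm (_ : [set r | _]%classic = set0) ?sup0 //.
by apply/seteqP; split => // r [n [x [Gx _]]]; apply: nG; exists n, x.
Qed.

Lemma Hnorm_nsq phi n (x : tup n) : Hinf phi -> G x -> forall v : 'cV[C]_n,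
  nsq (phi n x *m v) <= Hnorm delta phi ^+ 2 * nsq v.
Proof.
move=> Hphi Gx; apply: (iffLR (opnorm_leP _ (Hnorm_ge0 Hphi))).
exact: opnorm_le_Hnorm.
Qed.

Lemma Hinf_of_bound phi B : 0 <= B -> is_ncfun delta phi ->
  (forall n (x : tup n), G x -> forall v : 'cV[C]_n, nsq (phi n x *m v) <= B ^+ 2 * nsq v) ->
  Hinf phi /\ Hnorm delta phi <= B.
Proof.
move=> B0 phiN phiB.
have le_B n (x : tup n) : G x -> opnorm (phi n x) <= B.
  by move=> Gx; apply/opnorm_leP => // v; exact: phiB.
have Hphi : Hinf phi by split => //; exists B.
split => //; have [[n [x Gx]]|nG] := pselect (exists n (x : tup n), G x).
  apply: ge_sup; first by exists (opnorm (phi n x)), n, x.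
  by move=> r [m [y [Gy ->]]]; exact: le_B.
rewrite /Hnorm (_ : [set r | _]%classic = set0) ?sup0 //.
by apply/seteqP; split => // r [n [x [Gx _]]]; apply: nG; exists n, x.
Qed.

Lemma is_ncfun_add phi psi : is_ncfun delta phi -> is_ncfun delta psi ->
  is_ncfun delta (ncadd phi psi).
Proof.
move=> [a1 a2] [b1 b2]; split=> [m k x y Gx Gy|n s x us Gx Gs].
  by rewrite /ncadd a1 // b1 // add_block_mx !addr0.
by rewrite /ncadd a2 // b2 // mulmxDr mulmxDl.
Qed.

Lemma is_ncfun_scale c phi : is_ncfun delta phi -> is_ncfun delta (ncscale c phi).
Proof.
move=> [a1 a2]; split=> [m k x y Gx Gy|n s x us Gx Gs].
  by rewrite /ncscale a1 // scale_block_mx !scaler0.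
by rewrite /ncscale a2 // -scalemxAr -scalemxAl.
Qed.

Lemma Hinf_add phi psi : Hinf phi -> Hinf psi -> Hinf (ncadd phi psi).
Proof.
move=> Hphi Hpsi; have a0 := Hnorm_ge0 Hphi; have b0 := Hnorm_ge0 Hpsi.
have phiB n (x : tup n) := @Hnorm_nsq phi n x Hphi.
have psiB n (x : tup n) := @Hnorm_nsq psi n x Hpsi.
move: (Hnorm delta phi) (Hnorm delta psi) a0 b0 phiB psiB => a b a0 b0 phiB psiB.
suff [] : Hinf (ncadd phi psi) /\ Hnorm delta (ncadd phi psi) <= 2 * (a + b) by [].
apply: Hinf_of_bound; first by rewrite mulr_ge0 // addr_ge0.
  by apply: is_ncfun_add; [case: Hphi|case: Hpsi].
move=> n x Gx v; rewrite /ncadd mulmxDl.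
apply: le_trans (nsqD_le _ _ ltr01) _; rewrite invr1.
have := phiB _ _ Gx v; have := psiB _ _ Gx v.
have v0 := nsq_ge0 v; set u := nsq (_ *m _); set w := nsq (_ *m _) => h1 h2.
apply: (@le_trans _ _ ((1 + 1) * (a ^+ 2 * nsq v) + (1 + 1) * (b ^+ 2 * nsq v))).
  by lra.
have -> : (1 + 1) * (a ^+ 2 * nsq v) + (1 + 1) * (b ^+ 2 * nsq v) =
  (2 * a ^+ 2 + 2 * b ^+ 2) * nsq v by ring.
by rewrite ler_wpM2r //; have := mulr_ge0 a0 b0; have := sqr_ge0 a; have := sqr_ge0 b; rewrite !expr2; nra.
Qed.

Lemma Hinf_scale c phi : Hinf phi -> Hinf (ncscale c phi).
Proof.
move=> Hphi; have [] // := @Hinf_of_bound (ncscale c phi) (cabs c * Hnorm delta phi).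
- by rewrite mulr_ge0 ?cabs_ge0 ?Hnorm_ge0.
- by apply: is_ncfun_scale; case: Hphi.
move=> n x Gx v; rewrite /ncscale -scalemxAl nsqZ exprMn cabs_sqr -mulrA ler_wpM2l ?cabs2_ge0 //.
exact: Hnorm_nsq.
Qed.

(** Holds for every representative [phi] of a class, which yields the quotient norm as an upper
    bound. *)
Lemma com_bound phi f n (T : tup n) : Hinf phi ->
  (forall z, Omega delta z -> f z = at_scalar phi z) -> admissible delta T ->
  opnorm (fcalc f T) <= Hnorm delta phi.
Proof.
move=> Hphi fphi [n0 [cT [T1 TO]]]; have phiN := Hphi.1.
have phiB n' (x : tup n') := @Hnorm_nsq phi n' x Hphi.
have eD := nc_ext_ncreg phiN phiB.
rewrite (fcalcE (g := nc_ext delta phi) eD) //; last first.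
  by move=> z Oz; rewrite fphi // /at_scalar (nc_ext_G phiN Oz).
apply/opnorm_leP => [|v]; first exact: Hnorm_ge0.
apply: (nc_ext_bound phiN phiB); first exact: Dom_commuting.
exact/opnorm_deltaev_le1.
Qed.

Lemma Hcom_at_scalar phi : Hinf phi -> Hcom delta (at_scalar phi).
Proof.
move=> Hphi; split; last first.
  by exists (Hnorm delta phi) => n T adT; exact: (com_bound Hphi).
have phiN := Hphi.1; have phiB n' (x : tup n') := @Hnorm_nsq phi n' x Hphi.
apply: (holo_on_at_scalar (nc_ext_ncreg phiN phiB)) => z Oz.
by rewrite /at_scalar (nc_ext_G phiN Oz).
Qed.

Lemma com_extension f B : 0 < B ->
  (forall n (T : tup n), admissible delta T -> opnorm (fcalc f T) <= B) ->
  exists phi, [/\ Hinf phi, Hnorm delta phi <= B &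
    forall z, Omega delta z -> at_scalar phi z = f z].
Proof.
move=> B0 fB; have [phi [phiN phiB phif]] := commutative_extension B0 fB.
by have [Hphi phi_le] := Hinf_of_bound (ltW B0) phiN phiB; exists phi.
Qed.

Lemma comnorm_eq_qnorm phi : Hinf phi -> comnorm delta (at_scalar phi) = qnorm delta phi.
Proof.
move=> Hphi; have [_ [B HB]] := Hcom_at_scalar Hphi.
have com_ge n (T : tup n) : admissible delta T ->
    opnorm (fcalc (at_scalar phi) T) <= comnorm delta (at_scalar phi).
  move=> adT; apply: ub_le_sup; last by exists n, T.
  by exists B => r [m [Y [adY ->]]]; exact: HB.
have com_le b : 0 <= b -> (forall n (T : tup n), admissible delta T ->
    opnorm (fcalc (at_scalar phi) T) <= b) -> comnorm delta (at_scalar phi) <= b.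
  move=> b0 Hb; have [[n [T adT]]|nT] := pselect (exists n (T : tup n), admissible delta T).
    apply: ge_sup; first by exists (opnorm (fcalc (at_scalar phi) T)), n, T.
    by move=> r [m [Y [adY ->]]]; exact: Hb.
  rewrite /comnorm (_ : [set r | _]%classic = set0) ?sup0 //.
  by apply/seteqP; split => // r [n [T [adT _]]]; apply: nT; exists n, T.
have com0 : 0 <= comnorm delta (at_scalar phi).
  have [[n [T adT]]|nT] := pselect (exists n (T : tup n), admissible delta T).
    exact: le_trans (opnorm_ge0 _) (com_ge _ _ adT).
  rewrite /comnorm (_ : [set r | _]%classic = set0) ?sup0 //.
  by apply/seteqP; split => // r [n [T [adT _]]]; apply: nT; exists n, T.
pose Q : set R := [set r | exists psi : ncfun R d,
  Hinf psi /\ inI delta psi /\ r = Hnorm delta (ncadd phi psi)]%classic.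
have Q_ge r : Q r -> comnorm delta (at_scalar phi) <= r.
  move=> [psi [Hpsi [Ipsi ->]]]; have Hs := Hinf_add Hphi Hpsi.
  apply: com_le; first exact: Hnorm_ge0.
  move=> n T adT; apply: com_bound => // z Oz.
  by rewrite /at_scalar /ncadd Ipsi // addr0.
have lbQ : has_lbound Q by exists (comnorm delta (at_scalar phi)) => r; exact: Q_ge.
(* The margin [e] makes the bound positive, as the extension requires, even if the commutative norm
   is 0. *)
have Q_ex e : 0 < e -> exists2 r, Q r & r <= comnorm delta (at_scalar phi) + e.
  move=> e0; have [|n T adT|psi [Hpsi psi_le psiE]] :=
    @com_extension (at_scalar phi) (comnorm delta (at_scalar phi) + e).
  - by rewrite ltr_wpDl.
  - by apply: le_trans (com_ge _ _ adT) _; rewrite lerDl ltW.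
  pose chi := ncadd psi (ncscale (-1) phi).
  have phichi : ncadd phi chi = psi.
    apply: functional_extensionality_dep => n; apply/funext => x.
    by rewrite /chi /ncadd /ncscale scaleN1r addrC subrK.
  exists (Hnorm delta psi) => //; exists chi; rewrite phichi; split.
    exact: (Hinf_add Hpsi (Hinf_scale (-1) Hphi)).
  split; last by [].
  move=> x Gx; have xE : x = scal (fun i => x i 0 0).
    by apply/funext => i; rewrite /scal -mx11_scalar.
  rewrite /chi /ncadd /ncscale scaleN1r (mx11_scalar (psi 1%N x)) (mx11_scalar (phi 1%N x)).
  rewrite xE in Gx *; have := psiE _ Gx; rewrite /at_scalar => ->.
  by rewrite subrr.
apply/le_anti/andP; split.
  apply: lb_le_inf => [|r]; last exact: Q_ge.
  by have [r Qr _] := Q_ex 1 ltr01; exists r.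
apply/ler_addgt0Pl => e e0; have [r Qr r_le] := Q_ex e e0.
by rewrite addrC; apply: le_trans r_le; apply: (ge_inf lbQ).
Qed.

End Quotient.

(* H^infty(G_delta)/I is isometrically isomorphic to H^infty_{delta,com}:
   equivalently (first isomorphism theorem), there is a surjective unital
   algebra homomorphism rho : H^infty(G_delta) -> H^infty_{delta,com} with
   kernel exactly I, such that ||rho phi||_com equals the quotient norm of
   phi + I. *)
Theorem theorem8p18 (R : realType) (d p q : nat)
    (delta : 'I_p -> 'I_q -> ncpoly R d) :
  exists rho : ncfun R d -> ('I_d -> R[i]) -> R[i],
    (forall phi, Hinf delta phi -> Hcom delta (rho phi)) /\
    (forall phi psi, Hinf delta phi -> Hinf delta psi ->
       eqOm delta (rho (ncadd phi psi)) (fun z => rho phi z + rho psi z)) /\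
    (forall phi psi, Hinf delta phi -> Hinf delta psi ->
       eqOm delta (rho (ncmul phi psi)) (fun z => rho phi z * rho psi z)) /\
    (forall (c : R[i]) phi, Hinf delta phi ->
       eqOm delta (rho (ncscale c phi)) (fun z => c * rho phi z)) /\
    eqOm delta (rho (@ncone R d)) (fun _ => 1) /\
    (forall phi, Hinf delta phi ->
       (eqOm delta (rho phi) (fun _ => 0) <-> inI delta phi)) /\
    (forall f, Hcom delta f -> exists phi, Hinf delta phi /\ eqOm delta (rho phi) f) /\
    (forall phi, Hinf delta phi -> comnorm delta (rho phi) = qnorm delta phi).
Proof.
exists (@at_scalar R d).
split; [|split; [|split; [|split; [|split; [|split; [|split]]]]]].
- by move=> phi Hphi; exact: Hcom_at_scalar.
- by move=> phi psi _ _ z _; rewrite /at_scalar mxE.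
- by move=> phi psi _ _ z _; rewrite /at_scalar mxE big_ord1.
- by move=> c phi _ z _; rewrite /at_scalar mxE.
- by move=> z _; rewrite /at_scalar mxE eqxx.
- move=> phi _; split=> [phi0 x Gx|phiI z Oz].
    have xE : x = scal (fun i => x i 0 0).
      by apply/funext => i; rewrite /scal -mx11_scalar.
    rewrite (mx11_scalar (phi 1%N x)); rewrite xE in Gx *.
    by have := phi0 _ Gx; rewrite /at_scalar => ->; rewrite -scalemx1 scale0r.
  by rewrite /at_scalar phiI // mxE.
(* [B] itself need not be positive. *)
- move=> f [_ [B fB]]; have B0 : 0 < `|B| + 1 by rewrite ltr_wpDl.
  have [n T adT|phi [Hphi _ phif]] := @com_extension R d p q delta f _ B0.
    apply: le_trans (fB n T adT) _.
    by apply: le_trans (ler_norm B) _; rewrite lerDl.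
  by exists phi.
- by move=> phi; exact: comnorm_eq_qnorm.
Qed.
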